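(* Let $k$ be a field, let $F$ be a non-cyclic free group, and let $\mathrm{Rel}\subseteq kF$ satisfy the Compatibility Axiom. Let $\mathrm{Mon}$ be the set of monomials of $\mathrm{Rel}$, let $\mathcal{S}$ be the set of small pieces with respect to $\mathrm{Rel}$, and let $\mathcal{S}'$ be the union of $\mathcal{S}$ and the set of all letters that belong to $\mathrm{Mon}$. Let $\Lambda'$ denote the measure on $\mathrm{Mon}$ defined by $\mathcal{S}'$. Let $\tau\geqslant 11$ and assume that $\mathrm{Rel}$ satisfies the Small Cancellation Axiom with constant $\tau$ and the Isolation Axiom with constant $\tau$, both with respect to $\mathcal{S}'$ (that is, with respect to $\Lambda'$-measure). Assume that there exist non-empty reduced words that do not belong to $\mathrm{Mon}$. Then the quotient ring $kF/\langle\langle \mathrm{Rel}\rangle\rangle$ contains a subalgebra that is isomorphic to the free associative algebra over $k$ with two free generators.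
   Context: **Words and polynomials.** A basis (set of free generators) of the free group $F$ is fixed; the free generators and their inverses are called letters. Elements of $F$, identified with reduced words, are called words or monomials; elements of the group algebra $kF$ are called polynomials. For monomials $A,B$, $A\cdot B$ is their product in $F$; $AB$ (without the dot) denotes the product when there is no cancellation. $1$ is the empty word. $\langle\langle \mathrm{Rel}\rangle\rangle$ is the two-sided ideal of $kF$ generated by $\mathrm{Rel}$. $\mathrm{Mon}\subseteq F$ is the set of all monomials that occur with non-zero coefficient in some polynomial of $\mathrm{Rel}$. **Compatibility Axiom.** $\mathrm{Rel}$ is closed under multiplication by elements of $k$, and under left (respectively right) multiplication by a letter that cancels with the first (respectively last) letter of some monomial of the polynomial: if $p\in\mathrm{Rel}$ has a monomial beginning with the letter $x$, then $x^{-1}\cdot p\in\mathrm{Rel}$, and if $p$ has a monomial ending with $x$, then $p\cdot x^{-1}\in\mathrm{Rel}$. (Consequently $\mathrm{Mon}$ is closed under taking subwords.) **Small pieces.** Let $c\in\mathrm{Mon}$. Suppose there are $p,q\in\mathrm{Rel}$ such that $p$ contains a monomial $\widehat a_1c\widehat a_2$ and $q$ contains a monomial $\widehat b_1c\widehat b_2$ (the words $\widehat a_i,\widehat b_i$ may be empty) and at least one of $\widehat b_1\cdot\widehat a_1^{-1}\cdot p$ and $p\cdot\widehat a_2^{-1}\cdot\widehat b_2$ is not in $\mathrm{Rel}$. Then $c$ is called a small piece with respect to $\mathrm{Rel}$. The empty word is by definition always a small piece. The set of small pieces is $\mathcal{S}$; it is closed under taking subwords, and so is $\mathcal{S}'$.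 **Measure.** For $u\in\mathrm{Mon}$, $\Lambda'(u)$ is the smallest $t$ such that $u$ is a concatenation of $t$ elements of $\mathcal{S}'$ ($\infty$ if there is no such $t$). **Small Cancellation Axiom with constant $\tau$ (with respect to $\mathcal{S}'$).** If $q_1,\dots,q_n\in\mathrm{Rel}$ and a linear combination $\sum_l\gamma_lq_l$ ($\gamma_l\in k$) is non-zero after additive cancellations, then some monomial $a$ that has a non-zero coefficient in it after additive cancellations satisfies: either $a$ cannot be represented as a product (concatenation) of elements of $\mathcal{S}'$, or every such representation contains at least $\tau+1$ factors. That is, $\Lambda'(a)\geqslant\tau+1$. **Incident monomials; maximal occurrences.** Two monomials are incident if they both occur in one and the same polynomial of $\mathrm{Rel}$. An occurrence of $u\in\mathrm{Mon}$ in a word $A$ is a subword $u$ of $A$ together with its position. It is maximal if it is not properly contained in another occurrence in $A$ of an element of $\mathrm{Mon}$. **Isolation Axiom with constant $\tau$ (with respect to $\mathcal{S}'$).** It consists of a left-sided and a right-sided condition. *Left-sided.* Let $m_1,\dots,m_K\in\mathrm{Mon}$ be such that $m_1\neq m_K$, $m_i,m_{i+1}$ are incident for $1\leqslant i<K$, and $\Lambda'(m_i)\geqslant\tau-2$ for all $i$. Let $a\in\mathrm{Mon}$ be such that: $\Lambda'(a)\geqslant\tau-2$; the products $am_1$ and $am_K$ have no cancellations and $am_1,am_K\notin\mathrm{Mon}$; $m_1$ is a maximal occurrence in $am_1$ and $m_K$ is a maximal occurrence in $am_K$. Let $ap_1$ be the maximal occurrence in $am_1$ containing $a$ and $ap_K$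 the maximal occurrence in $am_K$ containing $a$ (so $p_1$ is a possibly empty prefix of $m_1$ and $p_K$ is a possibly empty prefix of $m_K$). Assume there exist $l,l'\in\mathcal{S}'$ such that $la$ and $l'a$ have no cancellations and belong to $\mathrm{Mon}$, and a sequence $b_1,\dots,b_n\in\mathrm{Mon}$ with $b_1=lap_1$, $b_n=l'ap_K$, $b_i,b_{i+1}$ incident for $1\leqslant i<n$, and $\Lambda'(b_i)\geqslant\tau-2$ for all $i$. Then it is required that $p_1^{-1}\cdot m_1\neq p_K^{-1}\cdot m_K$. *Right-sided.* The mirror image: $a$ is placed to the right of $m_1,m_K$ (words $m_1a$, $m_Ka$); $p_1a$, $p_Ka$ are the maximal occurrences containing $a$ (with $p_1,p_K$ suffixes of $m_1,m_K$); there are $r,r'\in\mathcal{S}'$ with $ar,ar'\in\mathrm{Mon}$ without cancellations; the sequence $b_1,\dots,b_n$ goes from $b_1=p_1ar$ to $b_n=p_Kar'$; and it is required that $m_1\cdot p_1^{-1}\neq m_K\cdot p_K^{-1}$. *)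

(* Defs.v *)
From HB Require Import structures.
From mathcomp Require Import all_boot all_order all_algebra.
From mathcomp Require Import finmap boolp classical_sets.
From mathcomp.multinomials Require Import monalg.

Set Implicit Arguments.
Unset Strict Implicit.
Unset Printing Implicit Defensive.

Import GRing.Theory.

Local Open Scope classical_set_scope.
Local Open Scope ring_scope.
Local Open Scope quotient_scope.

Section Letters.
Variable X : choiceType.

(* (x, false) is the free generator x, (x, true) its inverse. *)
Definition letter := (X * bool)%type.

Definition linv (a : letter) : letter := (a.1, ~~ a.2).

Definition reduced (w : seq letter) : bool :=
  sorted (fun a b => b != linv a) w.

Definition consl (a : letter) (w : seq letter) : seq letter :=
  if w is b :: w' then if b == linv a then w' else a :: w else [:: a].

Definition mulw (u v : seq letter) : seq letter := foldr consl v u.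

Definition invw (u : seq letter) : seq letter := rev (map linv u).

Lemma linvK : involutive linv.
Proof. by case=> x b; rewrite /linv /= negbK. Qed.

Lemma reduced_cons a w : reduced (a :: w) -> reduced w.
Proof. by case: w => //= b w /andP[]. Qed.

Lemma reduced_consl a w : reduced w -> reduced (consl a w).
Proof.
case: w => //= b w rw; case: ifP => [_|/negbT nb].
  exact: (@reduced_cons b).
by rewrite /reduced /= nb.
Qed.

Lemma conslE a w : reduced (a :: w) -> consl a w = a :: w.
Proof. by case: w => //= b w /andP[/negPf->]. Qed.

Lemma conslK a w : reduced w -> consl a (consl (linv a) w) = w.
Proof.
case: w => [|b w] rw /=; first by rewrite eqxx.
rewrite linvK; case: eqP => [eba|_] /=; last by rewrite eqxx.
by rewrite -eba conslE.
Qed.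

Lemma reduced_mulw u v : reduced v -> reduced (mulw u v).
Proof. by move=> rv; elim: u => //= a u IH; apply: reduced_consl. Qed.

Lemma reduced_invw u : reduced u -> reduced (invw u).
Proof.
rewrite /reduced /invw rev_sorted sorted_map.
apply: sub_sorted => a b /=; apply: contra => /eqP ->.
by rewrite !linvK.
Qed.

Lemma mulw_consl a v w : reduced v -> reduced w ->
  mulw (consl a v) w = consl a (mulw v w).
Proof.
case: v => [|b v] rv rw //=; case: ifP => //= /eqP ->.
by rewrite conslK // reduced_mulw.
Qed.

Lemma mulwA u v w : reduced v -> reduced w ->
  mulw u (mulw v w) = mulw (mulw u v) w.
Proof.
move=> rv rw; elim: u => //= a u ->.
by rewrite mulw_consl // reduced_mulw.
Qed.

Lemma mulw1 u : reduced u -> mulw u [::] = u.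
Proof.
elim: u => //= a u IH ru; rewrite IH ?conslE //.
exact: reduced_cons ru.
Qed.

Lemma mulVw u : mulw (invw u) u = [::].
Proof.
elim: u => //= a u IH; rewrite /invw /= rev_cons /mulw foldr_rcons /=.
by rewrite linvK eqxx.
Qed.

End Letters.

Record freegroup (X : choiceType) :=
  FreeWord { word :> seq (letter X); _ : reduced word }.

Section FreeGroup.
Variable X : choiceType.

HB.instance Definition _ := [isSub for @word X].
HB.instance Definition _ := [Choice of freegroup X by <:].

Implicit Types u v w : freegroup X.

Lemma word_reduced u : reduced u. Proof. exact: valP u. Qed.

Definition fg_one : freegroup X := FreeWord (isT : reduced (Nil (letter X))).
Definition fg_mul u v : freegroup X :=
  FreeWord (reduced_mulw u (word_reduced v)).
Definition fg_inv u : freegroup X := FreeWord (reduced_invw (word_reduced u)).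

Lemma fg_mulA : associative fg_mul.
Proof. by move=> u v w; apply/val_inj/mulwA; apply: word_reduced. Qed.

Lemma fg_mul1 : left_id fg_one fg_mul.
Proof. by move=> u; apply/val_inj. Qed.

Lemma fg_mulr1 : right_id fg_one fg_mul.
Proof. by move=> u; apply/val_inj/mulw1/word_reduced. Qed.

Lemma fg_mulV : left_inverse fg_one fg_inv fg_mul.
Proof. by move=> u; apply/val_inj/mulVw. Qed.

Lemma fg_invK : involutive fg_inv.
Proof.
move=> u; apply/val_inj; rewrite /= /invw map_rev revK -map_comp.
by rewrite map_id_in // => a _; apply: linvK.
Qed.

Lemma fg_mulrV : right_inverse fg_one fg_inv fg_mul.
Proof. by move=> u; rewrite -{1}(fg_invK u) fg_mulV. Qed.

HB.instance Definition _ := isGroup.Build (freegroup X)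
  fg_mulA fg_mul1 fg_mulr1 fg_mulV fg_mulrV.

End FreeGroup.

Definition cyclic_group (G : groupType) : Prop :=
  exists g : G, forall h : G, exists n : nat, h = (g ^+ n)%g \/ h = (g ^- n)%g.

(* The algebra structure of {malg k[K]} provided by the library requires K to
   be a monoid without non-trivial units, hence the alias. *)
Definition galg (k : fieldType) (G : groupType) := {malg k[G]}.

Section GroupAlgebra.
Variables (k : fieldType) (G : groupType).

HB.instance Definition _ := GRing.Lmodule.on (galg k G).

Implicit Types p q r : galg k G.

Definition gmono (x : G) : galg k G := << x >>.

Definition gmul p q : galg k G :=
  \sum_(x <- msupp p) \sum_(y <- msupp q) << p@_x * q@_y *g (x * y)%g >>.

Lemma gmulw (d1 d2 : {fset G}) p q :
  (msupp p `<=` d1)%fset -> (msupp q `<=` d2)%fset ->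
  gmul p q = \sum_(x <- d1) \sum_(y <- d2) << p@_x * q@_y *g (x * y)%g >>.
Proof.
move=> le1 le2; rewrite /gmul (big_fset_incl _ le1) /=.
  apply/eq_bigr=> x _; apply/big_fset_incl => // y _ /mcoeff_outdom ->.
  by rewrite mulr0 monalgU0.
move=> x _ /mcoeff_outdom px.
by rewrite big1 => // y _; rewrite px mul0r monalgU0.
Qed.

Lemma gmul0 : left_zero 0 gmul.
Proof. by move=> p; rewrite /gmul msupp0 big_seq_fset0. Qed.

Lemma gmulr0 : right_zero 0 gmul.
Proof.
by move=> p; rewrite /gmul big1 // => x _; rewrite msupp0 big_seq_fset0.
Qed.

Lemma gmulDl : left_distributive gmul +%R.
Proof.
move=> p q r.
rewrite (gmulw (msuppD_le p q) (fsubset_refl (msupp r))).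
rewrite (gmulw (fsubsetUl (msupp p) (msupp q)) (fsubset_refl (msupp r))).
rewrite (gmulw (fsubsetUr (msupp p) (msupp q)) (fsubset_refl (msupp r))).
rewrite -big_split /=; apply/eq_bigr=> x _.
rewrite -big_split /=; apply/eq_bigr=> y _.
by rewrite mcoeffD mulrDl monalgUD.
Qed.

Lemma gmulDr : right_distributive gmul +%R.
Proof.
move=> r p q.
rewrite (gmulw (fsubset_refl (msupp r)) (msuppD_le p q)).
rewrite (gmulw (fsubset_refl (msupp r)) (fsubsetUl (msupp p) (msupp q))).
rewrite (gmulw (fsubset_refl (msupp r)) (fsubsetUr (msupp p) (msupp q))).
rewrite -big_split /=; apply/eq_bigr=> x _.
rewrite -big_split /=; apply/eq_bigr=> y _.
by rewrite mcoeffD mulrDr monalgUD.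
Qed.

Lemma gmulUU (c d : k) (x y : G) :
  gmul << c *g x >> << d *g y >> = << c * d *g (x * y)%g >>.
Proof. by rewrite (gmulw msuppU_le msuppU_le) !big_seq_fset1 !mcoeffUU. Qed.

Lemma gmul_suml (I : Type) (s : seq I) (F : I -> galg k G) q :
  gmul (\sum_(i <- s) F i) q = \sum_(i <- s) gmul (F i) q.
Proof. exact: (big_morph (gmul^~ q) (fun _ _ => gmulDl _ _ _) (gmul0 q)). Qed.

Lemma gmul_sumr (I : Type) (s : seq I) (F : I -> galg k G) p :
  gmul p (\sum_(i <- s) F i) = \sum_(i <- s) gmul p (F i).
Proof. exact: (big_morph (gmul p) (fun _ _ => gmulDr _ _ _) (gmulr0 p)). Qed.

Lemma gmulA : associative gmul.
Proof.
move=> p q r; rewrite [p]monalgE; move: (msupp p) => sp.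
rewrite (gmul_suml sp _ (gmul q r)) (gmul_suml sp _ q) (gmul_suml sp _ r).
apply: eq_bigr => x _; rewrite [q]monalgE; move: (msupp q) => sq.
rewrite (gmul_suml sq _ r) (gmul_sumr sq _ << p@_x *g x >>).
rewrite (gmul_sumr sq _ << p@_x *g x >>) (gmul_suml sq _ r).
apply: eq_bigr => y _; rewrite [r]monalgE; move: (msupp r) => sr.
rewrite (gmul_sumr sr _ << q@_y *g y >>) (gmul_sumr sr _ << p@_x *g x >>).
rewrite (gmul_sumr sr _ (gmul _ _)); apply: eq_bigr => z _.
by rewrite !gmulUU mulrA mulgA.
Qed.

Lemma gmul1 : left_id (gmono 1%g) gmul.
Proof.
move=> p; rewrite [p]monalgE gmul_sumr; apply: eq_bigr => x _.
by rewrite gmulUU mul1r mul1g.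
Qed.

Lemma gmulr1 : right_id (gmono 1%g) gmul.
Proof.
move=> p; rewrite [p]monalgE gmul_suml; apply: eq_bigr => x _.
by rewrite gmulUU mulr1 mulg1.
Qed.

Lemma gmono1_neq0 : gmono 1%g != 0.
Proof. by rewrite monalgU_eq0 oner_eq0. Qed.

HB.instance Definition _ := GRing.Zmodule_isNzRing.Build (galg k G)
  gmulA gmul1 gmulr1 gmulDl gmulDr gmono1_neq0.

Lemma gscaleU (c d : k) (x : G) : c *: << d *g x >> = << c * d *g x >>.
Proof. by apply/malgP => y; rewrite mcoeffZ !mcoeffU mulrnAr. Qed.

Lemma gmul_scalel (c : k) p q : gmul (c *: p) q = c *: gmul p q.
Proof.
rewrite (gmulw (msuppZ_le c p) (fsubset_refl (msupp q))) /gmul scaler_sumr.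
apply: eq_bigr => x _; rewrite scaler_sumr; apply: eq_bigr => y _.
by rewrite mcoeffZ gscaleU mulrA.
Qed.

Lemma gmul_scaler (c : k) p q : gmul p (c *: q) = c *: gmul p q.
Proof.
rewrite (gmulw (fsubset_refl (msupp p)) (msuppZ_le c q)) /gmul scaler_sumr.
apply: eq_bigr => x _; rewrite scaler_sumr; apply: eq_bigr => y _.
by rewrite mcoeffZ gscaleU mulrCA.
Qed.

Lemma gscaleAl (c : k) p q : c *: (p * q) = (c *: p) * q.
Proof. by rewrite [RHS]gmul_scalel. Qed.

Lemma gscaleAr (c : k) p q : c *: (p * q) = p * (c *: q).
Proof. by rewrite [RHS]gmul_scaler. Qed.

HB.instance Definition _ := GRing.Lmodule_isLalgebra.Build k (galg k G)
  gscaleAl.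
HB.instance Definition _ := GRing.Lalgebra_isAlgebra.Build k (galg k G)
  gscaleAr.

End GroupAlgebra.

Section QuotientAlgebra.
Variables (k : fieldType) (A : algType k).

Definition two_sided_ideal (I : set A) : Prop :=
  [/\ I 0,
      forall x y, I x -> I y -> I (x + y),
      forall a x, I x -> I (a * x) &
      forall a x, I x -> I (x * a)].

Definition gen_ideal (S : set A) : set A :=
  [set x | forall I, two_sided_ideal I -> S `<=` I -> I x].

Lemma gen_idealP S : two_sided_ideal (gen_ideal S).
Proof.
split=> [I [] //|x y Sx Sy I iI SI|a x Sx I iI SI|a x Sx I iI SI];
  case: (iI) => I0 ID Il Ir.
- by apply: ID; [apply: Sx | apply: Sy].
- by apply: Il; apply: Sx.
- by apply: Ir; apply: Sx.
Qed.

Definition ideal_pred (S : set A) : {pred A} := fun x => `[< gen_ideal S x >].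

Lemma ideal_predP S x : reflect (gen_ideal S x) (x \in ideal_pred S).
Proof. exact: asboolP. Qed.

Lemma ideal_pred_zmod S : zmod_closed (ideal_pred S).
Proof.
have [I0 ID Il _] := gen_idealP S; split; first exact/ideal_predP.
move=> x y /ideal_predP Sx /ideal_predP Sy; apply/ideal_predP.
by rewrite -mulN1r; apply: ID => //; apply: Il.
Qed.

HB.instance Definition _ (S : set A) :=
  GRing.isZmodClosed.Build A (ideal_pred S) (ideal_pred_zmod S).

(* The library equips quotients with a ring structure only for proper ideals
   of commutative rings.  Here the ideal may be improper, so the quotient is
   only known to be a pzRingType. *)
Definition quot_alg (S : set A) := (@Quotient.quot A (ideal_pred S)).

Variable S : set A.
Local Notation Q := (quot_alg S).

HB.instance Definition _ := GRing.Zmodule.on Q.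

Definition toq (x : A) : Q := \pi_(@Quotient.quot A (ideal_pred S)) x.

Lemma toqP x y : reflect (gen_ideal S (x - y)) (toq x == toq y).
Proof. by rewrite -[_ == _]Quotient.idealrBE; apply: ideal_predP. Qed.

Lemma toq_repr (x : Q) : toq (repr x) = x.
Proof. exact: reprK. Qed.

Lemma toqD x y : toq (x + y) = toq x + toq y.
Proof. exact: Quotient.pi_add. Qed.

Definition qone : Q := toq 1.
Definition qmul (x y : Q) : Q := toq (repr x * repr y).
Definition qscale (c : k) (x : Q) : Q := toq (c *: repr x).

Lemma toq_reprP x : gen_ideal S (repr (toq x) - x).
Proof. by apply/toqP; rewrite toq_repr. Qed.

Lemma toqM x y : toq (x * y) = qmul (toq x) (toq y).
Proof.
apply/esym/eqP/toqP; have [_ ID Il Ir] := gen_idealP S.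
have -> : repr (toq x) * repr (toq y) - x * y =
    (repr (toq x) - x) * repr (toq y) + x * (repr (toq y) - y).
  by rewrite mulrBl mulrBr addrA subrK.
by apply: ID; [apply: Ir | apply: Il]; apply: toq_reprP.
Qed.

Lemma toqZ c x : toq (c *: x) = qscale c (toq x).
Proof.
apply/esym/eqP/toqP; have [_ ID Il Ir] := gen_idealP S.
by rewrite -scalerBr -mulr_algl; apply: Il; apply: toq_reprP.
Qed.

Lemma qmulA : associative qmul.
Proof.
move=> x y z; rewrite -(toq_repr x) -(toq_repr y) -(toq_repr z).
by rewrite -!toqM mulrA.
Qed.

Lemma qmul1 : left_id qone qmul.
Proof. by move=> x; rewrite -(toq_repr x) -toqM mul1r. Qed.

Lemma qmulr1 : right_id qone qmul.
Proof. by move=> x; rewrite -(toq_repr x) -toqM mulr1. Qed.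

Lemma qmulDl : left_distributive qmul +%R.
Proof.
move=> x y z; rewrite -(toq_repr x) -(toq_repr y) -(toq_repr z).
by rewrite -toqD -!toqM mulrDl toqD.
Qed.

Lemma qmulDr : right_distributive qmul +%R.
Proof.
move=> x y z; rewrite -(toq_repr x) -(toq_repr y) -(toq_repr z).
by rewrite -toqD -!toqM mulrDr toqD.
Qed.

HB.instance Definition _ := GRing.Zmodule_isPzRing.Build Q
  qmulA qmul1 qmulr1 qmulDl qmulDr.

Lemma qscaleA a b x : qscale a (qscale b x) = qscale (a * b) x.
Proof. by rewrite -(toq_repr x) -!toqZ scalerA. Qed.

Lemma qscale1 : left_id 1 qscale.
Proof. by move=> x; rewrite -(toq_repr x) -toqZ scale1r. Qed.

Lemma qscaleDr : right_distributive qscale +%R.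
Proof.
move=> c x y; rewrite -(toq_repr x) -(toq_repr y).
by rewrite -toqD -!toqZ scalerDr toqD.
Qed.

Lemma qscaleDl x : {morph qscale^~ x : a b / a + b}.
Proof.
by move=> a b; rewrite /= -(toq_repr x) -!toqZ scalerDl toqD.
Qed.

HB.instance Definition _ := GRing.Zmodule_isLmodule.Build k Q
  qscaleA qscale1 qscaleDr qscaleDl.

Lemma qscaleAl (c : k) (x y : Q) : c *: (x * y) = (c *: x) * y.
Proof.
rewrite -(toq_repr x) -(toq_repr y).
by rewrite /GRing.scale /GRing.mul /= -!(toqM, toqZ) scalerAl.
Qed.

Lemma qscaleAr (c : k) (x y : Q) : c *: (x * y) = x * (c *: y).
Proof.
rewrite -(toq_repr x) -(toq_repr y).
by rewrite /GRing.scale /GRing.mul /= -!(toqM, toqZ) scalerAr.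
Qed.

End QuotientAlgebra.

(* Free associative algebra on I: the algebra of the free monoid on I. *)
Notation free_algebra k I := {malg k[{fmonom I}]}.

Section SmallCancellation.
Variables (k : fieldType) (X : choiceType).
Local Notation F := (freegroup X).
Local Notation kF := (galg k F).
Variable Rel : set kF.

(* Monomials are elements of F, coerced to reduced words; the product A . B is
   (A * B)%g, while AB is the concatenation A ++ B of words. *)
Definition nocancel (A B : F) : Prop := reduced (A ++ B).

Definition Mon : set F := [set w | exists2 p, Rel p & w \in msupp p].

Definition compatibility_axiom : Prop :=
  [/\ forall (c : k) p, Rel p -> Rel (c *: p),
      forall p (x w : F), Rel p -> size x = 1%N -> w \in msupp p ->
        prefix x w -> Rel (gmono k x^-1%g * p) &
      forall p (x w : F), Rel p -> size x = 1%N -> w \in msupp p ->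
        suffix x w -> Rel (p * gmono k x^-1%g)].

Definition small_piece : set F :=
  [set c | c = 1%g \/
    (Mon c /\ exists p q a w (a1 a2 b1 b2 : F),
      [/\ Rel p /\ Rel q,
          a \in msupp p /\ a = a1 ++ c ++ a2 :> seq (letter X),
          w \in msupp q /\ w = b1 ++ c ++ b2 :> seq (letter X) &
          ~ Rel (gmono k (b1 * a1^-1)%g * p) \/
          ~ Rel (p * gmono k (a2^-1 * b2)%g)])].

Definition small_piece_or_letter : set F :=
  small_piece `|` [set c | Mon c /\ size c = 1%N].

Definition concat_of (S : set F) (u : F) (t : nat) : Prop :=
  exists s : seq F,
    [/\ size s = t, forall v, v \in s -> S v &
        u = flatten [seq word v | v <- s] :> seq (letter X)].

(* None stands for infinity; the empty word is the concatenation of 0 words. *)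
Definition Lambda (S : set F) (u : F) : option nat :=
  if pselect (exists t, `[< concat_of S u t >]) is left e
  then Some (ex_minn e) else None.

Definition le_inf (t : nat) (m : option nat) : Prop :=
  if m is Some n then (t <= n)%N else True.

Definition small_cancellation_axiom (S : set F) (tau : nat) : Prop :=
  forall (n : nat) (q : 'I_n -> kF) (g : 'I_n -> k),
    (forall i, Rel (q i)) -> \sum_i g i *: q i != 0 ->
    exists2 a, a \in msupp (\sum_i g i *: q i) & le_inf tau.+1 (Lambda S a).

Definition incident (u v : F) : Prop :=
  exists p, [/\ Rel p, u \in msupp p & v \in msupp p].

(* i is the position at which the occurrence of u starts in A. *)
Definition occurrence (A u : F) (i : nat) : Prop :=
  exists L R : seq (letter X),
    size L = i /\ A = L ++ u ++ R :> seq (letter X).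

Definition maximal_occurrence (A u : F) (i : nat) : Prop :=
  [/\ Mon u, occurrence A u i &
      forall (v : F) (j : nat), Mon v -> occurrence A v j ->
        (j <= i)%N -> (i + size u <= j + size v)%N -> v = u /\ j = i].

(* m 1, ..., m K; the other values of m are irrelevant. *)
Definition incident_chain (S : set F) (t K : nat) (m : nat -> F) : Prop :=
  [/\ (1 <= K)%N,
      forall i, (1 <= i <= K)%N -> Mon (m i) /\ le_inf t (Lambda S (m i)) &
      forall i, (1 <= i < K)%N -> incident (m i) (m i.+1)].

Definition left_isolation_axiom (S : set F) (tau : nat) : Prop :=
  forall (K : nat) (m : nat -> F) (a p1 pK : F),
    incident_chain S (tau - 2) K m -> m 1%N <> m K ->
    Mon a -> le_inf (tau - 2) (Lambda S a) ->
    nocancel a (m 1%N) -> nocancel a (m K) ->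
    ~ Mon (a * m 1%N)%g -> ~ Mon (a * m K)%g ->
    maximal_occurrence (a * m 1%N)%g (m 1%N) (size a) ->
    maximal_occurrence (a * m K)%g (m K) (size a) ->
    prefix p1 (m 1%N) -> maximal_occurrence (a * m 1%N)%g (a * p1)%g 0 ->
    prefix pK (m K) -> maximal_occurrence (a * m K)%g (a * pK)%g 0 ->
    (exists (l l' : F) (n : nat) (b : nat -> F),
      [/\ S l /\ S l',
          nocancel l a /\ Mon (l * a)%g,
          nocancel l' a /\ Mon (l' * a)%g,
          incident_chain S (tau - 2) n b &
          b 1%N = l ++ a ++ p1 :> seq (letter X) /\
          b n = l' ++ a ++ pK :> seq (letter X)]) ->
    (p1^-1 * m 1%N)%g <> (pK^-1 * m K)%g.

Definition right_isolation_axiom (S : set F) (tau : nat) : Prop :=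
  forall (K : nat) (m : nat -> F) (a p1 pK : F),
    incident_chain S (tau - 2) K m -> m 1%N <> m K ->
    Mon a -> le_inf (tau - 2) (Lambda S a) ->
    nocancel (m 1%N) a -> nocancel (m K) a ->
    ~ Mon (m 1%N * a)%g -> ~ Mon (m K * a)%g ->
    maximal_occurrence (m 1%N * a)%g (m 1%N) 0 ->
    maximal_occurrence (m K * a)%g (m K) 0 ->
    suffix p1 (m 1%N) ->
    maximal_occurrence (m 1%N * a)%g (p1 * a)%g (size (m 1%N) - size p1) ->
    suffix pK (m K) ->
    maximal_occurrence (m K * a)%g (pK * a)%g (size (m K) - size pK) ->
    (exists (r r' : F) (n : nat) (b : nat -> F),
      [/\ S r /\ S r',
          nocancel a r /\ Mon (a * r)%g,
          nocancel a r' /\ Mon (a * r')%g,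
          incident_chain S (tau - 2) n b &
          b 1%N = p1 ++ a ++ r :> seq (letter X) /\
          b n = pK ++ a ++ r' :> seq (letter X)]) ->
    (m 1%N * p1^-1)%g <> (m K * pK^-1)%g.

Definition isolation_axiom (S : set F) (tau : nat) : Prop :=
  left_isolation_axiom S tau /\ right_isolation_axiom S tau.

End SmallCancellation.

(* Main.v *)
(* Only the right-sided half of the Isolation Axiom is used.

   Call an occurrence A m B of a monomial m robust if it is maximal and still has
   measure at least tau - 2 after the parts shared with its neighbours are cut
   off.  Replacing m by an incident robust monomial m' does not change which
   other positions of the word are robust, and two replacements at different
   positions commute: the first one multiplies the second monomial by a group
   element, and multiplication by this element keeps the polynomial in Rel, as
   the rest of the monomial is not a small piece.

   Words are ordered by the cost of an optimal factorization into pieces and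
   monomials, then by the number of robust positions, then, position by position
   from left to right, by the class of the position under the replacements made
   on its right, in an arbitrary well-order of the classes.  The Small
   Cancellation Axiom turns every non-zero A p B with p in Rel into a combination
   of words with at least one robust position, and right isolation says that the
   members of a chain of incident monomials at a given position have distinct
   classes, so that this combination has a unique leading word.  Two combinations
   with the same leading word differ by combinations of smaller words, as the
   replacements commute.  Hence the rewriting of leading words gives a linear
   normal form that vanishes on the ideal and fixes the words without robust
   positions.

   Finally let w be a non-monomial of minimal length.  Its proper subwords are
   products of two pieces, so for two letters s1, s2 that do not cancel against w
   a monomial occurring in a product of words w s1 and w s2 is a product of five
   pieces.  These products have no robust positions, hence are linearly
   independent modulo the ideal, and w s1, w s2 freely generate. *)

Require Import Defs.
From HB Require Import structures.
From mathcomp Require Import all_boot all_order all_algebra.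
From mathcomp Require Import finmap boolp classical_sets wochoice.
From mathcomp.multinomials Require Import monalg.
From mathcomp Require Import zify.

Set Implicit Arguments.
Unset Strict Implicit.
Unset Printing Implicit Defensive.

Import GRing.Theory.

(** * Factorization costs of words *)

(** Two scales of cost are needed. When monomials cost [K], the cost is additive at a maximal
    occurrence of measure above [K + 1]. At robust positions this holds for [K = 7], and a
    replacement by at most six pieces lowers that cost. A longer replacement loses at most one piece
    at each end by trimming, so it is still a position of threshold 4, which is what [K = 3]
    requires. The cost with [K = 3] thus survives every other replacement, and the cost of the
    prefix, unlike its length, is a name of a position that replacements elsewhere respect. The same
    loss of one piece at each end leads from [tau] to [tau - 2].

    The obstacle is overlap: neighbours may share a piece, so replacing one alters the other, whose
    measure could drift by a piece at each step of a chain. Measuring only the trimmed part stops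
    the drift.

    Confluence at two positions follows the pattern of coprime leading terms in Groebner basis
    theory: the difference of two products is rewritten so that in each term one factor has lost its
    leading monomial. Overlaps make the factors interact, which is why multipliers are transported
    along whole chains. *)

Section Pieces.
Variables (T : eqType) (M P : seq T -> Prop).
Implicit Types (A B U V a b c m u v w : seq T) (K t n : nat).

Definition sub_closed (Q : seq T -> Prop) := forall a b c, Q (a ++ b ++ c) -> Q b.

(** What the definition of small pieces leaves of [Rel] at the level of words; it is proved for
    [Mon] in [Mw_glue]. *)
Definition glueable :=
  forall a c b, ~ P c -> M (a ++ c) -> M (c ++ b) -> M (a ++ c ++ b).

(** The index is only an upper bound, so [~ Lam t w] says that the measure of [w] exceeds [t]. *)
Inductive Lam : nat -> seq T -> Prop :=
| Lam0 t : Lam t [::]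
| LamS t u v : P u -> Lam t v -> Lam t.+1 (u ++ v).

(* Pieces cost 1, elements of [M] cost [K].  Single letters may always be used,
   at cost [K], so that every word has a finite cost. *)
Inductive cle K : seq T -> nat -> Prop :=
| cle0 n : cle K [::] n
| cleP u v n : P u -> cle K v n -> cle K (u ++ v) n.+1
| cleM u v n : M u \/ size u <= 1 -> cle K v n -> cle K (u ++ v) (K + n).

Lemma cle_ex K U : exists n, `[< cle K U n >].
Proof.
suff [n h] : exists n, cle K U n by exists n; apply/asboolP.
elim: U => [|x U [n IH]]; first by exists 0; apply: cle0.
by exists (K + n); rewrite -cat1s; apply: cleM => //; right.
Qed.

Definition cost K U : nat := ex_minn (cle_ex K U).

Lemma cost_cle K U : cle K U (cost K U).
Proof. by rewrite /cost; case: ex_minnP => n /asboolP. Qed.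

Lemma cost_le K U n : cle K U n -> cost K U <= n.
Proof. by rewrite /cost; case: ex_minnP => m _ h /asboolP /h. Qed.

(** One-letter extensions suffice: as [M] is closed under subwords, any larger occurrence contains
    one of them. *)
Definition maxl A m := forall A' x, A = rcons A' x -> ~ M (x :: m).
Definition maxr m B := forall y B', B = y :: B' -> ~ M (rcons m y).
Definition maxocc A m B := [/\ M m, maxl A m & maxr m B].

Hypothesis M_sub : sub_closed M.
Hypothesis P_sub : sub_closed P.
Hypothesis P_nil : P [::].
Hypothesis MP_glue : glueable.

Lemma cat_split a b c d : a ++ b = c ++ d ->
  (exists e, c = a ++ e /\ b = e ++ d) \/
  (exists e, e <> [::] /\ (a = c ++ e /\ d = e ++ b)).
Proof.
elim: a c => [|x a IH] [|y c] //= E.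
- by left; exists [::]; rewrite E.
- by left; exists (y :: c).
- by right; exists (x :: a).
case: E => -> /IH[] [e]; first by case=> -> ->; left; exists e.
by case=> e0 [-> ->]; right; exists e.
Qed.

Lemma M_catl u v : M (u ++ v) -> M u. Proof. exact: (@M_sub [::]). Qed.
Lemma M_catr u v : M (u ++ v) -> M v.
Proof. by move=> h; apply: (@M_sub u v [::]); rewrite cats0. Qed.
Lemma P_catl u v : P (u ++ v) -> P u. Proof. exact: (@P_sub [::]). Qed.
Lemma P_catr u v : P (u ++ v) -> P v.
Proof. by move=> h; apply: (@P_sub u v [::]); rewrite cats0. Qed.

Lemma Lam_le t t' w : t <= t' -> Lam t w -> Lam t' w.
Proof.
move=> le h; elim: h t' le => {t w} [t t' _|t u v Pu _ IH [|t'] //]; first exact: Lam0.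
by rewrite ltnS => /IH h; apply: LamS.
Qed.

Lemma Lam1 w : Lam 1 w <-> P w.
Proof.
split=> [h|h]; last by rewrite -[w]cats0; apply: LamS => //; apply: Lam0.
inversion h; subst => //; match goal with H : Lam 0 _ |- _ => inversion H; subst end.
by rewrite cats0.
Qed.

Lemma Lam_cat s t u v : Lam s u -> Lam t v -> Lam (s + t) (u ++ v).
Proof.
elim=> {s u} [s|s u w Pu _ IH] h /=; first by apply: Lam_le h; rewrite leq_addl.
by rewrite addSn -catA; apply: LamS => //; apply: IH.
Qed.

Lemma Lam_catr t u v : Lam t (u ++ v) -> Lam t v.
Proof.
move E: (u ++ v) => w h; elim: h u v E => {t w} [t|t p w Pp hw IH] u v.
  by case: u => //= ->; apply: Lam0.
move=> /cat_split[] [e [E1 E2]].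
  by subst; apply: LamS => //; apply: P_catr Pp.
by case: E2 => E2 E3; apply: (@Lam_le t) => //; apply: (IH e).
Qed.

Lemma Lam_catl t u v : Lam t (u ++ v) -> Lam t u.
Proof.
move E: (u ++ v) => w h; elim: h u v E => {t w} [t|t p w Pp hw IH] u v.
  by case: u => //= _; apply: Lam0.
move=> /cat_split[] [e [E1 E2]].
  by subst; rewrite -[u]cats0; apply: LamS; [apply: P_catl Pp|apply: Lam0].
by case: E2 => -> E3; apply: LamS => //; apply: (IH _ v).
Qed.

Lemma cle_le K n n' w : n <= n' -> cle K w n -> cle K w n'.
Proof.
move=> le h; elim: h n' le => {n w} [n n' _|u v n Pu _ IH [|n'] //|u v n Mu _ IH n' le].
- exact: cle0.
- by rewrite ltnS => /IH h; apply: cleP.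
- have -> : n' = K + (n' - K) by lia.
  by apply: cleM => //; apply: IH; lia.
Qed.

Lemma cost_leP K U n : reflect (cle K U n) (cost K U <= n).
Proof. by apply: (iffP idP) => [h|/cost_le//]; apply: cle_le h (cost_cle _ _). Qed.

Lemma cost0 K : cost K [::] = 0.
Proof. by apply/eqP; rewrite -leqn0; apply/cost_le/cle0. Qed.

Lemma cost_cat K U V : cost K (U ++ V) <= cost K U + cost K V.
Proof.
apply: cost_le; elim: (cost_cle K U) => {U} [n|u v n Pu _ IH|u v n Mu _ IH].
- by apply: cle_le (cost_cle K V); rewrite leq_addl.
- by rewrite -catA; apply: cleP.
- by rewrite -catA -addnA; apply: cleM.
Qed.

Lemma cost_catr K U V : cost K V <= cost K (U ++ V).
Proof.
apply: cost_le; move E: (U ++ V) (cost_cle K (U ++ V)) => W.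
move=> h; move: (cost _ _) h => n h.
elim: h U V E => {W n} [n|p w n Pp hw IH|p w n Mp hw IH] U V.
- by case: U => //= ->; apply: cle0.
- move=> /cat_split[] [e [E1 E2]].
    by subst; apply: cleP => //; apply: P_catr Pp.
  by case: E2 => E2 E3; apply: (@cle_le K n) => //; apply: (IH e).
- move=> /cat_split[] [e [E1 E2]].
    subst; apply: cleM => //; case: Mp => [/M_catr|]; [by left|right].
    by move: b; rewrite size_cat; lia.
  by case: E2 => E2 E3; apply: (@cle_le K n); rewrite ?leq_addl //; apply: (IH e).
Qed.

Lemma cost_catl K U V : cost K U <= cost K (U ++ V).
Proof.
apply: cost_le; move E: (U ++ V) (cost_cle K (U ++ V)) => W.
move=> h; move: (cost _ _) h => n h.
elim: h U V E => {W n} [n|p w n Pp hw IH|p w n Mp hw IH] U V.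
- by case: U => //= _; apply: cle0.
- move=> /cat_split[] [e [E1 E2]].
    by subst; rewrite -[U]cats0; apply: cleP; [apply: P_catl Pp|apply: cle0].
  by case: E2 => -> E3; apply: cleP => //; apply: (IH _ V).
- move=> /cat_split[] [e [E1 E2]].
    subst; rewrite -[U]cats0; apply: cleM; last exact: cle0.
    case: Mp => [/M_catl|]; [by left|right].
    by move: b; rewrite size_cat; lia.
  by case: E2 => -> E3; apply: cleM => //; apply: (IH _ V).
Qed.

Lemma cost_gt0 K U : 0 < K -> U <> [::] -> 0 < cost K U.
Proof.
move=> K0 U0; rewrite lt0n; apply/eqP => E.
have := cost_cle K U; rewrite E; move En: 0 => n h.
by elim: h En U0 {E} => {U n} [|u v n Pu _ IH|u v n Mu _ IH] //; lia.
Qed.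

Lemma cost_Lam K t U : Lam t U -> cost K U <= t.
Proof. by move=> h; apply: cost_le; elim: h => [*|*]; [apply: cle0|apply: cleP]. Qed.

Lemma cost_M K U : M U -> cost K U <= K.
Proof.
move=> h; apply: cost_le; rewrite -[U]cats0 -[K in cle _ _ K]addn0.
by apply: cleM; [left|apply: cle0].
Qed.

(* Weaker than maximality, but inherited by the suffixes of [m]. *)
Definition trimR m B := forall m' y b B',
  m = m' ++ y -> B = b ++ B' -> b <> [::] -> M (y ++ b) -> P y.
Definition trimL A m := forall A' a x m',
  A = A' ++ a -> m = x ++ m' -> a <> [::] -> M (a ++ x) -> P x.

(** A monomial reaching beyond the right end of [m] and meeting [m] in a non-piece could be glued to
    [m], against maximality. *)
Lemma trimR_maxr m B : M m -> maxr m B -> trimR m B.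
Proof.
move=> Mm mx m' y [|b0 b] B' Em EB // _ Myb; apply: contrapT => Py.
apply: (mx b0 (b ++ B')); rewrite ?EB // Em -cats1 -catA.
apply: MP_glue => //; first by rewrite -Em.
by apply: (@M_catl _ b); rewrite -catA.
Qed.

Lemma trimL_maxl A m : M m -> maxl A m -> trimL A m.
Proof.
move=> Mm mx A' a x m' EA Em; case/lastP: a EA => // a a0 EA _ Max.
apply: contrapT => Px; apply: (mx (A' ++ a) a0); rewrite ?EA ?rcons_cat // Em -cat1s.
apply: MP_glue => //; last by rewrite -Em.
by apply: (@M_catr a); rewrite catA cats1.
Qed.

(** Follow a factorization from the left. A piece inside [m] lowers the cost and [t] by one, a
    factor of cost [K] inside [m] pays for all of [m], and a factor crossing the end of [m] covers
    only a piece of it. *)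
Lemma cost_catMr K m B t : trimR m B -> ~ Lam t m ->
  minn K t + cost K B <= cost K (m ++ B).
Proof.
move E: (m ++ B) (cost_cle K (m ++ B)) => W; move: (cost _ W) => n h.
elim: h m E t => {W n} [n|p w n Pp hw IH|p w n Mp hw IH] m.
- by case: m => //= _ t _ []; apply: Lam0.
- move=> /cat_split[] [e [E1 E2]] t tr nL.
    case: t nL => [|t] nL; last first.
      by case: nL; apply: (@Lam_le 1) => //; apply/Lam1; rewrite E1 in Pp; apply: P_catl Pp.
    rewrite minn0 E2; apply: leq_trans (cost_cat _ _ _) _.
    rewrite -add1n leq_add //; last exact: cost_le.
    by apply: (@cost_Lam _ 1); apply/Lam1; rewrite E1 in Pp; apply: P_catr Pp.
  case: E2 => E2 E3; case: t nL => [|t] nL.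
    have := IH e (esym E3) 0; rewrite !minn0; move=> h; apply: leq_trans (h _ _) _ => //.
    + by move=> m' y b B' Ee; apply: (tr (p ++ m')); rewrite E2 Ee catA.
    + by move=> L; apply: nL; rewrite E2; case: {+}E1; inversion L.
  have := IH e (esym E3) t _ _; move=> h.
  suff : minn K t + cost K B <= n by lia.
  apply: h.
  + by move=> m' y b B' Ee; apply: (tr (p ++ m')); rewrite E2 Ee catA.
  + by move=> L; apply: nL; rewrite E2; apply: LamS.
- move=> /cat_split[] [e [E1 E2]] t tr nL.
    have Pm : e <> [::] -> P m.
      move=> e0; case: Mp => [Mp|]; first by apply: (tr [::] m e w) => //; rewrite -E1.
      by move=> s; exfalso; apply: nL; move: s; rewrite E1 size_cat;
        case: (m) => [|? ?]; [move=> _; apply: Lam0|case: (e) e0 => //= ? ?; lia].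
    have [e0|/eqP e0] := eqVneq e [::].
      by rewrite E2 e0 /= leq_add ?geq_minl //; apply: cost_le.
    case: t nL => [|t] nL; last by case: nL; apply: (@Lam_le 1) => //; apply/Lam1/Pm.
    rewrite minn0 E2; apply: leq_trans (cost_cat _ _ _) _; rewrite leq_add //; last exact: cost_le.
    apply: cost_le; rewrite -[e]cats0 -[K in cle _ _ K]addn0; apply: cleM; last exact: cle0.
    case: Mp => [|]; rewrite E1; [by move=> /M_catr; left|right; move: b; rewrite size_cat; lia].
  case: E2 => E2 E3; apply: leq_add; first exact: geq_minl.
  apply: cost_le; move: (hw); rewrite E3 => h.
  by apply/cost_leP; apply: leq_trans (cost_catr _ e _) _; apply: cost_le.
Qed.

Lemma cost_split K A V :
  cost K A + cost K V <= cost K (A ++ V) \/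
  exists A1 u1 u2 V2 q, [/\ A = A1 ++ u1 /\ V = u2 ++ V2, u1 <> [::] /\ u2 <> [::],
    P (u1 ++ u2) /\ q = 1 \/ M (u1 ++ u2) /\ q = K &
    cost K A1 + q + cost K V2 <= cost K (A ++ V)].
Proof.
move E: (A ++ V) (cost_cle K (A ++ V)) => W; move: (cost _ W) => n h.
elim: h A V E => {W n} [n|p w n Pp hw IH|p w n Mp hw IH] A V.
- by case: A => //= ->; left; rewrite !cost0.
- move=> /cat_split[] [e [E1 E2]]; last first.
    case: E2 => E2 E3; case: (IH _ _ (esym E3)) => [le|].
      left; rewrite E2; have := cost_cat K p e.
      by have : cost K p <= 1 by [apply: (@cost_Lam _ 1); apply/Lam1]; lia.
    move=> [A1 [u1 [u2 [V2 [q [[EA EV] u0 hq le]]]]]]; right.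
    exists (p ++ A1), u1, u2, V2, q; split=> //; first by rewrite E2 EA catA.
    have := cost_cat K p A1; have : cost K p <= 1 by apply: (@cost_Lam _ 1); apply/Lam1.
    by lia.
  have lw := cost_le hw.
  have [A0|/eqP A0] := eqVneq A [::].
    left; rewrite A0 cost0 E2; move: E1; rewrite A0 /= => <-.
    apply: leq_trans (cost_cat _ _ _) _; rewrite -add1n leq_add //.
    by apply: (@cost_Lam _ 1); apply/Lam1.
  have [e0|/eqP e0] := eqVneq e [::].
    left; rewrite E2 e0 /= -add1n leq_add //.
    by apply: (@cost_Lam _ 1); apply/Lam1; rewrite E1 e0 cats0 in Pp.
  right; exists [::], A, e, w, 1; split=> //; last by rewrite cost0; lia.
  by left; rewrite -E1.
- move=> /cat_split[] [e [E1 E2]]; last first.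
    have cp : cost K p <= K.
      by apply: cost_le; rewrite -[p]cats0 -[K in cle _ _ K]addn0; apply: cleM; last exact: cle0.
    case: E2 => E2 E3; case: (IH _ _ (esym E3)) => [le|].
      by left; rewrite E2; have := cost_cat K p e; lia.
    move=> [A1 [u1 [u2 [V2 [q [[EA EV] u0 hq le]]]]]]; right.
    exists (p ++ A1), u1, u2, V2, q; split=> //; first by rewrite E2 EA catA.
    by have := cost_cat K p A1; lia.
  have lw := cost_le hw.
  have cp u v : u ++ v = p -> cost K u <= K /\ cost K v <= K.
    move=> Ep; split; apply: cost_le; [rewrite -[u]cats0|rewrite -[v]cats0];
    rewrite -[K in cle _ _ K]addn0; apply: cleM; try exact: cle0;
    case: Mp; rewrite -Ep.
    + by move=> /M_catl; left.
    + by rewrite size_cat; right; lia.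
    + by move=> /M_catr; left.
    + by rewrite size_cat; right; lia.
  have [cA ce] := cp _ _ (esym E1).
  have [A0|/eqP A0] := eqVneq A [::].
    by left; rewrite A0 cost0 E2; have := cost_cat K e w; lia.
  have [e0|/eqP e0] := eqVneq e [::].
    by left; rewrite E2 e0 /=; lia.
  right; exists [::], A, e, w, K; split=> //; last by rewrite cost0; lia.
  (* A factor of length at most one cannot have letters on both sides of the cut. *)
  right; split=> //; rewrite -E1; case: Mp => //; rewrite E1 size_cat.
  by case: (A) A0 => // ? ?; case: (e) e0 => //= ? ? _ _; lia.
Qed.

(** The extra 1 pays for the factor that may cross from [A] into [m]: it takes one piece off [m],
    and [cost_catMr] bounds the rest. *)
Lemma cost_maxocc_ge K A m B t : maxocc A m B -> ~ Lam t.+1 m ->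
  cost K A + minn K t + cost K B <= cost K (A ++ m ++ B).
Proof.
move=> [Mm ml mr] nL; have tr := trimR_maxr Mm mr; have tl := trimL_maxl Mm ml.
case: (cost_split K A (m ++ B)) => [le|].
  have : minn K t.+1 + cost K B <= cost K (m ++ B) by apply: cost_catMr.
  by lia.
move=> [A1 [u1 [u2 [V2 [q [[EA EV] [u10 u20] hq le]]]]]].
have [e0|] := cat_split EV.
  case: e0 => e [E1 E2]; exfalso; case: hq => [[Pu _]|[Mu _]].
    apply: nL; apply: (@Lam_le 1) => //; apply/Lam1.
    by apply: (@P_sub u1 m e); rewrite -E1.
  case/lastP: u1 EA u10 Mu => // u1 x EA _ Mu.
  apply: (ml (A1 ++ u1) x); first by rewrite EA rcons_cat.
  by apply: (@M_sub u1 _ e); rewrite /= -cat_rcons -E1.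
move=> [m1 [m10 [Em EV2]]].
have Pu2 : P u2.
  by case: hq => [[/P_catr //]|[Mu _]]; apply: (tl A1 u1 u2 m1) => //; rewrite -Em.
have : minn K t + cost K B <= cost K (m1 ++ B).
  apply: cost_catMr => [m2 y b B' Ee|L]; first by apply: (tr (u2 ++ m2)); rewrite Em Ee catA.
  by apply: nL; rewrite Em; apply: LamS.
have : cost K A <= cost K A1 + q.
  rewrite EA; apply: leq_trans (cost_cat _ _ _) _; rewrite leq_add2l.
  by case: hq => [[/P_catl Pu ->]|[/M_catl Mu ->]]; [apply: cost_Lam; apply/Lam1|apply: cost_M].
by rewrite -EV2; lia.
Qed.

(** The lower bound is attained by using [m] itself as a factor. *)
Lemma cost_maxocc K A m B : maxocc A m B -> ~ Lam K.+1 m ->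
  cost K (A ++ m ++ B) = cost K A + K + cost K B.
Proof.
move=> mx nL; apply/eqP; rewrite eqn_leq; apply/andP; split.
  have := cost_cat K A (m ++ B); have := cost_cat K m B.
  by case: mx => /(cost_M K) *; lia.
by have := cost_maxocc_ge K mx nL; rewrite minnn.
Qed.

End Pieces.

(** * Mirror images *)

Section Mirror.
Variables (T : eqType).
Implicit Types (M P Q : seq T -> Prop) (A B m u v w : seq T).

Definition flip Q : seq T -> Prop := fun w => Q (rev w).

Lemma flipK Q : flip (flip Q) = Q.
Proof. by apply/funext => w; rewrite /flip revK. Qed.

Lemma sub_closed_flip Q : sub_closed Q -> sub_closed (flip Q).
Proof. by move=> h a b c; rewrite /flip !rev_cat -catA; apply: h. Qed.

Lemma glueable_flip M P : glueable M P -> glueable (flip M) (flip P).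
Proof.
by move=> h a c b; rewrite /flip !rev_cat -catA => nP Mac Mcb; apply: h.
Qed.

Lemma Lam_flip P t w : P [::] -> Lam P t w -> Lam (flip P) t (rev w).
Proof.
move=> P0; elim=> {t w} [t|t u v Pu _ IH]; first exact: Lam0.
rewrite rev_cat -addn1; apply: Lam_cat => //; apply/Lam1 => //.
by rewrite /flip revK.
Qed.

Lemma Lam_flipE P t w : P [::] -> Lam (flip P) t w <-> Lam P t (rev w).
Proof.
move=> P0; split=> [/(@Lam_flip (flip P) _ _ P0)|/(Lam_flip P0)].
  by rewrite flipK.
by rewrite revK.
Qed.

Lemma cle_rcons M P K U q u : (P u /\ q = 1) \/ ((M u \/ size u <= 1) /\ q = K) ->
  forall n, cle M P K U n -> cle M P K (U ++ u) (n + q).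
Proof.
move=> hq n; elim=> {U n} [n|v w n Pv _ IH|v w n Mv _ IH] /=.
- rewrite -[u]cats0 addnC; case: hq => [[Pu ->]|[Mu ->]].
    by rewrite add1n; apply: cleP => //; apply: cle0.
  by apply: cleM => //; apply: cle0.
- by rewrite -catA addSn; apply: cleP.
- by rewrite -catA -addnA; apply: cleM.
Qed.

Lemma cle_flip M P K U n : cle M P K U n -> cle (flip M) (flip P) K (rev U) n.
Proof.
elim=> {U n} [n|v w n Pv _ IH|v w n Mv _ IH]; first exact: cle0.
- rewrite rev_cat -addn1; apply: cle_rcons => //; left.
  by rewrite /flip revK.
- rewrite rev_cat addnC; apply: cle_rcons => //; right.
  by rewrite /flip revK size_rev.
Qed.

Lemma cost_flip M P K U : cost (flip M) (flip P) K U = cost M P K (rev U).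
Proof.
apply/eqP; rewrite eqn_leq; apply/andP; split; apply: cost_le.
  by rewrite -{1}[U]revK; apply: cle_flip; apply: cost_cle.
by have := cle_flip (cost_cle (flip M) (flip P) K U); rewrite !flipK.
Qed.

Lemma maxl_flip M A m : maxl M A m -> maxr (flip M) (rev m) (rev A).
Proof.
move=> h y B' E; rewrite /flip rev_rcons revK; apply: (h (rev B')).
by rewrite -rev_cons -E revK.
Qed.

Lemma maxr_flip M m B : maxr M m B -> maxl (flip M) (rev B) (rev m).
Proof.
move=> h A' x E; rewrite /flip rev_cons revK; apply: (h _ (rev A')).
by rewrite -[LHS]revK E rev_rcons.
Qed.

Lemma maxocc_flip M A m B : maxocc M A m B -> maxocc (flip M) (rev B) (rev m) (rev A).
Proof.
move=> [Mm ml mr]; split; [by rewrite /flip revK|exact: maxr_flip|exact: maxl_flip].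
Qed.

End Mirror.

(** * Positions and their overlaps *)

Section Positions.
Variables (T : eqType) (M P : seq T -> Prop).
Implicit Types (A B U V a b c g m u v w z : seq T) (K t n : nat).
Hypothesis M_sub : sub_closed M.
Hypothesis P_sub : sub_closed P.
Hypothesis P_nil : P [::].
Hypothesis MP_glue : glueable M P.

Notation maxocc := (maxocc M).
Notation Lam := (Lam P).
Notation cost := (cost M P).
Notation C := (cost 3).

Lemma cost_catMl K A m t : trimL M P A m -> ~ Lam t m ->
  cost K A + minn K t <= cost K (A ++ m).
Proof.
move=> tl nL.
have := @cost_catMr T (flip M) (flip P) (sub_closed_flip M_sub)
  (sub_closed_flip P_sub) P_nil K (rev m) (rev A) t.
rewrite !cost_flip !rev_cat !revK [minn _ _ + _]addnC; apply.
- move=> m' y b B' Em EA b0; rewrite /flip rev_cat => Mby.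
  apply: (tl (rev B') (rev b) (rev y) (rev m')) => //.
  + by rewrite -[A]revK EA rev_cat.
  + by rewrite -[m]revK Em rev_cat.
  + by move=> h; apply: b0; rewrite -[b]revK h.
- by move/(Lam_flipE _ _ P_nil); rewrite revK.
Qed.

(* The parts [x] and [y] are those shared with the neighbours of [m]: they can
   be appended to [A], resp. prepended to [B], at no cost.  Trimming them makes
   the measure of [m] independent of what the neighbours are. *)
Definition position t A m B := maxocc A m B /\
  forall x m1 y, m = x ++ m1 ++ y -> C (A ++ x) = C A -> C (y ++ B) = C B -> ~ Lam t m1.

Notation pos := position.

Lemma pos_max t A m B : pos t A m B -> maxocc A m B. Proof. by case. Qed.

Lemma pos_Lam t A m B : pos t A m B -> ~ Lam t m.
Proof. by move=> [_ h]; apply: (h [::] m [::]); rewrite ?cats0. Qed.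

Lemma pos_le t t' A m B : t <= t' -> pos t' A m B -> pos t A m B.
Proof.
by move=> le [mx h]; split=> // x m1 y E EA EB L; apply: (h x m1 y E EA EB); apply: Lam_le L.
Qed.

Lemma trimL_prefix A x m : trimL M P A (x ++ m) -> trimL M P A x.
Proof. by move=> tl A' a x' m' EA Ex; apply: (tl A' a x' (m' ++ m)); rewrite // Ex catA. Qed.

Lemma trimR_suffix x m B : trimR M P (x ++ m) B -> trimR M P m B.
Proof. by move=> tr m' y b B' Em EB; apply: (tr (x ++ m') y b B'); rewrite // Em catA. Qed.

Lemma free_prefix A x m : trimL M P A (x ++ m) -> C (A ++ x) = C A -> P x.
Proof.
move=> /trimL_prefix tl E; apply: contrapT => nP.
have nL : ~ Lam 1 x by move/(Lam1 P_nil).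
by have := cost_catMl 3 tl nL; rewrite E; lia.
Qed.

Lemma free_suffix m y B : trimR M P (m ++ y) B -> C (y ++ B) = C B -> P y.
Proof.
move=> /trimR_suffix tr E; apply: contrapT => nP.
have nL : ~ Lam 1 y by move/(Lam1 P_nil).
by have := cost_catMr M_sub P_sub P_nil 3 tr nL; rewrite E; lia.
Qed.

Lemma maxocc_trim A m B : maxocc A m B -> trimL M P A m /\ trimR M P m B.
Proof. by case=> Mm ml mr; split; [exact: trimL_maxl|exact: trimR_maxr]. Qed.

(** A part that can be trimmed for free is a piece, so trimming takes at most one piece from each
    end. *)
Lemma pos_of_Lam t A m B : maxocc A m B -> ~ Lam t.+2 m -> pos t A m B.
Proof.
move=> mx nL; have [tl tr] := maxocc_trim mx; split=> // x m1 y E EA EB L.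
have Px : P x by apply: (free_prefix (m := m1 ++ y)) EA; rewrite -E.
have Py : P y by apply: (free_suffix (m := x ++ m1)) EB; rewrite -catA -E.
apply: nL; rewrite E; apply: LamS => //; rewrite -addn1.
by apply: Lam_cat => //; apply/Lam1.
Qed.

Lemma maxocc_same A m B m' B' : maxocc A m B -> maxocc A m' B' ->
  m ++ B = m' ++ B' -> m = m' /\ B = B'.
Proof.
move=> [Mm _ mr] [Mm' _ mr'] /cat_split[] [e].
  case: e => [|y e] [E1 E2]; first by rewrite E1 E2 cats0.
  by case: (mr y (e ++ B')) => //; apply: (M_catl M_sub (v := e)); rewrite cat_rcons -E1.
case: e => [|y e] [e0 [E1 E2]] //.
by case: (mr' y (e ++ B)) => //; apply: (M_catl M_sub (v := e)); rewrite cat_rcons -E1.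
Qed.

Lemma maxocc_samer A m B A' m' : maxocc A m B -> maxocc A' m' B ->
  A ++ m = A' ++ m' -> A = A' /\ m = m'.
Proof.
have half D (n : seq T) D' (n' : seq T) : maxocc D n B -> maxocc D' n' B ->
    forall e, D' = D ++ e -> n = e ++ n' -> e = [::].
  move=> [Mn _ _] [_ nl _]; case/lastP => // e z ED En.
  case: (nl (D ++ e) z); first by rewrite ED rcons_cat.
  by apply: (M_catr M_sub (u := e)); rewrite -cat_rcons -En.
move=> mx mx' /cat_split[] [e]; last first.
  by case=> e0 [EA Em]; case: e0; apply: (half _ _ _ _ mx' mx e EA Em).
by case=> EA Em; have e0 := half _ _ _ _ mx mx' e EA Em; rewrite EA Em e0 cats0.
Qed.

(** Nested occurrences contradict maximality, and an overlap in a non-piece would glue the last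
    letter before [g] to [g]. Removing the shared piece takes the measure from above 4 to above
    3. *)
Lemma pos_cases A m B A2 g B2 : pos 4 A m B -> pos 4 A2 g B2 ->
  A ++ m ++ B = A2 ++ g ++ B2 -> size A < size A2 ->
  (exists z, [/\ z <> [::], A2 = A ++ m ++ z & B = z ++ g ++ B2]) \/
  (exists u c g0, [/\ u <> [::], A2 = A ++ u, m = u ++ c, g = c ++ g0 & B = g0 ++ B2] /\
     [/\ P c, ~ Lam 3 u & ~ Lam 3 g0]).
Proof.
move=> pm pg E lt; have [Mm ml mr] := pos_max pm; have [Mg gl gr] := pos_max pg.
have nLm := pos_Lam pm; have nLg := pos_Lam pg.
case: (cat_split E) => [[w [EA E1]]|[e [e0 [EA _]]]]; last first.
  by move: lt; rewrite EA size_cat; lia.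
have w0 : w <> [::] by move=> w0; move: lt; rewrite EA w0 cats0; lia.
have adj c : m = w ++ c -> c ++ B = g ++ B2 -> exists u c g0,
     [/\ u <> [::], A2 = A ++ u, m = u ++ c, g = c ++ g0 & B = g0 ++ B2] /\
     [/\ P c, ~ Lam 3 u & ~ Lam 3 g0].
  move=> Em /esym/cat_split[] [g0].
    case: g0 => [|y g0] [Ec EB2]; exfalso; case/lastP: w w0 EA Em {E1} => // w x _ EA Em.
      apply: (gl (A ++ w) x); rewrite ?EA ?rcons_cat //.
      by apply: (M_sub (a := w) (b := x :: g) (c := [::])); rewrite cats0 -cat_rcons Em Ec cats0 in Mm *.
    apply: (gl (A ++ w) x); rewrite ?EA ?rcons_cat //.
    by apply: (M_sub (a := w) (b := x :: g) (c := y :: g0)); rewrite /= -cat_rcons -Ec -Em.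
  move=> [g00 [Eg EB]].
  have Pc : P c.
    apply: contrapT => nP; case/lastP: w w0 EA Em {E1} => // w x _ EA Em.
    apply: (gl (A ++ w) x); rewrite ?EA ?rcons_cat //.
    apply: (M_catr M_sub (u := w)); rewrite -cat_rcons Eg; apply: MP_glue => //; first by rewrite -Em.
    by rewrite -Eg.
  exists w, c, g0; split=> //; split=> // L.
    by apply: nLm; rewrite Em -[4]/(3 + 1); apply: Lam_cat => //; apply/Lam1.
  by apply: nLg; rewrite Eg; apply: LamS.
case: (cat_split E1) => [[z [Ew EB]]|[c [c0 [Em Ec]]]].
  have [z0|/eqP z0] := eqVneq z [::].
    right; apply: (adj [::]); first by rewrite Ew z0 !cats0.
    by rewrite EB z0.
  by left; exists z; rewrite EA Ew.
by right; apply: (adj c).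
Qed.

End Positions.

(** * Positions and turns *)

Section Turns.
Variables (T : eqType) (M P : seq T -> Prop).
Implicit Types (A B U V a b c g m u v w z : seq T) (K t n : nat).
Hypothesis M_sub : sub_closed M.
Hypothesis P_sub : sub_closed P.
Hypothesis P_nil : P [::].
Hypothesis MP_glue : glueable M P.

Notation maxocc := (maxocc M).
Notation Lam := (Lam P).
Notation cost := (cost M P).
Notation C := (cost 3).
Notation pos := (position M P).

Lemma maxl_suffix A w m : w <> [::] -> maxl M (A ++ w) m <-> maxl M w m.
Proof.
case/lastP: w => // w x _; split=> h A' y E; apply: h.
  by rewrite E -rcons_cat.
by move: E; rewrite -rcons_cat => /rcons_inj [_ <-].
Qed.

Lemma maxr_prefix m w B : w <> [::] -> maxr M m (w ++ B) <-> maxr M m w.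
Proof.
case: w => // x w _; split=> h y B' E; apply: h; last by case: E => -> _; reflexivity.
by rewrite E.
Qed.

Lemma maxl_M A w m : w <> [::] -> maxl M (A ++ w) m -> ~ M (w ++ m).
Proof.
case/lastP: w => // w x _ ml Mm; apply: (ml (A ++ w) x); first by rewrite rcons_cat.
by apply: (M_catr M_sub (u := w)); rewrite -cat_rcons.
Qed.

Lemma cost_left A u m : trimL M P A (u ++ m) -> M u -> ~ Lam 3 u ->
  C (A ++ u) = C A + 3.
Proof.
move=> /trimL_prefix tl Mu nL; apply/eqP; rewrite eqn_leq; apply/andP; split.
  by have := cost_cat M P 3 A u; have := cost_M P 3 Mu; lia.
by have := cost_catMl M_sub P_sub P_nil 3 tl nL; lia.
Qed.

Lemma cost_right m g B : trimR M P (m ++ g) B -> M g -> ~ Lam 3 g ->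
  C (g ++ B) = 3 + C B.
Proof.
move=> /trimR_suffix tr Mg nL; apply/eqP; rewrite eqn_leq; apply/andP; split.
  by have := cost_cat M P 3 g B; have := cost_M P 3 Mg; lia.
by have := cost_catMr M_sub P_sub P_nil 3 tr nL; lia.
Qed.

Lemma longest_prefix (Q : seq T -> Prop) g : Q [::] ->
  exists c g0, [/\ g = c ++ g0, Q c & forall y g1, g0 = y :: g1 -> ~ Q (rcons c y)].
Proof.
move=> Q0; suff: forall c, Q c -> exists c' g0,
    [/\ c ++ g = c' ++ g0, Q c' & forall y g1, g0 = y :: g1 -> ~ Q (rcons c' y)].
  by move=> /(_ [::] Q0).
elim: g => [|y g IH] c Qc; first by exists c, [::].
have [Qy|nQ] := pselect (Q (rcons c y)).
  by have [c' [g0]] := IH _ Qy; rewrite cat_rcons => h; exists c', g0.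
by exists c, (y :: g); split=> // y' g1 [<- _].
Qed.

(** A free left trim ends inside [u], because [u] already costs 3. A free right trim never reaches
    beyond the overlap, because the whole neighbour costs 3 as its remainder does. Hence the trimmed
    part does not depend on the overlap. *)
Lemma pos_adj t A u c g0 c' g0' B2 :
  maxocc (A ++ u) (c ++ g0) B2 -> ~ Lam 4 (c ++ g0) ->
  maxocc (A ++ u) (c' ++ g0') B2 -> ~ Lam 4 (c' ++ g0') ->
  maxocc A (u ++ c') (g0' ++ B2) ->
  u <> [::] -> ~ Lam 3 u -> ~ Lam 3 g0 -> ~ Lam 3 g0' ->
  pos t A (u ++ c) (g0 ++ B2) -> pos t A (u ++ c') (g0' ++ B2).
Proof.
move=> pg nLc pg' nLc' mx u0 nu ng ng' pm; have [[Mm ml mr] h] := pm.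
split=> // x m1 y E EA EB.
have [tm _] := maxocc_trim M_sub MP_glue (pos_max pm).
have [_ tg] := maxocc_trim M_sub MP_glue pg.
have [_ tg'] := maxocc_trim M_sub MP_glue pg'.
have Mu : M u by apply: (M_catl M_sub) Mm.
have [[Mg _ _] [Mg' gl' _]] := (pg, pg').
have CA : C (A ++ u) = C A + 3 by apply: (cost_left tm).
have CB : C (g0 ++ B2) = 3 + C B2 by apply: (cost_right tg) => //; apply: (M_catr M_sub) Mg.
have CB' : C (g0' ++ B2) = 3 + C B2 by apply: (cost_right tg') => //; apply: (M_catr M_sub) Mg'.
case: (cat_split E) => [[e [Ex _]]|[e [e0 [Eu /esym E1]]]].
  by have := cost_catl M_sub P_sub 3 (A ++ u) e; rewrite -catA -Ex EA; lia.
(* The overlap [c] is free on the right: with or without it the neighbour contributes 3. *)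
have he : ~ Lam t e.
  apply: (h x e c) => //; first by rewrite Eu -catA.
  rewrite catA (cost_right (m := [::]) tg) ?CB // => L3.
  by apply: nLc; apply: Lam_le L3.
case: (cat_split (esym E1)) => [[e' [Ee Ey]]|[e' [_ [Em _]]]]; last first.
  by move=> L; apply: he; apply: (Lam_catl P_sub (v := e')); rewrite -Em.
have [e'0|/eqP e'0] := eqVneq e' [::].
  by move=> L; apply: he; rewrite Ee e'0 cats0.
move: EB; rewrite Ey -!catA CB'.
have mxe : maxocc e' (c' ++ g0') B2.
  split=> //; last by case: pg'.
  by move: gl'; rewrite Eu Ee 2!catA => /maxl_suffix; apply.
have := cost_maxocc M_sub P_sub P_nil MP_glue mxe nLc'.
rewrite -!catA => ->; have := cost_gt0 M P (isT : 0 < 3) e'0.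
by lia.
Qed.

Lemma cost_gap A z g B2 y : pos 4 (A ++ z) g B2 -> z <> [::] ->
  C (y ++ z ++ g ++ B2) = C (y ++ z) + 3 + C B2.
Proof.
move=> pg z0; have [Mg gl gr] := pos_max pg.
rewrite catA; apply: cost_maxocc => //; last exact: pos_Lam pg.
by split=> //; apply/maxl_suffix => //; move: gl => /maxl_suffix; apply.
Qed.

(** Behind a non-empty gap [g] and [g'] both contribute exactly 3, so the same trims are free. *)
Lemma pos_gap t A A' m z g g' B2 :
  pos 4 (A' ++ z) g B2 -> pos 4 (A' ++ z) g' B2 -> z <> [::] ->
  pos t A m (z ++ g ++ B2) -> pos t A m (z ++ g' ++ B2).
Proof.
move=> pg pg' z0 [[Mm ml mr] h]; split.
  by split=> //; apply/maxr_prefix => //; move: mr => /maxr_prefix; apply.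
move=> x m1 y E EA EB; apply: (h x m1 y) => //; move: EB.
have c0 q : pos 4 (A' ++ z) q B2 -> C (z ++ q ++ B2) = C z + 3 + C B2.
  by move=> pq; rewrite (cost_gap [::] pq).
by rewrite !(cost_gap _ pg, cost_gap _ pg') // !(c0 g, c0 g') //; lia.
Qed.

(** If there is no gap, [m'] is [u] followed by the longest prefix [c'] of [g'] that keeps it a
    monomial. This [c'] is a piece, since otherwise [u] and [g'] would glue and [g'] would not be
    maximal. *)
Lemma turn_right A m B A2 g g' B2 : pos 4 A m B -> pos 4 A2 g B2 -> pos 4 A2 g' B2 ->
  A ++ m ++ B = A2 ++ g ++ B2 -> size A < size A2 ->
  exists m' B', [/\ A2 ++ g' ++ B2 = A ++ m' ++ B', C B' = C B,
    forall t, pos t A m B -> pos t A m' B' &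
    (exists z, [/\ z <> [::], A2 = A ++ m ++ z, B = z ++ g ++ B2, m' = m &
       B' = z ++ g' ++ B2]) \/
    (exists u c g0 c' g0', [/\ [/\ u <> [::], A2 = A ++ u, m = u ++ c, g = c ++ g0 & B = g0 ++ B2],
       [/\ m' = u ++ c', g' = c' ++ g0' & B' = g0' ++ B2], P c /\ P c' &
       [/\ ~ Lam 3 u, ~ Lam 3 g0 & ~ Lam 3 g0']])].
Proof.
move=> pm pg pg' E lt.
case: (pos_cases M_sub P_nil MP_glue pm pg E lt).
  move=> [z [z0 EA EB]]; exists m, (z ++ g' ++ B2); split; last by left; exists z.
  - by rewrite EA -!catA.
  - move: pg pg'; rewrite EB EA catA => pg pg'.
    by rewrite (cost_gap [::] pg) // (cost_gap [::] pg').
  - move=> t; rewrite EB; apply: (pos_gap (A' := A ++ m)) => //; by rewrite -catA -EA.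
move=> [u [c [g0 [[u0 EA Em Eg EB] [Pc nu ng]]]]].
have [[Mm ml mr] [Mg gl gr] [Mg' gl' gr']] := And3 (pos_max pm) (pos_max pg) (pos_max pg').
have Mu : M u by rewrite Em in Mm; apply: (M_catl M_sub) Mm.
have [|c' [g0' [Eg' Muc lg]]] := @longest_prefix (fun c => M (u ++ c)) g'; first by rewrite cats0.
have nMug : ~ M (u ++ g') by apply: (@maxl_M A) => //; rewrite -EA.
case: g0' => [|y g0'] in Eg' lg; first by case: nMug; rewrite Eg' cats0.
have Pc' : P c' by apply: contrapT => nP; apply: nMug; rewrite Eg'; apply: MP_glue => //; rewrite -Eg'.
have nPu : ~ P u by move=> /(Lam1 P_nil) L; apply: nu; apply: Lam_le L.
have mx : maxocc A (u ++ c') ((y :: g0') ++ B2).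
  split=> //; last by move=> y' B' [<- _]; rewrite rcons_cat; apply: lg (erefl _).
  move=> A' x EA' Mx; apply: (ml A' x EA'); rewrite Em -cat1s.
  apply: MP_glue => //; last by rewrite -Em.
  by apply: (M_catl M_sub (v := c')); rewrite -catA.
have ng' : ~ Lam 3 (y :: g0').
  by move=> L; apply: (pos_Lam pg'); rewrite Eg'; apply: LamS.
exists (u ++ c'), ((y :: g0') ++ B2); split.
- by rewrite EA Eg' -!catA.
- have [_ tg] := maxocc_trim M_sub MP_glue (pos_max pg).
  have [_ tg'] := maxocc_trim M_sub MP_glue (pos_max pg').
  rewrite EB; rewrite Eg in tg Mg; rewrite Eg' in tg' Mg'.
  rewrite (cost_right tg) ?(cost_right tg') //.
    exact: (M_catr M_sub) Mg'.
  exact: (M_catr M_sub) Mg.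
- move=> t; rewrite Em EB; apply: pos_adj => //.
  + by rewrite -EA -Eg; exact: pos_max pg.
  + by rewrite -Eg; exact: pos_Lam pg.
  + by rewrite -EA -Eg'; exact: pos_max pg'.
  + by rewrite -Eg'; exact: pos_Lam pg'.
- by right; exists u, c, g0, c', (y :: g0').
Qed.

(** The part of [m] before [g] contributes 3 to the prefix cost, which therefore names the positions
    of a word. *)
Lemma cost_pos_lt A m B A2 g B2 : pos 4 A m B -> pos 4 A2 g B2 ->
  A ++ m ++ B = A2 ++ g ++ B2 -> size A < size A2 -> C A < C A2.
Proof.
move=> pm pg E lt; have [Mm ml mr] := pos_max pm.
have [tm _] := maxocc_trim M_sub MP_glue (pos_max pm).
case: (pos_cases M_sub P_nil MP_glue pm pg E lt).
  move=> [z [z0 -> EB]]; rewrite (@cost_maxocc _ _ _ M_sub P_sub P_nil MP_glue 3) //; first by lia.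
  - split=> //; rewrite EB in mr; move: mr => /maxr_prefix; exact.
  - exact: pos_Lam pm.
move=> [u [c [g0 [[u0 -> Em Eg EB] [Pc nu ng]]]]].
rewrite Em in tm Mm; rewrite (cost_left tm) //; first by lia.
exact: (M_catl M_sub) Mm.
Qed.

Lemma pos_inj A m B A2 g B2 : pos 4 A m B -> pos 4 A2 g B2 ->
  A ++ m ++ B = A2 ++ g ++ B2 -> C A = C A2 -> [/\ A = A2, m = g & B = B2].
Proof.
move=> pm pg E EC; case: (ltngtP (size A) (size A2)) => [lt|lt|eq].
- by have := cost_pos_lt pm pg E lt; rewrite EC; lia.
- by have := cost_pos_lt pg pm (esym E) lt; rewrite EC; lia.
have [EA E1] : A = A2 /\ m ++ B = g ++ B2.
  by move/eqP: E; rewrite eqseq_cat // => /andP[/eqP-> /eqP->].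
have [//|-> ->] := maxocc_same M_sub (pos_max pm) _ E1; last by [].
by rewrite EA; exact: pos_max pg.
Qed.

End Turns.

Lemma pos_flip (T : eqType) (M P : seq T -> Prop) t A m B : P [::] ->
  position M P t A m B -> position (flip M) (flip P) t (rev B) (rev m) (rev A).
Proof.
move=> P0 [mx h]; split; first exact: maxocc_flip.
move=> x m1 y E EA EB /(Lam_flipE _ _ P0); apply: (h (rev y) (rev m1) (rev x)).
- by rewrite -[m]revK E !rev_cat catA.
- by move: EB; rewrite !cost_flip rev_cat !revK.
- by move: EA; rewrite !cost_flip rev_cat !revK.
Qed.

Section Mirrored.
Variables (T : eqType) (M P : seq T -> Prop).
Implicit Types (A B U V a b c g m u v w z : seq T) (K t n : nat).
Hypothesis M_sub : sub_closed M.
Hypothesis P_sub : sub_closed P.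
Hypothesis P_nil : P [::].
Hypothesis MP_glue : glueable M P.

Notation Lam := (Lam P).
Notation C := (cost M P 3).
Notation pos := (position M P).

Lemma pos_flipE t A m B :
  pos t A m B <-> position (flip M) (flip P) t (rev B) (rev m) (rev A).
Proof.
split; first exact: pos_flip.
by move=> /(@pos_flip _ (flip M) (flip P)); rewrite !flipK !revK; apply.
Qed.

Lemma turn_left A m B A2 g g' B2 : pos 4 A m B -> pos 4 A2 g B2 -> pos 4 A2 g' B2 ->
  A ++ m ++ B = A2 ++ g ++ B2 -> size B < size B2 ->
  exists A' m', [/\ A2 ++ g' ++ B2 = A' ++ m' ++ B, C A' = C A,
    forall t, pos t A m B -> pos t A' m' B &
    (exists z, [/\ z <> [::], B2 = z ++ m ++ B, A = A2 ++ g ++ z, m' = m &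
       A' = A2 ++ g' ++ z]) \/
    (exists u c g0 c' g0', [/\ [/\ u <> [::], B2 = u ++ B, m = c ++ u, g = g0 ++ c & A = A2 ++ g0],
       [/\ m' = c' ++ u, g' = g0' ++ c' & A' = A2 ++ g0'], P c /\ P c' &
       [/\ ~ Lam 3 u, ~ Lam 3 g0 & ~ Lam 3 g0']])].
Proof.
rewrite 3!pos_flipE => pm pg pg' E lt.
have E' : rev B ++ rev m ++ rev A = rev B2 ++ rev g ++ rev A2.
  by rewrite -!rev_cat -!catA E.
have nn w : w <> [::] -> rev w <> [::] by move=> w0 h; apply: w0; rewrite -[w]revK h.
have rr (w w' : seq T) : rev w = w' -> w = rev w' by move=> <-; rewrite revK.
have := turn_right (sub_closed_flip M_sub) (sub_closed_flip P_sub) P_nil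
  (glueable_flip MP_glue) pm pg pg' E'.
rewrite !size_rev => /(_ lt) [m' [A' [E1 EC ht hc]]].
have {}ht t : pos t A m B -> pos t (rev A') (rev m') B.
  by move=> p; apply/pos_flipE; rewrite !revK; apply: ht; apply/pos_flipE.
exists (rev A'), (rev m'); split=> //.
- by have := congr1 rev E1; rewrite !rev_cat !revK -!catA.
- by move: EC; rewrite !cost_flip revK.
case: hc => [[z [z0 EB EA Em' EA']]|[u [c [g0 [c' [g0' [[u0 EB Em Eg EA] [Em' Eg' EA'] [Pc Pc'] [n1 n2 n3]]]]]]]].
  left; exists (rev z); split; first exact: nn.
  - by rewrite (rr _ _ EB) !rev_cat !revK -catA.
  - by rewrite (rr _ _ EA) !rev_cat !revK -catA.
  - by rewrite Em' revK.
  - by rewrite EA' !rev_cat !revK -catA.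
right; exists (rev u), (rev c), (rev g0), (rev c'), (rev g0'); split.
- split; first exact: nn.
  + by rewrite (rr _ _ EB) rev_cat revK.
  + by rewrite (rr _ _ Em) rev_cat.
  + by rewrite (rr _ _ Eg) rev_cat.
  + by rewrite (rr _ _ EA) rev_cat revK.
- split; first by rewrite Em' rev_cat.
  + by rewrite (rr _ _ Eg') rev_cat.
  + by rewrite EA' rev_cat revK.
- by [].
- by split; move/(Lam_flip P_nil); rewrite revK.
Qed.

Lemma pos_order A m B A2 g B2 : pos 4 A m B -> pos 4 A2 g B2 ->
  A ++ m ++ B = A2 ++ g ++ B2 -> size A < size A2 -> size B2 < size B.
Proof.
move=> pm pg E lt.
case: (pos_cases M_sub P_nil MP_glue pm pg E lt).
  by move=> [z [z0 EA EB]]; rewrite EB !size_cat; case: z z0 {EA EB} => //= *; lia.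
move=> [u [c [g0 [[u0 EA Em Eg EB] [Pc nu ng]]]]].
rewrite EB size_cat; case: g0 ng {Eg EB} => [|? ?] h; last by move=> /=; lia.
by case: h; apply: Lam0.
Qed.

Lemma pos_eq A m B A2 g B2 : pos 4 A m B -> pos 4 A2 g B2 ->
  A ++ m ++ B = A2 ++ g ++ B2 -> size A = size A2 -> [/\ A = A2, m = g & B = B2].
Proof.
move=> pm pg E eq; apply: (pos_inj M_sub P_sub P_nil MP_glue pm pg) => //.
by move/eqP: E; rewrite eqseq_cat // => /andP[/eqP-> _].
Qed.

Lemma pos_eqr A m B A2 g B2 : pos 4 A m B -> pos 4 A2 g B2 ->
  A ++ m ++ B = A2 ++ g ++ B2 -> size B = size B2 -> [/\ A = A2, m = g & B = B2].
Proof.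
move=> pm pg E eq; apply: pos_eq => //; case: (ltngtP (size A) (size A2)) => // lt.
  by have := pos_order pm pg E lt; rewrite eq ltnn.
by have := pos_order pg pm (esym E) lt; rewrite eq ltnn.
Qed.

Variable th : nat.
Hypothesis th_ge4 : 4 <= th.

(** The index is a prefix cost and not a length, because a turn further left changes lengths but no
    prefix costs. *)
Definition rob U (v : nat) := exists A m B, [/\ U = A ++ m ++ B, pos th A m B & C A = v].
(** A prefix costs at most [C U], so this range catches every robust position. *)
Definition nrob U := \sum_(v < (C U).+1) (`[< rob U v >] : nat).

Lemma pos_th A m B : pos th A m B -> pos 4 A m B.
Proof. exact: pos_le. Qed.

Lemma cost_pos A m B : pos 4 A m B -> C (A ++ m ++ B) = C A + 3 + C B.
Proof. by move=> pm; apply: cost_maxocc => //; [exact: pos_max pm|exact: pos_Lam pm]. Qed.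

Lemma rob_turn A m m' B (v : nat) : pos 4 A m B -> pos 4 A m' B -> v <> C A ->
  rob (A ++ m ++ B) v -> rob (A ++ m' ++ B) v.
Proof.
move=> pm pm' nv [A2 [g [B2 [E pg Ev]]]]; have pg4 := pos_th pg.
case: (ltngtP (size A2) (size A)) => [lt|lt|eq].
- have [g' [B' [E' _ h _]]] := turn_right M_sub P_sub P_nil MP_glue pg4 pm pm' (esym E) lt.
  by exists A2, g', B'; split=> //; apply: h.
- have lt' := pos_order pm pg4 E lt.
  have [A' [g' [E' EC h _]]] := turn_left pg4 pm pm' (esym E) lt'.
  by exists A', g', B2; split=> //; [apply: h|rewrite EC].
- by case: nv; have [<- _ _] := pos_eq pg4 pm (esym E) eq.
Qed.

(** All other positions keep their names by [rob_turn], so the count can change only at the position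
    being turned. *)
Lemma nrob_turn A m m' B : pos th A m B -> pos 4 A m' B ->
  nrob (A ++ m' ++ B) + ~~ `[< pos th A m' B >] = nrob (A ++ m ++ B).
Proof.
move=> pm pm'; have pm4 := pos_th pm.
have lt : C A < (C A + 3 + C B).+1 by lia.
rewrite /nrob !cost_pos // [in LHS](bigD1 (Ordinal lt)) // [in RHS](bigD1 (Ordinal lt)) //=.
have -> : `[< rob (A ++ m ++ B) (C A) >] by apply/asboolP; exists A, m, B.
have -> : `[< rob (A ++ m' ++ B) (C A) >] = `[< pos th A m' B >].
  apply/asboolP/asboolP => [[A2 [g [B2 [E pg Ev]]]]|p]; last by exists A, m', B.
  have [EA Em EB] := pos_inj M_sub P_sub P_nil MP_glue pm' (pos_th pg) E (esym Ev).
  by rewrite EA Em EB.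
have E1 : nat_of_bool `[< pos th A m' B >] + ~~ `[< pos th A m' B >] = true by case: asboolP.
rewrite addnAC E1; congr (_ + _).
apply: eq_bigr => i /eqP ni; congr (nat_of_bool _).
have nv : i <> C A :> nat by move=> h; apply: ni; apply: val_inj.
by apply/asboolP/asboolP; apply: rob_turn.
Qed.

End Mirrored.

(** * Words of the free group *)

Section Words.
Local Open Scope ring_scope.
Variable X : choiceType.
Local Notation F := (freegroup X).
Local Notation L := (letter X).
Implicit Types (u v w : F) (a b c d : seq L).

Lemma reduced_sub a b c : reduced (a ++ b ++ c) -> reduced b.
Proof. by move=> /cat_sorted2[_ /cat_sorted2[]]. Qed.

Lemma reduced_catl a b : reduced (a ++ b) -> reduced a.
Proof. by move=> /cat_sorted2[]. Qed.

Lemma reduced_catr a b : reduced (a ++ b) -> reduced b.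
Proof. by move=> /cat_sorted2[]. Qed.

Lemma reduced_glue a z b : z <> [::] ->
  reduced (a ++ z) -> reduced (z ++ b) -> reduced (a ++ z ++ b).
Proof.
case: z => // x z _; case: a => [|y a] //=; rewrite /reduced /= !cat_path /=.
by move=> /and3P[-> -> _]; rewrite cat_path.
Qed.

Definition nf a : F := FreeWord (reduced_mulw a (isT : reduced (Nil L))).

Lemma nfK a : reduced a -> word (nf a) = a.
Proof. exact: mulw1. Qed.

Lemma wordK u : nf u = u.
Proof. by apply/val_inj/mulw1/word_reduced. Qed.

Lemma nfM a b : nf (a ++ b) = (nf a * nf b)%g.
Proof.
apply/val_inj; rewrite /= {1}/mulw foldr_cat -/(mulw b _) -/(mulw a (mulw b _)).
by rewrite -{1}[mulw b _]/(mulw [::] (mulw b [::])) mulwA // reduced_mulw.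
Qed.

Lemma nf_nil : nf [::] = 1%g. Proof. exact/val_inj. Qed.

Lemma word_mul u v : reduced (u ++ v) -> word (u * v)%g = u ++ v.
Proof. by move=> r; rewrite -[u]wordK -[v]wordK -nfM nfK // !wordK. Qed.

Lemma word_mul3 u v w : reduced (u ++ v ++ w) -> word (u * v * w)%g = u ++ v ++ w.
Proof.
move=> r; have E : word (v * w)%g = v ++ w by apply: word_mul; apply: reduced_catr r.
by rewrite -mulgA word_mul E.
Qed.

Lemma word_cat u a b : word u = a ++ b -> [/\ u = (nf a * nf b)%g, reduced a & reduced b].
Proof.
move=> E; split; first by rewrite -nfM -E wordK.
  by apply: (@reduced_catl a b); rewrite -E word_reduced.
by apply: (@reduced_catr a b); rewrite -E word_reduced.
Qed.

(** The parts that cancel are [b] and [c]. Costs are subadditive on products because a prefix of [u]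
    and a suffix of [v] survive. *)
Lemma mul_split u v : exists a b c d,
  [/\ word u = a ++ b, word v = c ++ d & word (u * v)%g = a ++ d].
Proof.
have [rv ru] := (word_reduced v, word_reduced u).
rewrite -[word (u * v)%g]/(mulw u v).
elim: (word u) ru => [_|x s IH ru]; first by exists [::], [::], [::], v.
have [a [b [c [d [Es Ev E]]]]] := IH (reduced_cons ru).
rewrite -[mulw (x :: s) v]/(consl x (mulw s v)) E.
case: a => [|y a] in Es E *; last first.
  exists [:: x, y & a], b, c, d; split=> //; first by rewrite Es.
  by move: ru; rewrite Es /= => /andP[/negPf-> _].
case: d => [|y d] in Ev E *.
  by exists [:: x], b, c, [::]; split=> //; rewrite Es.
rewrite /=; have [Ey|ny] := boolP (y == linv x).
  by exists [::], (x :: b), (rcons c y), d; rewrite Es Ev cat_rcons.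
by exists [:: x], b, c, (y :: d); rewrite Es Ev.
Qed.

Lemma cancel_letter u v : u <> 1%g -> v <> 1%g -> ~~ reduced (u ++ v) ->
  exists a x b, [/\ word u = rcons a x & word v = linv x :: b].
Proof.
move=> u1 v1; have [u0 v0] : word u <> [::] /\ word v <> [::].
  by split=> h; [apply: u1|apply: v1]; apply/val_inj.
case/lastP Eu: (word u) u0 => // [a x] _; case Ev: (word v) v0 => // [y b] _.
rewrite cat_rcons => nr; exists a, x, b; split=> //; congr cons.
apply/eqP; apply: contraR nr => ny.
have := word_reduced u; have := word_reduced v; rewrite Eu Ev => ry rx.
rewrite -cat1s; apply: reduced_glue => //; first by rewrite cats1.
by move: ry; rewrite /reduced /= => ->; rewrite ny.
Qed.

Lemma cost_mul (M P : seq L -> Prop) K u v : sub_closed M -> sub_closed P ->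
  (cost M P K (u * v)%g <= cost M P K u + cost M P K v)%N.
Proof.
move=> sM sP; have [a [b [c [d [-> -> ->]]]]] := mul_split u v.
apply: leq_trans (cost_cat M P K a d) _; apply: leq_add.
  exact: cost_catl.
exact: cost_catr.
Qed.

Lemma word_inj u v : word u = word v -> u = v.
Proof. by move=> h; apply: val_inj. Qed.

Lemma linv_nf (x : L) : nf [:: linv x] = ((nf [:: x])^-1)%g.
Proof. by apply/val_inj. Qed.

End Words.

(** * Multiplying relators by group elements *)

Section Relators.
Local Open Scope ring_scope.
Variables (k : fieldType) (X : choiceType).
Local Notation F := (freegroup X).
Local Notation L := (letter X).
Local Notation kF := (galg k F).
Variable Rel : set kF.
Implicit Types (u v w x y : F) (a b c d : seq L) (p q : kF).
Hypothesis compat : compatibility_axiom Rel.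

Definition lmul u p : kF := gmono k u * p.
Definition rmul p u : kF := p * gmono k u.

Lemma coeff_lmul u p w : (lmul u p)@_w = p@_(u^-1 * w)%g.
Proof.
rewrite /lmul /GRing.mul /= /gmul msuppU oner_eq0 big_seq_fset1.
rewrite [in RHS](monalgE p) raddf_sum raddf_sum; apply: eq_bigr => y _ /=.
by rewrite /gmono mcoeffUU mul1r !mcoeffU (can2_eq (mulKg u) (mulVKg u)).
Qed.

Lemma coeff_rmul u p w : (rmul p u)@_w = p@_(w * u^-1)%g.
Proof.
rewrite /rmul /GRing.mul /= /gmul.
rewrite [in RHS](monalgE p) raddf_sum raddf_sum; apply: eq_bigr => y _ /=.
rewrite msuppU oner_eq0 big_seq_fset1 /gmono mcoeffUU mulr1 !mcoeffU.
by rewrite (can2_eq (mulgK u) (mulgVK u)).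
Qed.

Lemma supp_lmul u p w : (w \in msupp (lmul u p)) = ((u^-1 * w)%g \in msupp p).
Proof. by rewrite -!mcoeff_neq0 coeff_lmul. Qed.

Lemma supp_rmul u p w : (w \in msupp (rmul p u)) = ((w * u^-1)%g \in msupp p).
Proof. by rewrite -!mcoeff_neq0 coeff_rmul. Qed.

Lemma supp_lmulM u p w : ((u * w)%g \in msupp (lmul u p)) = (w \in msupp p).
Proof. by rewrite supp_lmul mulKg. Qed.

Lemma supp_rmulM u p w : ((w * u)%g \in msupp (rmul p u)) = (w \in msupp p).
Proof. by rewrite supp_rmul mulgK. Qed.

Lemma gmonoM (G : groupType) (u v : G) : gmono k (u * v)%g = gmono k u * gmono k v.
Proof. by rewrite -[RHS]/(gmul _ _) gmulUU mulr1. Qed.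

Lemma lmulM u v p : lmul (u * v)%g p = lmul u (lmul v p).
Proof. by rewrite /lmul gmonoM; exact: esym (mulrA _ _ _). Qed.

Lemma rmulM u v p : rmul p (u * v)%g = rmul (rmul p u) v.
Proof. by rewrite /rmul gmonoM; exact: mulrA. Qed.

Lemma lmul1 p : lmul 1%g p = p.
Proof. by rewrite /lmul; exact: mul1r. Qed.

Lemma rmul1 p : rmul p 1%g = p.
Proof. by rewrite /rmul; exact: mulr1. Qed.

Lemma lrmul u v p : lmul u (rmul p v) = rmul (lmul u p) v.
Proof. exact: mulrA. Qed.

(** Compatibility removes one letter at a time, each being the first letter of what is left of the
    same monomial [w]. *)
Lemma Rel_stripl p w a b : Rel p -> w \in msupp p -> word w = a ++ b ->
  Rel (lmul (nf a)^-1%g p).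
Proof.
elim: a p w => [|x a IH] p w Rp wp Ew; first by rewrite nf_nil invg1 lmul1.
have [_ Rl _] := compat.
have rx : reduced [:: x] by [].
have Rp' : Rel (lmul (nf [:: x])^-1%g p).
  apply: (Rl p (nf [:: x]) w) => //.
  by rewrite nfK // Ew; apply: (prefix_prefix [:: x]).
have := IH _ ((nf [:: x])^-1 * w)%g Rp'; rewrite supp_lmulM => /(_ wp).
have -> : nf (x :: a) = (nf [:: x] * nf a)%g by rewrite -nfM.
rewrite invgM lmulM; apply.
have [-> ra rb] := @word_cat _ w [:: x] (a ++ b) Ew.
by rewrite mulKg nfK.
Qed.

Lemma Rel_stripr p w a b : Rel p -> w \in msupp p -> word w = a ++ b ->
  Rel (rmul p (nf b)^-1%g).
Proof.
elim/last_ind: b p w => [|b x IH] p w Rp wp Ew; first by rewrite nf_nil invg1 rmul1.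
have [_ _ Rr] := compat.
have rx : reduced [:: x] by [].
have Rp' : Rel (rmul p (nf [:: x])^-1%g).
  apply: (Rr p (nf [:: x]) w) => //.
  by rewrite nfK // Ew -rcons_cat -cats1 suffix_suffix.
have := IH _ (w * (nf [:: x])^-1)%g Rp'; rewrite supp_rmulM => /(_ wp).
rewrite -cats1 nfM invgM rmulM; apply.
have [|-> ra rb] := @word_cat _ w (a ++ b) [:: x]; first by rewrite Ew -cats1 catA.
by rewrite mulgK nfK.
Qed.

End Relators.

(** * Pieces and monomials *)

Section Gluing.
Local Open Scope ring_scope.
Variables (k : fieldType) (X : choiceType).
Local Notation F := (freegroup X).
Local Notation L := (letter X).
Local Notation kF := (galg k F).
Variable Rel : set kF.
Implicit Types (u v w x y : F) (a b c d : seq L) (p q : kF).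
Hypothesis compat : compatibility_axiom Rel.

(** Predicates on raw letter sequences, so that the combinatorics above applies without proofs of
    reducedness. *)
Definition Mw a := exists2 u : F, Mon Rel u & word u = a.
Definition Pw a := exists2 u : F, small_piece_or_letter Rel u & word u = a.

Lemma Mw_reduced a : Mw a -> reduced a.
Proof. by case=> u _ <-; apply: word_reduced. Qed.

Lemma MwE u : Mw (word u) <-> Mon Rel u.
Proof. by split=> [[v Mv /word_inj <-]|Mu] //; exists u. Qed.

Lemma Pw_reduced a : Pw a -> reduced a.
Proof. by case=> u _ <-; apply: word_reduced. Qed.

Lemma Mw_nf a : Mw a -> Mon Rel (nf a).
Proof. by move=> Ma; apply/MwE; rewrite nfK // Mw_reduced. Qed.

Lemma Mw_supp p x : Rel p -> x \in msupp p -> Mw x.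
Proof. by move=> Rp xp; apply/MwE; exists p. Qed.

Lemma supp_strip p w a b c : w \in msupp p -> word w = a ++ b ++ c ->
  nf b \in msupp (rmul (lmul (nf a)^-1%g p) (nf c)^-1%g).
Proof.
move=> wp Ew; rewrite supp_rmul supp_lmul !invgK.
by rewrite mulgA -!nfM -catA -Ew wordK.
Qed.

Lemma Rel_strip p w a b c : Rel p -> w \in msupp p -> word w = a ++ b ++ c ->
  Rel (rmul (lmul (nf a)^-1%g p) (nf c)^-1%g).
Proof.
move=> Rp wp Ew; have Rp' := Rel_stripl compat Rp wp Ew.
apply: (Rel_stripr compat (w := nf (b ++ c)) (a := b)) => //.
  by rewrite supp_lmul invgK -nfM -Ew wordK.
by rewrite nfK //; apply: (@reduced_catr _ a); rewrite -Ew word_reduced.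
Qed.

Lemma Mw_sub : sub_closed Mw.
Proof.
move=> a b c [w [p Rp wp] Ew]; exists (nf b); last first.
  by rewrite nfK //; apply: (@reduced_sub _ a b c); rewrite -Ew word_reduced.
exists (rmul (lmul (nf a)^-1%g p) (nf c)^-1%g); first exact: Rel_strip wp Ew.
exact: (supp_strip wp Ew).
Qed.

Lemma Pw_nil : Pw [::].
Proof. by exists 1%g; [left; left|]. Qed.

(** A witness for a small piece becomes one for its subword when the outer parts are moved into
    [a1], [a2], [b1], [b2]. The multipliers stay the same, as these parts cancel in them. *)
Lemma Pw_sub : sub_closed Pw.
Proof.
move=> a b c [w Sw Ew]; have rw := word_reduced w; rewrite Ew in rw.
have rb := reduced_sub rw; exists (nf b); last by rewrite nfK.
case: Sw => [[w1|[Mc [p [q [x [y [a1 [a2 [b1 [b2 [Rpq [xp Ex] [yq Ey] nR]]]]]]]]]]]|[Mc sc]].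
- by left; left; move: Ew; rewrite w1; case: (a) => //; case: (b) => // *; rewrite nf_nil.
- left; right; split; first by apply: Mw_nf; apply: (@Mw_sub a _ c); rewrite -Ew; apply/MwE.
  rewrite Ew in Ex Ey.
  have [r1 r2] : reduced (a1 ++ a) /\ reduced (c ++ a2).
    have := word_reduced x; rewrite Ex -!catA catA => r.
    by split; [apply: reduced_catl r|move: r => /reduced_catr/reduced_catr].
  have [r3 r4] : reduced (b1 ++ a) /\ reduced (c ++ b2).
    have := word_reduced y; rewrite Ey -!catA catA => r.
    by split; [apply: reduced_catl r|move: r => /reduced_catr/reduced_catr].
  exists p, q, x, y, (nf (a1 ++ a)), (nf (c ++ a2)), (nf (b1 ++ a)), (nf (c ++ b2)).
  rewrite (nfK r1) (nfK r2) (nfK r3) (nfK r4) (nfK rb); split; first exact: Rpq.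
    by split; [exact: xp|rewrite Ex -!catA].
    by split; [exact: yq|rewrite Ey -!catA].
  have e1 : (nf (b1 ++ a) * (nf (a1 ++ a))^-1)%g = (b1 * a1^-1)%g.
    by rewrite !nfM !wordK mulgKA.
  have e2 : ((nf (c ++ a2))^-1 * nf (c ++ b2))%g = (a2^-1 * b2)%g.
    by rewrite !nfM !wordK invgM mulgA mulgVK.
  by rewrite e1 e2; exact: nR.
- have Mb : Mw b by apply: (@Mw_sub a _ c); rewrite -Ew; apply/MwE.
  have [b0|/eqP b0] := eqVneq b [::]; first by left; left; rewrite b0 nf_nil.
  right; split; first exact: Mw_nf.
  move: sc; rewrite nfK // Ew !size_cat => sc.
  by apply/eqP; rewrite eqn_leq; case: (b) b0 sc => // ? ? _ /=; lia.
Qed.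

Lemma Mw_letter (z : L) : Mw [:: z] -> Pw [:: z].
Proof. by case=> u Mu Eu; exists u => //; right; split=> //; rewrite Eu. Qed.

(** The contrapositive of the definition of a small piece, for both sides at once. *)
Lemma Rel_glue c p x a d b1 b2 : ~ Pw c -> Rel p -> x \in msupp p ->
  word x = a ++ c ++ d -> Mw (b1 ++ c ++ b2) ->
  Rel (lmul (nf b1 * (nf a)^-1)%g p) /\ Rel (rmul p ((nf d)^-1 * nf b2)%g).
Proof.
move=> nP Rp xp Ex [y [q Rq yq] Ey].
have := word_reduced x; have := word_reduced y; rewrite Ex Ey => ry rx.
have [ra rc rd] : [/\ reduced a, reduced c & reduced d].
  by split; [apply: reduced_catl rx|apply: reduced_sub rx|move: rx => /reduced_catr/reduced_catr].
have [rb1 rb2] : reduced b1 /\ reduced b2.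
  by split; [apply: reduced_catl ry|move: ry => /reduced_catr/reduced_catr].
apply: contrapT => nR; apply: nP; exists (nf c); last by rewrite nfK.
left; right; split.
  by apply: Mw_nf; apply: (@Mw_sub a _ d); rewrite -Ex; apply/MwE; exists p.
exists p, q, x, y, (nf a), (nf d), (nf b1), (nf b2).
rewrite (nfK ra) (nfK rd) (nfK rb1) (nfK rb2) (nfK rc); split; first by split.
- by split.
- by split.
- by apply/not_andP.
Qed.

Lemma Rel_gluel (a b c x : F) p : ~ Pw c -> Rel p -> x \in msupp p ->
  word x = a ++ c -> Mw (b ++ c) -> Rel (lmul (b * a^-1)%g p).
Proof.
move=> nP Rp xp Ex Mbc.
have Ex' : word x = a ++ c ++ [::] by rewrite Ex (cats0 (word c)).
have Mbc' : Mw (b ++ c ++ [::]) by rewrite (cats0 (word c)).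
by have [] := Rel_glue nP Rp xp Ex' Mbc'; rewrite (wordK a) (wordK b).
Qed.

Lemma Rel_gluer (c d b x : F) p : ~ Pw c -> Rel p -> x \in msupp p ->
  word x = c ++ d -> Mw (c ++ b) -> Rel (rmul p (d^-1 * b)%g).
Proof.
move=> nP Rp xp Ex Mbc.
by have [_] := @Rel_glue c p x [::] d [::] b nP Rp xp Ex Mbc; rewrite (wordK d) (wordK b).
Qed.

Lemma Mw_glue : glueable Mw Pw.
Proof.
move=> a c b nP [x [p Rp xp] Ex] Mcb.
have c0 : c <> [::] by move=> h; apply: nP; rewrite h; apply: Pw_nil.
have Ex' : word x = a ++ c ++ [::] by rewrite cats0.
have [_ R2] := @Rel_glue c p x a [::] [::] b nP Rp xp Ex' Mcb.
rewrite nf_nil invg1 mul1g in R2.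
exists (x * nf b)%g; first by exists (rmul p (nf b)) => //; rewrite supp_rmulM.
have rcb := Mw_reduced Mcb.
have rb := reduced_catr rcb; rewrite word_mul (nfK rb) Ex -catA //.
by apply: reduced_glue => //; rewrite -Ex word_reduced.
Qed.

(** If [x] cancelled against an adjacent letter, compatibility would allow [p] to be multiplied by
    that letter, and [m] extended by it would be a monomial. *)
Lemma reduced_turn A m B p x : maxocc Mw A m B -> m <> [::] -> reduced (A ++ m ++ B) ->
  Rel p -> nf m \in msupp p -> x \in msupp p -> x <> 1%g -> reduced (A ++ x ++ B).
Proof.
move=> [Mm ml mr] m0 r Rp mp xp x1; have rm := Mw_reduced Mm.
have x0 : word x <> [::] by move=> h; apply: x1; apply: word_inj.
have rx := word_reduced x.
apply: reduced_glue => //.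
- have {r} r : reduced (A ++ m) by apply: (@reduced_catl _ _ B); rewrite -catA.
  case/lastP: A r ml => // A z r ml; rewrite cat_rcons -cat1s.
  apply: reduced_glue => //; first by rewrite cats1; apply: reduced_catl r.
  case Ex: (word x) x0 rx => [|y s] // _; rewrite /reduced /= => ->; rewrite andbT.
  apply/negP => /eqP Ey; apply: (ml A z erefl); exists (nf (z :: m)).
    exists (lmul (nf [:: y])^-1%g p); first exact: (Rel_stripl compat Rp xp (b := s)).
    rewrite supp_lmul invgK -[z :: m]/([:: z] ++ m) nfM mulgA Ey linv_nf mulVg.
    by rewrite mul1g.
  by rewrite nfK //; apply: (@reduced_catr _ A); rewrite -cat_rcons.
- have {r} r : reduced (m ++ B) by apply: reduced_catr r.
  case: B r mr => [|z B] r mr; first by rewrite cats0.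
  rewrite -cat1s; apply: reduced_glue => //; last by apply: reduced_catr r.
  case/lastP Ex: (word x) x0 rx => [|s y] // _ rx.
  rewrite cat_rcons -cat1s; apply: reduced_glue => //; first by rewrite cats1.
  rewrite /reduced /= andbT; apply/negP => /eqP Ey; apply: (mr z B erefl).
  exists (nf (rcons m z)).
    exists (rmul p (nf [:: y])^-1%g).
      by apply: (Rel_stripr compat Rp xp (a := s)); rewrite Ex cats1.
    rewrite supp_rmul invgK -cats1 nfM -mulgA.
    have -> : (nf [:: z] * nf [:: y])%g = 1%g by rewrite Ey linv_nf mulVg.
    by rewrite mulg1.
  by rewrite nfK // -cats1; apply: (@reduced_catl _ _ B); rewrite -catA.
Qed.

(** If a letter extends the non-piece [x] to a monomial, it multiplies all of [p] within [Rel], so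
    it extends [m] too. *)
Lemma maxocc_turn A m B p x : maxocc Mw A m B -> m <> [::] -> reduced (A ++ m ++ B) ->
  ~ Pw x -> Rel p -> nf m \in msupp p -> x \in msupp p -> maxocc Mw A x B.
Proof.
move=> [Mm ml mr] m0 r nP Rp mp xp; have rm := Mw_reduced Mm.
have e0 : word x = [::] ++ x ++ [::] by rewrite cats0.
split; first by apply/MwE; exists p.
- move=> A' z EA Mz; apply: (ml A' z EA).
  have [|R1 _] := @Rel_glue x p x [::] [::] [:: z] [::] nP Rp xp e0; first by rewrite cats0.
  rewrite nf_nil invg1 mulg1 in R1.
  exists (nf (z :: m)).
    exists (lmul (nf [:: z]) p) => //.
    by rewrite -[z :: m]/([:: z] ++ m) nfM supp_lmulM.
  by rewrite nfK //; apply: (@reduced_sub _ A' _ B); rewrite /= -cat_rcons -EA.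
- move=> z B' EB Mz; apply: (mr z B' EB).
  have [|_ R1] := @Rel_glue x p x [::] [::] [::] [:: z] nP Rp xp e0; first by rewrite cats1.
  rewrite nf_nil invg1 mul1g in R1.
  exists (nf (rcons m z)).
    by exists (rmul p (nf [:: z])) => //; rewrite -cats1 nfM supp_rmulM.
  by rewrite nfK //; apply: (@reduced_sub _ A _ B'); rewrite cat_rcons -EB.
Qed.

End Gluing.

(** * Positions in the free group *)

Section Positions.
Variables (k : fieldType) (X : choiceType).
Local Notation F := (freegroup X).
Local Notation L := (letter X).
Local Notation kF := (galg k F).
Variable Rel : set kF.
Implicit Types (A B m g x y z u v w : F) (a b c d : seq L) (p q : kF).
Hypothesis compat : compatibility_axiom Rel.

Local Notation Mw := (Mw Rel).
Local Notation Pw := (Pw Rel).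
Local Notation Lam := (Lam Pw).
Local Notation C := (cost Mw Pw 3).
Local Notation pos := (position Mw Pw).

Let Msub := Mw_sub compat.
Let Psub := Pw_sub compat.
Let Pnil := Pw_nil Rel.
Let Glue := Mw_glue compat.

Definition fpos t A m B := reduced (A ++ m ++ B) /\ pos t A m B.

Lemma fposE t A m B : fpos t A m B -> word (A * m * B)%g = A ++ m ++ B.
Proof. by case=> r _; apply: word_mul3. Qed.

Lemma fpos_le t t' A m B : (t <= t')%N -> fpos t' A m B -> fpos t A m B.
Proof. by move=> le [r h]; split=> //; apply: pos_le h. Qed.

Lemma fpos_nf t a b c : pos t a b c -> reduced (a ++ b ++ c) ->
  [/\ fpos t (nf a) (nf b) (nf c), word (nf a) = a, word (nf b) = b & word (nf c) = c].
Proof.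
move=> h r; have [ra rb rc] : [/\ reduced a, reduced b & reduced c].
  by split; [apply: reduced_catl r|apply: reduced_sub r|move: r => /reduced_catr/reduced_catr].
by rewrite /fpos !nfK.
Qed.

Lemma fpos_eqw t t' A m B A2 g B2 : fpos t A m B -> fpos t' A2 g B2 ->
  (A * m * B = A2 * g * B2)%g -> A ++ m ++ B = A2 ++ g ++ B2.
Proof. by move=> pm pg E; rewrite -(fposE pm) -(fposE pg) E. Qed.

Lemma fpos_eq A m B A2 g B2 : fpos 4 A m B -> fpos 4 A2 g B2 ->
  (A * m * B = A2 * g * B2)%g -> size A = size A2 -> [/\ A = A2, m = g & B = B2].
Proof.
move=> pm pg E eq; have E' := fpos_eqw pm pg E.
by have [/word_inj -> /word_inj -> /word_inj ->] :=
  pos_eq Msub Psub Pnil Glue pm.2 pg.2 E' eq.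
Qed.

Lemma fpos_eqr A m B A2 g B2 : fpos 4 A m B -> fpos 4 A2 g B2 ->
  (A * m * B = A2 * g * B2)%g -> size B = size B2 -> [/\ A = A2, m = g & B = B2].
Proof.
move=> pm pg E eq; have E' := fpos_eqw pm pg E.
by have [/word_inj -> /word_inj -> /word_inj ->] :=
  pos_eqr Msub Psub Pnil Glue pm.2 pg.2 E' eq.
Qed.

Lemma fpos_order A m B A2 g B2 : fpos 4 A m B -> fpos 4 A2 g B2 ->
  (A * m * B = A2 * g * B2)%g -> (size A < size A2)%N = (size B2 < size B)%N.
Proof.
move=> pm pg E; have E' := fpos_eqw pm pg E.
have H := pos_order Msub Pnil Glue pm.2 pg.2 E'.
have H' := pos_order Msub Pnil Glue pg.2 pm.2 (esym E').
apply/idP/idP => // lt; rewrite ltnNge leq_eqVlt; apply/negP => /orP[/eqP eq|/H' lt'].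
  by have [_ _ EB] := fpos_eq pm pg E (esym eq); move: lt; rewrite EB ltnn.
by move: lt; rewrite ltnNge (ltnW lt').
Qed.

Lemma turned p A m B x : fpos 4 A m B -> Rel p -> m \in msupp p -> x \in msupp p ->
  ~ Pw x -> reduced (A ++ x ++ B) /\ maxocc Mw A x B.
Proof.
move=> [r pm] Rp mp xp nP.
have m0 : word m <> [::] by move=> h; apply: (pos_Lam pm); rewrite h; apply: Lam0.
have mp' : nf m \in msupp p by rewrite wordK.
have mx := pos_max pm; split; last exact: maxocc_turn mx m0 r nP Rp mp' xp.
apply: reduced_turn mx m0 r Rp mp' xp _ => // x1; apply: nP; rewrite x1; exact: Pnil.
Qed.

Lemma turned_reduced p A m B x : fpos 4 A m B -> Rel p -> m \in msupp p -> x \in msupp p ->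
  x <> 1%g -> reduced (A ++ x ++ B).
Proof.
move=> [r pm] Rp mp xp x1.
have m0 : word m <> [::] by move=> h; apply: (pos_Lam pm); rewrite h; apply: Lam0.
have mp' : nf m \in msupp p by rewrite wordK.
exact: reduced_turn (pos_max pm) m0 r Rp mp' xp x1.
Qed.

Definition gap_right A m B A2 g B2 m' g' B' := exists z, [/\ word z <> [::],
  word A2 = A ++ m ++ z, word B = z ++ g ++ B2, m' = m & word B' = z ++ g' ++ B2].

Definition adj_right A m B A2 g B2 m' g' B' := exists u c g0 c' g0' : F,
  [/\ [/\ word A2 = A ++ u, word m = u ++ c, word g = c ++ g0 & word B = g0 ++ B2],
      [/\ word m' = u ++ c', word g' = c' ++ g0' & word B' = g0' ++ B2] &
      [/\ ~ Lam 3 u, ~ Lam 3 g0 & ~ Lam 3 g0']].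

Lemma fturn_right A m B A2 g g' B2 : fpos 4 A m B -> fpos 4 A2 g B2 -> fpos 4 A2 g' B2 ->
  (A * m * B = A2 * g * B2)%g -> (size A < size A2)%N ->
  exists m' B', [/\ (A2 * g' * B2 = A * m' * B')%g, C B' = C B,
    forall t, fpos t A m B -> fpos t A m' B' &
    gap_right A m B A2 g B2 m' g' B' \/ adj_right A m B A2 g B2 m' g' B'].
Proof.
move=> pm pg pg' E lt; have E' := fpos_eqw pm pg E.
have [m' [B' [E1 EC ht hc]]] := turn_right Msub Psub Pnil Glue pm.2 pg.2 pg'.2 E' lt.
have r : reduced (A ++ m' ++ B') by rewrite -E1; case: pg'.
have pm' : fpos 4 A (nf m') (nf B').
  by have [] := fpos_nf (ht 4 pm.2) r; rewrite wordK.
have [rm rB] : reduced m' /\ reduced B'.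
  by split; [apply: reduced_sub r|move: r => /reduced_catr/reduced_catr].
exists (nf m'), (nf B'); split.
- by apply: word_inj; rewrite (fposE pg') (fposE pm') !nfK.
- by rewrite nfK.
- by move=> t pt; rewrite /fpos !nfK //; split=> //; apply: ht; case: pt.
have rA2 := word_reduced A2; have rw := word_reduced m; have rg := word_reduced g.
have rg' := word_reduced g'.
case: hc => [[z [z0 EA EB Em' EB']]|].
  have rz : reduced z by apply: (@reduced_sub _ (A ++ m) z [::]); rewrite cats0 -catA -EA.
  left; exists (nf z); rewrite !nfK //; split=> //; by rewrite Em' wordK.
move=> [u [c [g0 [c' [g0' [[u0 EA Em Eg EB] [Em' Eg' EB'] [Pc Pc'] [n1 n2 n3]]]]]]].
have ru : reduced u by apply: (@reduced_catr _ A); rewrite -EA.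
have rc : reduced c by apply: (@reduced_catr _ u); rewrite -Em.
have rg0 : reduced g0 by apply: (@reduced_catr _ c); rewrite -Eg.
have rc' : reduced c' by apply: (@reduced_catr _ u); rewrite -Em'.
have rg0' : reduced g0' by apply: (@reduced_catr _ c'); rewrite -Eg'.
by right; exists (nf u), (nf c), (nf g0), (nf c'), (nf g0'); rewrite !nfK.
Qed.

Definition gap_left A m B A2 g B2 m' g' A' := exists z, [/\ word z <> [::],
  word B2 = z ++ m ++ B, word A = A2 ++ g ++ z, m' = m & word A' = A2 ++ g' ++ z].

Definition adj_left A m B A2 g B2 m' g' A' := exists u c g0 c' g0' : F,
  [/\ [/\ word B2 = u ++ B, word m = c ++ u, word g = g0 ++ c & word A = A2 ++ g0],
      [/\ word m' = c' ++ u, word g' = g0' ++ c' & word A' = A2 ++ g0'] &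
      [/\ ~ Lam 3 u, ~ Lam 3 g0 & ~ Lam 3 g0']].

Lemma fturn_left A m B A2 g g' B2 : fpos 4 A m B -> fpos 4 A2 g B2 -> fpos 4 A2 g' B2 ->
  (A * m * B = A2 * g * B2)%g -> (size B < size B2)%N ->
  exists A' m', [/\ (A2 * g' * B2 = A' * m' * B)%g, C A' = C A,
    forall t, fpos t A m B -> fpos t A' m' B &
    gap_left A m B A2 g B2 m' g' A' \/ adj_left A m B A2 g B2 m' g' A'].
Proof.
move=> pm pg pg' E lt; have E' := fpos_eqw pm pg E.
have [A' [m' [E1 EC ht hc]]] := turn_left Msub Psub Pnil Glue pm.2 pg.2 pg'.2 E' lt.
have r : reduced (A' ++ m' ++ B) by rewrite -E1; case: pg'.
have pm' : fpos 4 (nf A') (nf m') B.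
  by have [] := fpos_nf (ht 4 pm.2) r; rewrite wordK.
have [rm rA] : reduced m' /\ reduced A'.
  by split; [apply: reduced_sub r|apply: reduced_catl r].
exists (nf A'), (nf m'); split.
- by apply: word_inj; rewrite (fposE pg') (fposE pm') !nfK.
- by rewrite nfK.
- by move=> t pt; rewrite /fpos !nfK //; split=> //; apply: ht; case: pt.
have rB2 := word_reduced B2; have rw := word_reduced m; have rg := word_reduced g.
have rg' := word_reduced g'.
case: hc => [[z [z0 EB EA Em' EA']]|].
  have rz : reduced z by apply: (@reduced_catl _ z (m ++ B)); rewrite -EB.
  left; exists (nf z); rewrite !nfK //; split=> //; by rewrite Em' wordK.
move=> [u [c [g0 [c' [g0' [[u0 EB Em Eg EA] [Em' Eg' EA'] [Pc Pc'] [n1 n2 n3]]]]]]].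
have ru : reduced u by apply: (@reduced_catl _ _ B); rewrite -EB.
have rc : reduced c by apply: (@reduced_catl _ _ u); rewrite -Em.
have rg0 : reduced g0 by apply: (@reduced_catl _ _ c); rewrite -Eg.
have rc' : reduced c' by apply: (@reduced_catl _ _ u); rewrite -Em'.
have rg0' : reduced g0' by apply: (@reduced_catl _ _ c'); rewrite -Eg'.
by right; exists (nf u), (nf c), (nf g0), (nf c'), (nf g0'); rewrite !nfK.
Qed.

(** The turn at [g] produces some position with prefix [A]; uniqueness identifies it with the given
    one, and the situation is symmetric in [g] and [g']. *)
Lemma edge_right A m B A2 g g' B2 m' B' :
  fpos 4 A m B -> fpos 4 A2 g B2 -> fpos 4 A2 g' B2 -> fpos 4 A m' B' ->
  (A * m * B = A2 * g * B2)%g -> (A * m' * B' = A2 * g' * B2)%g ->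
  (size A < size A2)%N -> forall t, fpos t A m B <-> fpos t A m' B'.
Proof.
suff half A' n D A2' h h' B2' n' D' :
  fpos 4 A' n D -> fpos 4 A2' h B2' -> fpos 4 A2' h' B2' -> fpos 4 A' n' D' ->
  (A' * n * D = A2' * h * B2')%g -> (A' * n' * D' = A2' * h' * B2')%g ->
  (size A' < size A2')%N -> forall t, fpos t A' n D -> fpos t A' n' D'.
  by move=> pm pg pg' pm' E E' lt t; split; [apply: half E E' lt t|apply: half E' E lt t].
move=> pm pg pg' pm' E E' lt t.
have [n1 [D1 [E1 _ ht _]]] := fturn_right pm pg pg' E lt.
have [_ <- <-] := fpos_eq (ht 4 pm) pm' (etrans (esym E1) (esym E')) erefl.
exact: ht.
Qed.

Lemma edge_left A m B A2 g g' B2 A' m' :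
  fpos 4 A m B -> fpos 4 A2 g B2 -> fpos 4 A2 g' B2 -> fpos 4 A' m' B ->
  (A * m * B = A2 * g * B2)%g -> (A' * m' * B = A2 * g' * B2)%g ->
  (size B < size B2)%N -> forall t, fpos t A m B <-> fpos t A' m' B.
Proof.
suff half D n B' A2' h h' B2' D' n' :
  fpos 4 D n B' -> fpos 4 A2' h B2' -> fpos 4 A2' h' B2' -> fpos 4 D' n' B' ->
  (D * n * B' = A2' * h * B2')%g -> (D' * n' * B' = A2' * h' * B2')%g ->
  (size B' < size B2')%N -> forall t, fpos t D n B' -> fpos t D' n' B'.
  by move=> pm pg pg' pm' E E' lt t; split; [apply: half E E' lt t|apply: half E' E lt t].
move=> pm pg pg' pm' E E' lt t.
have [D1 [n1 [E1 _ ht _]]] := fturn_left pm pg pg' E lt.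
have [<- <- _] := fpos_eqr (ht 4 pm) pm' (etrans (esym E1) (esym E')) erefl.
exact: ht.
Qed.

End Positions.

(** * Commuting squares *)

Section Squares.
Variables (k : fieldType) (X : choiceType).
Local Notation F := (freegroup X).
Local Notation L := (letter X).
Local Notation kF := (galg k F).
Variable Rel : set kF.
Implicit Types (A B m g x y z u v w : F) (a b c d : seq L) (p q : kF).
Hypothesis compat : compatibility_axiom Rel.

Local Notation Mw := (Mw Rel).
Local Notation Pw := (Pw Rel).
Local Notation Lam := (Lam Pw).
Local Notation C := (cost Mw Pw 3).
Local Notation fpos := (fpos Rel).

Let Msub := Mw_sub compat.
Let Psub := Pw_sub compat.
Let Pnil := Pw_nil Rel.
Let Glue := Mw_glue compat.

Lemma mul_word w u v : word w = u ++ v -> w = (u * v)%g.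
Proof. by case/word_cat; rewrite !wordK. Qed.

Lemma cat_inj2 (a b c d : seq L) : size a = size c -> a ++ b = c ++ d -> a = c /\ b = d.
Proof. by move=> s /eqP; rewrite eqseq_cat // => /andP[/eqP-> /eqP->]. Qed.

Lemma catI (a b d : seq L) : a ++ b = a ++ d -> b = d.
Proof. by move=> /(cat_inj2 erefl)[]. Qed.

Lemma nLam_nPw t w : ~ Lam t.+1 w -> ~ Pw w.
Proof. by move=> n /(Lam1 Pnil) h; apply: n; apply: Lam_le h. Qed.

Lemma nLam_neq0 t w : ~ Lam t w -> word w <> [::].
Proof. by move=> n h; apply: n; rewrite h; apply: Lam0. Qed.

(* The left-hand word [x f] of the square is determined by comparing the two
   factorizations [x f . y0 = x0 . e y] of the same reduced word. *)
Lemma square_adj A1 (b0 c m0 : F) B2 A2 (b m x y b1 m1 x0 c1 d y0 : F) B1 B1' A2' :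
  fpos 4 A1 b B1 -> fpos 4 A2 m B2 -> fpos 4 A1 x B1 -> fpos 4 A2 y B2 ->
  fpos 4 A1 b1 B1' -> fpos 4 A2' m1 B2 ->
  incident Rel b x -> incident Rel m y ->
  [/\ word A2 = A1 ++ b0, word b = b0 ++ c, word m = c ++ m0 & word B1 = m0 ++ B2] ->
  [/\ word b1 = b0 ++ d, word y = d ++ y0 & word B1' = y0 ++ B2] ->
  [/\ word m1 = c1 ++ m0, word x = x0 ++ c1 & word A2' = A1 ++ x0] ->
  ~ Lam 3 b0 -> ~ Lam 3 m0 -> ~ Lam 3 x0 -> ~ Lam 3 y0 ->
  let f := (c^-1 * d)%g in let e := (c1 * c^-1)%g in
  [/\ b1 = (b * f)%g /\ m1 = (e * m)%g, (A1 * (x * f) * B1' = A2' * (e * y) * B2)%g,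
      fpos 4 A1 (x * f)%g B1' /\ reduced (A2' ++ (e * y)%g ++ B2) /\ maxocc Mw A2' (e * y)%g B2,
      forall p, Rel p -> b \in msupp p \/ x \in msupp p -> Rel (rmul p f) &
      forall q, Rel q -> m \in msupp q \/ y \in msupp q -> Rel (lmul e q)].
Proof.
move=> pb pm px py pb1 pm1 [p0 [Rp0 bp0 xp0]] [q0 [Rq0 mq0 yq0]].
move=> [EA2 Eb Em EB1] [Eb1 Ey EB1'] [Em1 Ex EA2'] nb0 nm0 nx0 ny0 f e.
have [[[gb gm] gx] gy] := (mul_word Eb, mul_word Em, mul_word Ex, mul_word Ey).
have [gb1 gm1] := (mul_word Eb1, mul_word Em1).
have [[[gA2 gA2'] gB1] gB1'] := (mul_word EA2, mul_word EA2', mul_word EB1, mul_word EB1').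
have eb1 : b1 = (b * f)%g by rewrite gb1 gb /f mulgA mulgK.
have em1 : m1 = (e * m)%g by rewrite gm1 gm /e mulgA mulgVK.
have Eg : (A1 * (x * f) * B1' = A2' * (e * y) * B2)%g.
  by rewrite gB1' gA2' /f /e gx gy !mulgA.
have M1 : Mw (b0 ++ d) by rewrite -Eb1; case: (pos_max pb1.2).
have M2 : Mw (c1 ++ m0) by rewrite -Em1; case: (pos_max pm1.2).
have Rf p : Rel p -> b \in msupp p -> Rel (rmul p f).
  by move=> Rp bp; apply: (Rel_gluer compat (nLam_nPw nb0) Rp bp Eb M1).
have Re q : Rel q -> m \in msupp q -> Rel (lmul e q).
  by move=> Rq mq; apply: (Rel_gluel compat (nLam_nPw nm0) Rq mq Em M2).
have Rpf := Rf _ Rp0 bp0; have Req := Re _ Rq0 mq0.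
have b1pf : b1 \in msupp (rmul p0 f) by rewrite eb1 supp_rmulM.
have xfpf : (x * f)%g \in msupp (rmul p0 f) by rewrite supp_rmulM.
have m1eq : m1 \in msupp (lmul e q0) by rewrite em1 supp_lmulM.
have eyeq : (e * y)%g \in msupp (lmul e q0) by rewrite supp_lmulM.
have r1 : reduced ((x * f)%g ++ y0).
  have [->|/eqP n1] := eqVneq (x * f)%g 1%g; first exact: word_reduced.
  have := turned_reduced compat pb1 Rpf b1pf xfpf n1; rewrite EB1' => /reduced_catr.
  by rewrite catA => /reduced_catl.
have r2 : reduced (x0 ++ (e * y)%g).
  have [->|/eqP n1] := eqVneq (e * y)%g 1%g; first by rewrite cats0; exact: word_reduced.
  have := turned_reduced compat pm1 Req m1eq eyeq n1; rewrite EA2' -catA => /reduced_catr.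
  by rewrite catA => /reduced_catl.
have Exy : (x * f)%g ++ y0 = x0 ++ (e * y)%g.
  by rewrite -(word_mul r1) -(word_mul r2) /f /e gx gy !mulgA.
(* If [x0] were longer than [x f], by a word starting with [z], then [d z] would be a prefix of [c].
   So [b1] followed by [z] would be a subword of [b], against the maximality of [b1]. *)
have [s [Exf Eey]] : exists s : seq L, word (x * f)%g = x0 ++ s /\ word (e * y)%g = s ++ y0.
  case: (cat_split Exy) => [[s [Ex0 Ey0]]|[s [_ [-> ->]]]]; last by exists s.
  case: s => [|z s] in Ex0 Ey0 *.
    by exists [::]; rewrite Ex0 !cats0 Ey0.
  have rs : reduced (z :: s) by apply: (@reduced_catr _ (x * f)%g); rewrite -Ex0 word_reduced.
  have [gx0 _ _] := word_cat Ex0.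
  have Ec : c = (d * (nf (z :: s) * c1))%g.
    rewrite wordK in gx0.
    have E1 : (x * f * (nf (z :: s) * c1) = x)%g by rewrite mulgA -gx0 -gx.
    have E2 : (f^-1 = nf (z :: s) * c1)%g by apply: (mulgI (x * f)%g); rewrite /= E1 mulgK.
    by rewrite -E2 /f invgM invgK mulVKg.
  have rdz : reduced (d ++ z :: s).
    by apply: (@reduced_catl _ _ (e * y)%g); rewrite -catA -Ey0 -Ey word_reduced.
  have rzc : reduced ((z :: s) ++ c1).
    by apply: (@reduced_catr _ (x * f)%g); rewrite catA -Ex0 -Ex word_reduced.
  have wc : word c = d ++ (z :: s) ++ c1.
    have rall : reduced (d ++ (z :: s) ++ c1) by apply: reduced_glue.
    by rewrite -[RHS](nfK rall) !nfM !wordK -Ec.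
  exfalso; have [_ _ mr] := pos_max pb1.2.
  apply: (mr z (s ++ (e * y)%g ++ B2)); first by rewrite EB1' Ey0 /= -catA.
  rewrite Eb1 rcons_cat -cats1; apply: (M_catl Msub (v := s ++ c1)).
  have : Mw b by case: (pos_max pb.2).
  by rewrite Eb wc -!catA.
have rs : reduced s by apply: (@reduced_catr _ x0); rewrite -Exf word_reduced.
have E1 : (x * f = x0 * nf s)%g by have [-> _ _] := word_cat Exf; rewrite (wordK x0).
have E2 : (e * y = nf s * y0)%g by have [-> _ _] := word_cat Eey; rewrite (wordK y0).
have nxf : ~ Lam 3 (x * f)%g by rewrite Exf => h; apply: nx0; apply: (Lam_catl Psub) h.
have ney : ~ Lam 3 (e * y)%g by rewrite Eey => h; apply: ny0; apply: (Lam_catr Psub) h.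
have [rxf mxf] := turned compat pb1 Rpf b1pf xfpf (nLam_nPw nxf).
have [rey mey] := turned compat pm1 Req m1eq eyeq (nLam_nPw ney).
split.
- by split; [exact: eb1|exact: em1].
- exact: Eg.
- split; last exact: conj rey mey.
  split; first exact: rxf.
  rewrite Exf EB1'.
  have px2 := px.2; rewrite Ex EB1 in px2.
  have [t1 t2] := maxocc_trim Msub Glue (pos_max pb1.2).
  have cA : C (A1 ++ b0) = C A1 + 3.
    apply: (cost_left Msub Psub Pnil (m := c)) nb0.
      by have [] := maxocc_trim Msub Glue (pos_max pb.2); rewrite Eb.
    exact: (M_catl Msub M1).
  (* The prefix [d] of [y] is free after [A2], as [A1 b0] and [A1 b0 d] both cost [C A1 + 3];
     trimming it leaves [y0]. *)
  have n4 : ~ Lam 4 y0.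
    apply: (py.2.2 d y0 [::]); [by rewrite Ey cats0| |by []].
    rewrite EA2 -catA cA -Eb1.
    have [Mb1 _ _] := pos_max pb1.2.
    apply/eqP; rewrite eqn_leq; apply/andP; split.
      apply: leq_trans (cost_cat Mw Pw 3 A1 b1) _; rewrite leq_add2l.
      exact: cost_M.
    by rewrite -cA Eb1 catA; apply: (cost_catl Msub Psub).
  apply: (pos_adj Msub Psub Pnil Glue (c := c1) (g0 := m0)).
  + by rewrite -Em1 -EA2'; exact: pos_max pm1.2.
  + by rewrite -Em1; exact: pos_Lam pm1.2.
  + by rewrite -Eey -EA2'.
  + by move=> h; apply: n4; apply: (Lam_catr Psub) h.
  + by rewrite -Exf -EB1'.
  + exact: nLam_neq0 nx0.
  + exact: nx0.
  + exact: nm0.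
  + exact: ny0.
  + exact: px2.
(* The monomials [x] and [x f] share the non-piece prefix [x0], so relators containing [x] admit the
   same multiplier [f]. *)
- move=> p Rp [|xp]; first exact: Rf.
  have Mxf : Mw (x0 ++ nf s) by rewrite (nfK rs) -Exf; apply: Mw_supp xfpf.
  have := Rel_gluer compat (nLam_nPw nx0) Rp xp Ex Mxf.
  suff -> : (c1^-1 * nf s = f)%g by [].
  by apply: (mulgI x); rewrite /= {1}gx -mulgA mulVKg E1.
- move=> q Rq [|yq]; first exact: Re.
  have Mey : Mw (nf s ++ y0) by rewrite (nfK rs) -Eey; apply: Mw_supp eyeq.
  have := Rel_gluel compat (nLam_nPw ny0) Rq yq Ey Mey.
  suff -> : (nf s * d^-1 = e)%g by [].
  by apply: (mulIg y); rewrite /= {1}gy mulgA mulgVK E2.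
Qed.

(** Across a gap both multipliers are 1. If the monomials touch, [f = c^-1 d] and [e = c1 c^-1]
    exchange the shared piece, and the case is that of [square_adj]. *)
Lemma square A1 (b : F) B1 A2 m B2 x y :
  fpos 4 A1 b B1 -> fpos 4 A2 m B2 -> (A1 * b * B1 = A2 * m * B2)%g ->
  (size A1 < size A2)%N -> fpos 4 A1 x B1 -> fpos 4 A2 y B2 ->
  incident Rel b x -> incident Rel m y ->
  exists f B1' e A2',
  [/\ [/\ (A2 * y * B2 = A1 * (b * f) * B1')%g, (A1 * x * B1 = A2' * (e * m) * B2)%g &
          (A1 * (x * f) * B1' = A2' * (e * y) * B2)%g],
      [/\ fpos 4 A1 (b * f)%g B1', fpos 4 A1 (x * f)%g B1',
          fpos 4 A2' (e * m)%g B2 & fpos 4 A2' (e * y)%g B2],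
      (size A1 < size A2')%N /\ (size B2 < size B1')%N,
      forall p, Rel p -> b \in msupp p \/ x \in msupp p -> Rel (rmul p f) &
      forall q, Rel q -> m \in msupp q \/ y \in msupp q -> Rel (lmul e q)].
Proof.
move=> pb pm E lt px py ibx imy.
have ltr : (size B2 < size B1)%N by rewrite -(fpos_order compat pb pm E).
have [A2' [m1 [E1 _ hm hl]]] := fturn_left compat pm pb px (esym E) ltr.
have [b1 [B1' [E2 _ hb hr]]] := fturn_right compat pb pm py E lt.
have {hm}pm1 := hm 4 pm; have {hb}pb1 := hb 4 pb.
have sz u : ~ Lam 3 u -> (0 < size u)%N by move=> /nLam_neq0; case: (word u).
have xl : (0 < size x)%N by apply: sz => h; apply: (pos_Lam px.2); apply: Lam_le h.
have bl : (0 < size b)%N by apply: sz => h; apply: (pos_Lam pb.2); apply: Lam_le h.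
have yl : (0 < size y)%N by apply: sz => h; apply: (pos_Lam py.2); apply: Lam_le h.
(* The two turns start from the same word, so they agree on whether there is a gap: [A2] ends either
   beyond [b] or not. *)
have nogap u (z : F) : word z <> [::] -> word A2 = A1 ++ b ++ z -> word A2 = A1 ++ u ->
    (size u <= size b)%N -> False.
  move=> z0 -> /catI <-; rewrite size_cat; case: (word z) z0 => //= *; lia.
case: hl => [[z [z0 EB1 EA2 Em1 EA2']]|[m0 [c [b0 [c1 [x0 [[EB1 Em Eb EA2] [Em1 Ex EA2'] [n1 n2 n3]]]]]]]].
- case: hr => [[z' [_ EA2z _ Eb1 EB1']]|[u [cc [g0 [cc' [g0' [[EA2u Ebu _ _] _ _]]]]]]]; last first.
    case: (nogap _ _ z0 EA2 EA2u); rewrite Ebu size_cat; exact: leq_addr.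
  have Ez : word z' = word z.
    by apply: (@catI b); apply: (@catI A1); rewrite -EA2z.
  rewrite Ez in EB1'.
  have pb' : fpos 4 A1 b B1' by rewrite -Eb1.
  have px' : fpos 4 A1 x B1'.
    split.
      rewrite EB1'.
      have ra : reduced ((A1 ++ x) ++ z).
        have := pm1.1; rewrite EA2' -!catA => r.
        by apply: (@reduced_catl _ _ (m1 ++ B2)); rewrite -!catA.
      have rb : reduced (z ++ y ++ B2) by rewrite -EB1'; apply: word_reduced.
      by have := reduced_glue z0 ra rb; rewrite -catA.
    rewrite EB1'; apply: (pos_gap Msub Psub Pnil Glue (A' := A1 ++ b) (g := m)) => //.
    + by rewrite -catA -EA2; exact: pm.2.
    + by rewrite -catA -EA2; exact: py.2.
    + by rewrite -EB1; exact: px.2.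
  have E2' : (A2 * y * B2 = A1 * b * B1')%g by rewrite E2 Eb1.
  have ltr' : (size B2 < size B1')%N.
    by rewrite EB1' size_cat size_cat; lia.
  have [A'' [y' [E3 _ hy hl']]] := fturn_left compat py pb' px' E2' ltr'.
  have py' := hy 4 py.
  case: hl' => [[z'' [_ _ EA2z'' Ey' EA'']]|[u [cc [g0 [cc' [g0' [[_ _ Ebu EA2u] _ _]]]]]]]; last first.
    case: (nogap _ _ z0 EA2 EA2u); rewrite Ebu size_cat; exact: leq_addr.
  have EAA : A'' = A2'.
    apply: word_inj; rewrite EA'' EA2'; congr (_ ++ (_ ++ _)).
    by apply: (@catI b); apply: (@catI A1); rewrite -EA2z''.
  rewrite EAA Ey' in E3 py'; rewrite Em1 in E1 pm1.
  exists 1%g, B1', 1%g, A2'; rewrite !mulg1 !mul1g; split.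
  + by split; [exact: E2'|exact: E1|exact: E3].
  + by split.
  + by rewrite EA2' !size_cat; split; [lia|exact: ltr'].
  + by move=> p Rp _; rewrite rmul1.
  + by move=> q Rq _; rewrite lmul1.
case: hr => [[z' [z0 EA2z _ _ _]]|[u [cc [g0 [d [y0 [[EA2u Ebu Emu EB1u] [Eb1 Ey EB1'] [n4 n5 n6]]]]]]]].
  by case: (nogap _ _ z0 EA2z EA2); rewrite Eb size_cat; apply: leq_addr.
have Eu : word u = word b0 by apply: (@catI A1); rewrite -EA2u.
have Ec : word cc = word c by apply: (@catI b0); rewrite -Eb -Eu.
have Em0 : word g0 = word m0 by apply: (@catI c); rewrite -Em -Ec.
rewrite (word_inj Eu) in n4 Eb1.
have [] := square_adj (b0 := b0) (c := c) (m0 := m0) (d := d) (y0 := y0) (x0 := x0) (c1 := c1)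
  pb pm px py pb1 pm1 ibx imy (And4 EA2 Eb Em EB1) (And3 Eb1 Ey EB1') (And3 Em1 Ex EA2') n2 n1 n3 n6.
move=> [eb1 em1] E3 [pxf [rey mey]] Rf Re.
exists (c^-1 * d)%g, B1', (c1 * c^-1)%g, A2'.
have ltr' : (size B2 < size B1')%N by rewrite EB1' size_cat; have := sz _ n6; lia.
have lt' : (size A1 < size A2')%N by rewrite EA2' size_cat; have := sz _ n3; lia.
have pey : fpos 4 A2' (c1 * c^-1 * y)%g B2.
  have [A'' [y' [E4 _ hy _]]] := fturn_left compat py pb1 pxf E2 ltr'.
  have py' := hy 4 py.
  have Ew : A'' ++ y' ++ B2 = A2' ++ (c1 * c^-1 * y)%g ++ B2.
    by rewrite -(fposE py') -E4 E3 word_mul3.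
  have Ew' : A'' ++ y' = A2' ++ (c1 * c^-1 * y)%g.
    have := Ew; rewrite !catA => /cat_inj2[] //.
    by have := congr1 size Ew; rewrite !size_cat; lia.
  have [/word_inj <- /word_inj <-] := maxocc_samer Msub (pos_max py'.2) mey Ew'.
  exact: py'.
split.
- by rewrite -eb1 -em1; split.
- by rewrite -eb1 -em1; split.
- by split.
- exact: Rf.
- exact: Re.
Qed.

End Squares.

(** * Transfers along chains *)

Section Transfers.
Variables (k : fieldType) (X : choiceType).
Local Notation F := (freegroup X).
Local Notation kF := (galg k F).
Variable Rel : set kF.
Implicit Types (A B m g b x y z u v w e f : F) (p q : kF).
Hypothesis compat : compatibility_axiom Rel.
Variable th : nat.
Hypothesis th_ge4 : 4 <= th.

Local Notation fpos := (fpos Rel).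
Local Notation robust := (fpos th).
Local Notation incident := (incident Rel).

Lemma incidentC u v : incident u v -> incident v u.
Proof. by case=> p [Rp up vp]; exists p. Qed.

Lemma incident_lmul q e u v : Rel (lmul e q) -> u \in msupp q -> v \in msupp q ->
  incident (e * u)%g (e * v)%g.
Proof. by move=> Rq uq vq; exists (lmul e q); split; [|rewrite supp_lmulM|rewrite supp_lmulM]. Qed.

Lemma incident_rmul q e u v : Rel (rmul q e) -> u \in msupp q -> v \in msupp q ->
  incident (u * e)%g (v * e)%g.
Proof. by move=> Rq uq vq; exists (rmul q e); split; [|rewrite supp_rmulM|rewrite supp_rmulM]. Qed.

Lemma fpos_incident t A m B : fpos t A m B -> incident m m.
Proof. by move=> [_ /pos_max[/MwE[p Rp mp] _ _]]; exists p. Qed.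

Lemma robust4 A m B : robust A m B -> fpos 4 A m B.
Proof. exact: fpos_le. Qed.

Definition link A B m m' := [/\ robust A m B, robust A m' B & incident m m'].

Inductive chain A B : F -> F -> Prop :=
| chain0 m : chain A B m m
| chainS m m' m'' : link A B m m' -> chain A B m' m'' -> chain A B m m''.

Lemma chain_trans A B m m' m'' : chain A B m m' -> chain A B m' m'' -> chain A B m m''.
Proof. by elim=> {m m'} // m n n' l _ IH /IH; apply: chainS l. Qed.

Lemma link_sym A B m m' : link A B m m' -> link A B m' m.
Proof. by case=> r r' /incidentC. Qed.

Lemma chain1 A B m m' : link A B m m' -> chain A B m m'.
Proof. by move=> l; apply: chainS l (chain0 _ _ _). Qed.

Lemma chain_sym A B m m' : chain A B m m' -> chain A B m' m.
Proof.
elim=> {m m'} [m|m n n' l _ IH]; first exact: chain0.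
by apply: chain_trans IH _; apply: chain1; apply: link_sym.
Qed.

Lemma chain_robust A B m m' : robust A m B -> chain A B m m' -> robust A m' B.
Proof. by move=> + c; elim: c => // {}m n n' [_ rn _] _ IH _; apply: IH. Qed.

Definition config t s A1 b B1 A2 m B2 := [/\ fpos t A1 b B1, fpos s A2 m B2,
  (A1 * b * B1 = A2 * m * B2)%g & (size A1 < size A2)%N].

(** The four edges preserve every threshold [t], not only 4: this is what keeps robust positions
    robust when [x] or [y] is not. *)
Definition square_of A1 b B1 A2 m B2 x y f B1' e A2' :=
  [/\ [/\ (A2 * y * B2 = A1 * (b * f) * B1')%g, (A1 * x * B1 = A2' * (e * m) * B2)%g &
          (A1 * (x * f) * B1' = A2' * (e * y) * B2)%g],
      (size A1 < size A2')%N /\ (size B2 < size B1')%N,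
      forall t, (fpos t A1 b B1 <-> fpos t A1 (b * f)%g B1') /\
                (fpos t A1 x B1 <-> fpos t A1 (x * f)%g B1'),
      forall t, (fpos t A2 m B2 <-> fpos t A2' (e * m)%g B2) /\
                (fpos t A2 y B2 <-> fpos t A2' (e * y)%g B2) &
      (forall p, Rel p -> b \in msupp p \/ x \in msupp p -> Rel (rmul p f)) /\
      (forall q, Rel q -> m \in msupp q \/ y \in msupp q -> Rel (lmul e q))].

Lemma square_ex A1 b B1 A2 m B2 x y : config 4 4 A1 b B1 A2 m B2 ->
  fpos 4 A1 x B1 -> fpos 4 A2 y B2 -> incident b x -> incident m y ->
  exists f B1' e A2', square_of A1 b B1 A2 m B2 x y f B1' e A2'.
Proof.
move=> [pb pm E lt] px py ibx imy.
have [f [B1' [e [A2' [[E1 E2 E3] [p1 p2 p3 p4] [l1 l2] Rf Re]]]]] :=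
  square compat pb pm E lt px py ibx imy.
have ltB : (size B2 < size B1)%N by rewrite -(fpos_order compat pb pm E).
exists f, B1', e, A2'; split; [by split|by split| | |by split].
- move=> t; split.
    exact: (edge_right compat pb pm py p1 E (esym E1) lt).
  exact: (edge_right compat px p3 p4 p2 E2 E3 l1).
- move=> t; split.
    exact: (edge_left compat pm pb px p3 (esym E) (esym E2) ltB).
  exact: (edge_left compat py p1 p2 p4 E1 (esym E3) l2).
Qed.

Lemma fpos_word_eq A b B b' B' : fpos 4 A b B -> fpos 4 A b' B' ->
  (A * b * B = A * b' * B')%g -> b = b' /\ B = B'.
Proof. by move=> p p' E; have [_ -> ->] := fpos_eq compat p p' E erefl. Qed.

Lemma fpos_word_eqr A b B A' b' : fpos 4 A b B -> fpos 4 A' b' B ->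
  (A * b * B = A' * b' * B)%g -> A = A' /\ b = b'.
Proof. by move=> p p' E; have [-> -> _] := fpos_eqr compat p p' E erefl. Qed.

(* A right move: a robust position on the right of [m] is replaced by an
   incident monomial, which may change the end of [m]. *)
Definition rstep A m B m' B' := [/\ robust A m B, robust A m' B' &
  exists A2 g g' B2, [/\ (size A < size A2)%N, link A2 B2 g g',
    (A * m * B = A2 * g * B2)%g & (A * m' * B' = A2 * g' * B2)%g]].

Inductive rmoves A : F -> F -> F -> F -> Prop :=
| rmoves0 m B : rmoves A m B m B
| rmovesS m B m' B' m'' B'' : rstep A m B m' B' -> rmoves A m' B' m'' B'' ->
    rmoves A m B m'' B''.

Lemma rmoves_trans A m B m' B' m'' B'' :
  rmoves A m B m' B' -> rmoves A m' B' m'' B'' -> rmoves A m B m'' B''.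
Proof. by elim=> {m B m' B'} // m B n D n' D' l _ IH /IH; apply: rmovesS l. Qed.

Lemma rstep_sym A m B m' B' : rstep A m B m' B' -> rstep A m' B' m B.
Proof.
case=> r r' [A2 [g [g' [B2 [lt /link_sym l E E']]]]]; split=> //.
by exists A2, g', g, B2; split.
Qed.

Lemma rmoves1 A m B m' B' : rstep A m B m' B' -> rmoves A m B m' B'.
Proof. by move=> l; apply: rmovesS l (rmoves0 _ _ _). Qed.

Lemma rmoves_sym A m B m' B' : rmoves A m B m' B' -> rmoves A m' B' m B.
Proof.
elim=> {m B m' B'} [m B|m B n D n' D' l _ IH]; first exact: rmoves0.
by apply: rmoves_trans IH _; apply: rmoves1; apply: rstep_sym.
Qed.

Definition right_turn A1 b B1 b' B1' A2 m y B2 := exists e A2',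
  [/\ (A1 * b * B1 = A2' * (e * m) * B2)%g, (A1 * b' * B1' = A2' * (e * y) * B2)%g,
      (size A1 < size A2')%N, incident (e * m)%g (e * y)%g &
      forall t, (fpos t A2 m B2 <-> fpos t A2' (e * m)%g B2) /\
                (fpos t A2 y B2 <-> fpos t A2' (e * y)%g B2)].

(** Successive squares along the chain share an edge, and positions in a word are unique, so the
    multiplier [f] of the first square is that of all the others. *)
Lemma transfer_right_aux A1 B1 b b' f B1' B2 : chain A1 B1 b b' ->
  forall A2 m y, config th 4 A1 b B1 A2 m B2 -> fpos 4 A2 y B2 -> incident m y ->
  (A2 * y * B2 = A1 * (b * f) * B1')%g -> fpos 4 A1 (b * f)%g B1' ->
  [/\ chain A1 B1' (b * f)%g (b' * f)%g,
      forall p, Rel p -> b' \in msupp p -> Rel (rmul p f) &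
      right_turn A1 b' B1 (b' * f)%g B1' A2 m y B2].
Proof.
elim=> {b b'} [b|b b1 b' [rb rb1 ib] _ IH] A2 m y cf py imy E pbf.
  have [pb pm Em lt] := cf; have pb4 := robust4 pb.
  have [|f0 [B0 [e0 [A0 [[E1 _ _] _ Ht _ [Rf _]]]]]] := square_ex (x := b) (y := y) _ pb4 py (fpos_incident pb) imy.
    by split.
  have p0 : fpos 4 A1 (b * f0)%g B0 by have [h _] := Ht 4; apply/h.
  have [/mulgI Ef EB] := fpos_word_eq pbf p0 (etrans (esym E) E1).
  split; first exact: chain0.
  - by move=> p Rp bp; rewrite Ef; apply: Rf => //; left.
  - by exists 1%g, A2; rewrite !mul1g; split; [exact: Em|exact: esym E|exact: lt|exact: imy|split].
have [pb pm Em lt] := cf.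
have [|f0 [B0 [e [A2' [[E1 E2 E3] [l1 l2] Hb Hm [Rf Re]]]]]] :=
    square_ex (x := b1) (y := y) _ (robust4 rb1) py ib imy.
  by split=> //; apply: robust4.
have p0 : fpos 4 A1 (b * f0)%g B0 by have [h _] := Hb 4; apply/h/robust4.
have [/mulgI Ef EB] := fpos_word_eq pbf p0 (etrans (esym E) E1); subst f0 B0.
have [h1 h2] := Hb 4; have [h3 h4] := Hm 4.
have pem : fpos 4 A2' (e * m)%g B2 by apply/h3.
have pey : fpos 4 A2' (e * y)%g B2 by apply/h4.
have iem : incident (e * m)%g (e * y)%g.
  by have [q [Rq mq yq]] := imy; apply: (incident_lmul (q := q)) => //; apply: Re => //; left.
have pb1f : fpos 4 A1 (b1 * f)%g B1' by apply/h2/robust4.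
have [c1 R1 [e' [A' [E4 E5 ll ii un]]]] := IH A2' (e * m)%g (e * y)%g (And4 rb1 pem E2 l1) pey iem (esym E3) pb1f.
split.
- apply: (chainS (m' := (b1 * f)%g)) c1; split.
  + by have [h _] := Hb th; apply/h.
  + by have [_ h] := Hb th; apply/h.
  + by have [p [Rp bp b1p]] := ib; apply: (incident_rmul (q := p)) => //; apply: Rf => //; left.
- exact: R1.
- exists (e' * e)%g, A'; rewrite -(mulgA e' e m) -(mulgA e' e y).
  split; [exact: E4|exact: E5|exact: ll|exact: ii|move=> t].
  have [h5 h6] := Hm t; have [h7 h8] := un t.
  by split; [rewrite h5|rewrite h6].
Qed.

Definition left_turn A1 b x B1 A2 m B2 A2' m' := exists f B1',
  [/\ (A2 * m * B2 = A1 * (b * f) * B1')%g, (A2' * m' * B2 = A1 * (x * f) * B1')%g,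
      (size A1 < size A2)%N, incident (b * f)%g (x * f)%g &
      forall t, (fpos t A1 b B1 <-> fpos t A1 (b * f)%g B1') /\
                (fpos t A1 x B1 <-> fpos t A1 (x * f)%g B1')].

Lemma transfer_left_aux A2 B2 m m' e A2' A1 : chain A2 B2 m m' ->
  forall b x B1, config 4 th A1 b B1 A2 m B2 -> fpos 4 A1 x B1 -> incident b x ->
  (A1 * x * B1 = A2' * (e * m) * B2)%g -> fpos 4 A2' (e * m)%g B2 ->
  [/\ chain A2' B2 (e * m)%g (e * m')%g,
      forall q, Rel q -> m' \in msupp q -> Rel (lmul e q) &
      left_turn A1 b x B1 A2 m' B2 A2' (e * m')%g].
Proof.
elim=> {m m'} [m|m m1 m' [rm rm1 im] _ IH] b x B1 cf px ibx E pem.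
  have [pb pm Em lt] := cf; have pm4 := robust4 pm.
  have [|f0 [B0 [e0 [A0 [[_ E1 _] _ _ Ht [_ Re]]]]]] := square_ex (x := x) (y := m) _ px pm4 ibx (fpos_incident pm).
    by split.
  have p0 : fpos 4 A0 (e0 * m)%g B2 by have [h _] := Ht 4; apply/h.
  have [EA /mulIg Ee] := fpos_word_eqr pem p0 (etrans (esym E) E1).
  split; first exact: chain0.
  - by move=> q Rq mq; rewrite Ee; apply: Re => //; left.
  - by exists 1%g, B1; rewrite !mulg1; split; [exact: esym Em|exact: esym E|exact: lt|exact: ibx|split].
have [pb pm Em lt] := cf.
have [|f [B1' [e0 [A0 [[E1 E2 E3] [l1 l2] Hb Hm [Rf Re]]]]]] :=
    square_ex (x := x) (y := m1) _ px (robust4 rm1) ibx im.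
  by split=> //; apply: robust4.
have p0 : fpos 4 A0 (e0 * m)%g B2 by have [h _] := Hm 4; apply/h/robust4.
have [EA /mulIg Ee] := fpos_word_eqr pem p0 (etrans (esym E) E2); subst e0 A0.
have [h1 h2] := Hb 4; have [h3 h4] := Hm 4.
have pbf : fpos 4 A1 (b * f)%g B1' by apply/h1.
have pxf : fpos 4 A1 (x * f)%g B1' by apply/h2.
have ibf : incident (b * f)%g (x * f)%g.
  by have [p [Rp bp xp]] := ibx; apply: (incident_rmul (q := p)) => //; apply: Rf => //; left.
have pem1 : fpos 4 A2' (e * m1)%g B2 by apply/h4/robust4.
have [c1 R1 [f' [B' [E4 E5 ll ii un]]]] := IH (b * f)%g (x * f)%g B1' (And4 pbf rm1 (esym E1) lt) pxf ibf E3 pem1.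
split.
- apply: (chainS (m' := (e * m1)%g)) c1; split.
  + by have [h _] := Hm th; apply/h.
  + by have [_ h] := Hm th; apply/h.
  + by have [q [Rq mq m1q]] := im; apply: (incident_lmul (q := q)) => //; apply: Re => //; left.
- exact: R1.
- exists (f * f')%g, B'; rewrite (mulgA b f f') (mulgA x f f').
  split; [exact: E4|exact: E5|exact: ll|exact: ii|move=> t].
  have [h5 h6] := Hb t; have [h7 h8] := un t.
  by split; [rewrite h5|rewrite h6].
Qed.

(** The order of quantifiers is the point: one [f] serves all [b'] in the chain of [b], so it can
    multiply a whole family of relators. *)
Lemma transfer_right A1 b B1 A2 m B2 y : config th 4 A1 b B1 A2 m B2 ->
  fpos 4 A2 y B2 -> incident m y ->
  exists f B1', [/\ (A2 * y * B2 = A1 * (b * f) * B1')%g, robust A1 (b * f)%g B1' &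
    forall b', chain A1 B1 b b' -> [/\ chain A1 B1' (b * f)%g (b' * f)%g,
      forall p, Rel p -> b' \in msupp p -> Rel (rmul p f) &
      right_turn A1 b' B1 (b' * f)%g B1' A2 m y B2]].
Proof.
move=> cf py imy; have [pb pm Em lt] := cf; have pb4 := robust4 pb.
have [|f [B1' [e [A2' [[E1 _ _] _ Hb _ _]]]]] := square_ex (x := b) (y := y) _ pb4 py (fpos_incident pb) imy.
  by split.
have rbf : robust A1 (b * f)%g B1' by have [h _] := Hb th; apply/h.
exists f, B1'; split=> // b' c.
exact: (transfer_right_aux c cf py imy E1 (robust4 rbf)).
Qed.

Lemma transfer_left A1 b B1 A2 m B2 x : config 4 th A1 b B1 A2 m B2 ->
  fpos 4 A1 x B1 -> incident b x ->
  exists e A2', [/\ (A1 * x * B1 = A2' * (e * m) * B2)%g, robust A2' (e * m)%g B2,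
    (size A1 < size A2')%N &
    forall m', chain A2 B2 m m' -> [/\ chain A2' B2 (e * m)%g (e * m')%g,
      forall q, Rel q -> m' \in msupp q -> Rel (lmul e q) &
      left_turn A1 b x B1 A2 m' B2 A2' (e * m')%g]].
Proof.
move=> cf px ibx; have [pb pm Em lt] := cf; have pm4 := robust4 pm.
have [|f [B1' [e [A2' [[_ E1 _] [l _] _ Hm _]]]]] := square_ex (x := x) (y := m) _ px pm4 ibx (fpos_incident pm).
  by split.
have rem : robust A2' (e * m)%g B2 by have [h _] := Hm th; apply/h.
exists e, A2'; split=> // m' c.
exact: (transfer_left_aux c cf px ibx E1 (robust4 rem)).
Qed.

(** The multipliers of the links from [m] to [m'] are composed. Each of them is a right move for the
    left position, so classes there are unchanged. *)
Lemma transfer_right_chain A2 B2 m m' : chain A2 B2 m m' ->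
  forall A1 b B1, config th th A1 b B1 A2 m B2 ->
  exists f B1', [/\ (A2 * m' * B2 = A1 * (b * f) * B1')%g, robust A1 (b * f)%g B1' &
    forall b', chain A1 B1 b b' -> [/\ chain A1 B1' (b * f)%g (b' * f)%g,
      forall p, Rel p -> b' \in msupp p -> Rel (rmul p f) &
      rmoves A1 b' B1 (b' * f)%g B1']].
Proof.
elim=> {m m'} [m|m m1 m' [rm rm1 im] _ IH] A1 b B1 [rb _ E lt].
  exists 1%g, B1; rewrite mulg1; split=> // b' c; rewrite mulg1; split=> //.
    by move=> p Rp _; rewrite rmul1.
  exact: rmoves0.
have [f [B1' [E1 rbf H]]] := transfer_right (y := m1) (And4 rb (robust4 rm) E lt) (robust4 rm1) im.
have [f' [B' [E2 rbf' H']]] := IH A1 (b * f)%g B1' (And4 rbf rm1 (esym E1) lt).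
exists (f * f')%g, B'; rewrite (mulgA b f f'); split=> // b' c.
have [c1 R1 [e [A2' [T1 T2 T3 T4 T5]]]] := H b' c; have [c2 R2 T'] := H' _ c1.
rewrite (mulgA b' f f'); split; first exact: c2.
- move=> p Rp bp; rewrite rmulM; apply: R2; first exact: R1.
  by rewrite supp_rmulM.
- apply: rmovesS T'; have [h1 h2] := T5 th; split.
  + exact: chain_robust c.
  + exact: chain_robust c1.
  + exists A2', (e * m)%g, (e * m1)%g, B2; split=> //; split=> //; [exact/h1|exact/h2].
Qed.

Lemma transfer_left_chain A1 B1 b b' : chain A1 B1 b b' ->
  forall A2 m B2, config th th A1 b B1 A2 m B2 ->
  exists e A2', [/\ (A1 * b' * B1 = A2' * (e * m) * B2)%g, robust A2' (e * m)%g B2,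
    (size A1 < size A2')%N &
    forall m', chain A2 B2 m m' -> chain A2' B2 (e * m)%g (e * m')%g /\
      forall q, Rel q -> m' \in msupp q -> Rel (lmul e q)].
Proof.
elim=> {b b'} [b|b b1 b' [rb rb1 ib] _ IH] A2 m B2 [_ rm E lt].
  exists 1%g, A2; rewrite mul1g; split=> // m' c; rewrite mul1g; split=> //.
  by move=> q Rq _; rewrite lmul1.
have [e [A2' [E1 rem l H]]] := transfer_left (x := b1) (And4 (robust4 rb) rm E lt) (robust4 rb1) ib.
have [e' [A' [E2 rem' l' H']]] := IH A2' (e * m)%g B2 (And4 rb1 rem E1 l).
exists (e' * e)%g, A'; rewrite -(mulgA e' e m); split=> // m' c.
have [c1 R1 _] := H m' c; have [c2 R2] := H' _ c1.
rewrite -(mulgA e' e m'); split; first exact: c2.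
by move=> q Rq mq; rewrite lmulM; apply: R2; [exact: R1|rewrite supp_lmulM].
Qed.

End Transfers.

(** * The order on words *)

Section Levels.
Variables (k : fieldType) (X : choiceType).
Local Notation F := (freegroup X).
Local Notation kF := (galg k F).
Variable Rel : set kF.
Implicit Types (A B U V W m g b x y z u v w e f : F) (p q : kF) (n : nat).
Hypothesis compat : compatibility_axiom Rel.
Variable th : nat.

Local Notation Mw := (Mw Rel).
Local Notation Pw := (Pw Rel).
Local Notation Lam := (Lam Pw).
Local Notation C3 := (cost Mw Pw 3).
Local Notation C7 := (cost Mw Pw 7).
Local Notation fpos := (fpos Rel).
Local Notation robust := (fpos th).
Local Notation link := (link Rel th).
Local Notation chain := (chain Rel th).
Local Notation rmoves := (rmoves Rel th).

Let Msub := Mw_sub compat.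
Let Psub := Pw_sub compat.
Let Pnil := Pw_nil Rel.
Let Glue := Mw_glue compat.

Definition nr U := nrob Mw Pw th (word U).

(* The positions reached from [A m B] by right moves, which leave [A] unchanged. *)
Definition cls A m B : set (F * F * F) :=
  fun t => t.1.1 = A /\ rmoves A m B t.1.2 t.2.

(* Robust positions of a word are told apart by the cost of what precedes
   them; for the other [n] the key is empty. *)
Definition key U n : set (F * F * F) := fun t =>
  exists A m B, [/\ U = (A * m * B)%g, robust A m B, C3 A = n & cls A m B t].

(** Equality of [C3] is included because keys are indexed by prefix costs: words of one level have
    the same finite range of keys. *)
Definition lev_eq W U := C7 W = C7 U /\ C3 W = C3 U /\ nr W = nr U.
Definition lev_lt W U := C7 W < C7 U \/ C7 W = C7 U /\ C3 W = C3 U /\ nr W < nr U.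
Definition lev_le W U := lev_lt W U \/ lev_eq W U.

Lemma lev_eq_trans U V W : lev_eq U V -> lev_eq V W -> lev_eq U W.
Proof. by move=> [e1 [e2 e3]] [e4 [e5 e6]]; rewrite /lev_eq e1 e2 e3 e4 e5 e6. Qed.

Lemma lev_lt_le U V W : lev_lt U V -> lev_le V W -> lev_lt U W.
Proof.
rewrite /lev_le /lev_lt /lev_eq.
by move: (C7 U) (C7 V) (C7 W) (C3 U) (C3 V) (C3 W) (nr U) (nr V) (nr W) => *; lia.
Qed.

Lemma lev_le_lt U V W : lev_le U V -> lev_lt V W -> lev_lt U W.
Proof.
rewrite /lev_le /lev_lt /lev_eq.
by move: (C7 U) (C7 V) (C7 W) (C3 U) (C3 V) (C3 W) (nr U) (nr V) (nr W) => *; lia.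
Qed.

Lemma lev_le_trans U V W : lev_le U V -> lev_le V W -> lev_le U W.
Proof.
rewrite /lev_le /lev_lt /lev_eq.
by move: (C7 U) (C7 V) (C7 W) (C3 U) (C3 V) (C3 W) (nr U) (nr V) (nr W) => *; lia.
Qed.

Lemma lev_le_eq U V W : lev_le U V -> lev_eq V W -> lev_le U W.
Proof. by move=> h e; apply: lev_le_trans h _; right. Qed.

Lemma lev_lt_eq U V W : lev_lt U V -> lev_eq V W -> lev_lt U W.
Proof. by move=> h e; apply: lev_lt_le h _; right. Qed.

Hypothesis th_ge9 : 9 <= th.

Let th_ge4 : 4 <= th. Proof. exact: leq_trans th_ge9. Qed.

Lemma C7_mul3 u v w n1 n2 n3 : C7 u <= n1 -> C7 v <= n2 -> C7 w <= n3 ->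
  C7 (u * v * w)%g <= n1 + n2 + n3.
Proof.
move=> h1 h2 h3; apply: leq_trans (cost_mul _ _ _ Msub Psub) _; apply: leq_add h3.
by apply: leq_trans (cost_mul _ _ _ Msub Psub) _; apply: leq_add.
Qed.

Lemma C7_pos A m B : fpos 8 A m B -> C7 (A * m * B)%g = C7 A + 7 + C7 B.
Proof.
move=> pm; rewrite (fposE pm).
by apply: (cost_maxocc Msub Psub Pnil Glue); [exact: pos_max pm.2|exact: pos_Lam pm.2].
Qed.

Lemma C3_pos A m B : fpos 4 A m B -> C3 (A * m * B)%g = C3 A + 3 + C3 B.
Proof. by move=> pm; rewrite (fposE pm); apply: cost_pos pm.2. Qed.

Lemma C7_M u : Mw u -> C7 u <= 7. Proof. exact: cost_M. Qed.

Lemma robust_le t A m B : t <= 9 -> robust A m B -> fpos t A m B.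
Proof. by move=> le; apply: fpos_le; apply: leq_trans le th_ge9. Qed.

(** At most 6 for the pieces of [x], against exactly 7 for the robust [m]. *)
Lemma turn_low A m B x : robust A m B -> Lam 6 x -> C7 (A * x * B)%g < C7 (A * m * B)%g.
Proof.
move=> /(robust_le (isT : 8 <= 9)) pm Lx; rewrite (C7_pos pm).
apply: leq_ltn_trans (C7_mul3 (leqnn _) (cost_Lam _ _ Lx) (leqnn _)) _.
by rewrite ltn_add2r ltn_add2l.
Qed.

(** Measure above 6 leaves measure above 4 after one piece is trimmed at each end. *)
Lemma turn_alive A m B x p : robust A m B -> Rel p -> m \in msupp p -> x \in msupp p ->
  ~ Lam 6 x -> fpos 4 A x B.
Proof.
move=> /(robust_le (isT : 4 <= 9)) pm Rp mp xp nx.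
have nP : ~ Pw x by apply: (nLam_nPw nx).
have [r mx] := turned compat pm Rp mp xp nP; split=> //.
exact: (pos_of_Lam Msub Psub Pnil Glue mx nx).
Qed.

(** [C3] is additive at both positions and stays the same, [C7] cannot grow, and [nr] drops exactly
    when robustness is lost. *)
Lemma turn_level A m B x : robust A m B -> fpos 4 A x B ->
  [/\ lev_le (A * x * B)%g (A * m * B)%g, ~ robust A x B -> lev_lt (A * x * B)%g (A * m * B)%g &
      robust A x B -> lev_eq (A * x * B)%g (A * m * B)%g].
Proof.
move=> rm px; have pm := robust_le (isT : 4 <= 9) rm.
have p8 := robust_le (isT : 8 <= 9) rm.
have c3 : C3 (A * x * B)%g = C3 (A * m * B)%g by rewrite !C3_pos.
have c7 : C7 (A * x * B)%g <= C7 (A * m * B)%g.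
  by rewrite (C7_pos p8); apply: C7_mul3 => //; apply: C7_M; case: (pos_max px.2).
have := nrob_turn Msub Psub Pnil Glue th_ge4 rm.2 px.2.
rewrite -(fposE px) -(fposE pm) -/(nr _) -/(nr _) => en.
have rx : robust A x B <-> position Mw Pw th A x B 
  by split=> [[_ h]|h]; [exact: h|split; [by case: px|exact: h]].
have eq7 : robust A x B -> C7 (A * x * B)%g = C7 (A * m * B)%g.
  by move=> /(robust_le (isT : 8 <= 9)) px8; rewrite !C7_pos.
rewrite /lev_le /lev_lt /lev_eq; case: asboolP en => r en.
  have e7 := eq7 (rx.2 r); split.
  - by right; split=> //; split=> //; move: en; rewrite addn0.
  - by move=> n; case: n; apply/rx.
  - by move=> _; split=> //; split=> //; move: en; rewrite addn0.
have n' : nr (A * x * B)%g < nr (A * m * B)%g by rewrite -en addn1.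
have lt : C7 (A * x * B)%g < C7 (A * m * B)%g \/ C7 (A * x * B)%g = C7 (A * m * B)%g /\
  C3 (A * x * B)%g = C3 (A * m * B)%g /\ nr (A * x * B)%g < nr (A * m * B)%g.
  by move: c7; rewrite leq_eqVlt => /orP[/eqP c7|c7]; [right|left].
split; [by left|by move=> _|by move=> /rx].
Qed.

Lemma C3_lt A m B A2 g B2 : fpos 4 A m B -> fpos 4 A2 g B2 ->
  (A * m * B = A2 * g * B2)%g -> (size A < size A2) = (C3 A < C3 A2).
Proof.
move=> pm pg E; have E' := fpos_eqw pm pg E.
have H := cost_pos_lt Msub Psub Pnil Glue pm.2 pg.2 E'.
have H' := cost_pos_lt Msub Psub Pnil Glue pg.2 pm.2 (esym E').
apply/idP/idP => // lt; rewrite ltnNge leq_eqVlt; apply/negP => /orP[/eqP eq|/H' lt'].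
  by have [EA _ _] := fpos_eq compat pm pg E (esym eq); move: lt; rewrite EA ltnn.
by move: lt; rewrite ltnNge (ltnW lt').
Qed.

Lemma fpos_C3_inj A m B A2 g B2 : fpos 4 A m B -> fpos 4 A2 g B2 ->
  (A * m * B = A2 * g * B2)%g -> C3 A = C3 A2 -> [/\ A = A2, m = g & B = B2].
Proof.
move=> pm pg E EC; apply: (fpos_eq compat pm pg E).
have := C3_lt pm pg E; have := C3_lt pg pm (esym E); rewrite EC ltnn.
by case: ltngtP.
Qed.

Lemma cls_rmoves A m B m' B' : rmoves A m B m' B' -> cls A m B = cls A m' B'.
Proof.
move=> r; apply/funext => t; apply/propext; split=> -[h1 h2]; split=> //.
  by apply: rmoves_trans h2; apply: rmoves_sym.
exact: rmoves_trans r h2.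
Qed.

Lemma cls_eq A m B m' B' : cls A m B = cls A m' B' -> rmoves A m B m' B'.
Proof.
move=> e; have : cls A m' B' (A, m', B') by split=> //; apply: rmoves0.
by rewrite -e => -[].
Qed.

(** For a position further left this replacement is a right move, and classes are closed under right
    moves. *)
Lemma turn_key A B m x n : link A B m x -> n < C3 A ->
  key (A * x * B)%g n = key (A * m * B)%g n.
Proof.
suff half y z : link A B y z -> n < C3 A -> forall t, key (A * y * B)%g n t -> key (A * z * B)%g n t.
  move=> l lt; apply/funext => t; apply/propext; split; apply: half => //.
  exact: link_sym.
move=> l lt t [A2 [g [B2 [E rg EC c]]]]; have [ry rz i] := l.
have [py pz pg] := And3 (robust_le (isT : 4 <= 9) ry) (robust_le (isT : 4 <= 9) rz) (robust_le (isT : 4 <= 9) rg).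
have lt' : size A2 < size A by rewrite (C3_lt pg py (esym E)) EC.
have [g' [B' [E' _ ht _]]] := fturn_right compat pg py pz (esym E) lt'.
exists A2, g', B'; split=> //; first exact: ht.
rewrite -(cls_rmoves (m := g) (B := B2)) //.
apply: rmoves1; split; [by []|exact: ht|].
by exists A, y, z, B; split=> //; exact: esym.
Qed.

Lemma key_at A m B : robust A m B -> key (A * m * B)%g (C3 A) = cls A m B.
Proof.
move=> rm; apply/funext => t; apply/propext; split; last by move=> c; exists A, m, B.
move=> [A2 [g [B2 [E rg EC c]]]].
have [pm pg] := conj (robust_le (isT : 4 <= 9) rm) (robust_le (isT : 4 <= 9) rg).
by have [-> -> ->] := fpos_C3_inj pm pg E (esym EC).
Qed.

Lemma chain_level A B m x : robust A m B -> chain A B m x ->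
  lev_eq (A * x * B)%g (A * m * B)%g /\
  forall n, n < C3 A -> key (A * x * B)%g n = key (A * m * B)%g n.
Proof.
move=> rm c; elim: c rm => {m x} [m|m m' x l _ IH] rm; first by split.
have [_ rm' _] := l; have [h1 h2] := IH rm'.
have [_ _ /(_ rm') e] := turn_level rm (robust_le (isT : 4 <= 9) rm').
split; first exact: lev_eq_trans h1 e.
by move=> n lt; rewrite h2 // (turn_key l lt).
Qed.

End Levels.

(** * Replacements at two positions at once *)

Section Pairs.
Variables (k : fieldType) (X : choiceType).
Local Notation F := (freegroup X).
Local Notation kF := (galg k F).
Variable Rel : set kF.
Implicit Types (A B U V W m g b x y z u v w e f : F) (p q : kF) (n : nat).
Hypothesis compat : compatibility_axiom Rel.
Variable th : nat.
Hypothesis th_ge9 : 9 <= th.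

Local Notation Mw := (Mw Rel).
Local Notation Pw := (Pw Rel).
Local Notation Lam := (Lam Pw).
Local Notation C7 := (cost Mw Pw 7).
Local Notation fpos := (fpos Rel).
Local Notation robust := (fpos th).
Local Notation chain := (chain Rel th).
Local Notation config := (config Rel).
Local Notation lev_le := (lev_le Rel th).
Local Notation lev_lt := (lev_lt Rel th).
Local Notation lev_eq := (lev_eq Rel th).

Let Msub := Mw_sub compat.
Let Psub := Pw_sub compat.
Let Pnil := Pw_nil Rel.
Let Glue := Mw_glue compat.

Let th_ge4 : 4 <= th. Proof. exact: leq_trans th_ge9. Qed.

Lemma C7_mul4 u v w z n1 n2 n3 n4 : C7 u <= n1 -> C7 v <= n2 -> C7 w <= n3 -> C7 z <= n4 ->
  C7 (u * v * w * z)%g <= n1 + n2 + n3 + n4.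
Proof.
move=> h1 h2 h3 h4; apply: leq_trans (cost_mul _ _ _ Msub Psub) _; apply: leq_add h4.
exact: C7_mul3.
Qed.

(** [(A1 b)^-1 A2] is the gap, or the inverse of the overlap [c]. In the second case it is absorbed
    into the monomial other than the short one, which stays in [Mon] by compatibility. The two
    replacements then cost at most 13, while [b] and [m] cost 14. *)
Lemma pair_low A1 b B1 A2 m B2 p q x y : config th th A1 b B1 A2 m B2 ->
  Rel p -> b \in msupp p -> x \in msupp p -> Rel q -> m \in msupp q -> y \in msupp q ->
  Lam 6 x \/ Lam 6 y ->
  C7 (A1 * x * ((A1 * b)^-1 * A2) * y * B2)%g < C7 (A1 * b * B1)%g.
Proof.
move=> [rb rm E lt] Rp bp xp Rq mq yq low.
have [pb pm] := conj (robust_le th_ge9 (isT : 4 <= 9) rb) (robust_le th_ge9 (isT : 4 <= 9) rm).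
have pb8 := robust_le th_ge9 (isT : 8 <= 9) rb.
have nb8 := pos_Lam (robust_le th_ge9 (isT : 8 <= 9) rm).2.
have cx : C7 x <= 7 by apply: C7_M; exact: Mw_supp Rp xp.
have cy : C7 y <= 7 by apply: C7_M; exact: Mw_supp Rq yq.
have sum : C7 x + C7 y <= 13.
  by case: low => /(cost_Lam Mw 7) h; lia.
rewrite (C7_pos compat pb8).
have E' := fpos_eqw pb pm E.
case: (pos_cases Msub Pnil Glue pb.2 pm.2 E' lt) => [[z [z0 EA EB]]|].
  have mxm : maxocc Mw z m B2.
    have [Mm ml mr] := pos_max pm.2; split=> //.
    by move: ml; rewrite EA catA => /maxl_suffix; apply.
  have -> : ((A1 * b)^-1 * A2 = nf z)%g.
    have -> : (A2 = A1 * b * nf z)%g.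
      by rewrite -[LHS]wordK EA !nfM !wordK mulgA.
    by rewrite mulKg.
  have rz : reduced z by apply: (@reduced_sub _ (A1 ++ b) z [::]); rewrite cats0 -catA -EA; exact: word_reduced.
  rewrite EB (cost_maxocc Msub Psub Pnil Glue mxm nb8).
  apply: leq_ltn_trans (cost_mul _ _ _ Msub Psub) _.
  have := C7_mul4 (leqnn (C7 A1)) (leqnn (C7 x)) (leqnn (C7 (nf z))) (leqnn (C7 y)).
  by rewrite nfK //; lia.
move=> [u [c [g0 [[u0 EA Eb Em EB] [Pc _ _]]]]].
(* Of the measure above 8 of [m], the overlap [c] accounts for one piece. *)
have ng0 : ~ Lam 7 g0.
  by move=> h; apply: nb8; rewrite Em; apply: (@Lam_cat _ _ 1 7) h; apply/(Lam1 Pnil).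
have tg : trimR Mw Pw g0 B2.
  have [_ tr] := maxocc_trim Msub Glue (pos_max pm.2).
  by move=> m' y' b' B' E1; apply: (tr (c ++ m')); rewrite Em E1 catA.
have cg : 7 + C7 B2 <= C7 B1.
  by rewrite EB -[X in X + _](minnn 7); apply: (cost_catMr Msub Psub Pnil).
have -> : ((A1 * b)^-1 * A2 = (nf c)^-1)%g.
  have -> : (A2 = A1 * nf u)%g by rewrite -[LHS]wordK EA !nfM !wordK.
  have -> : (b = nf u * nf c)%g by rewrite -[LHS]wordK Eb !nfM.
  by rewrite !invgM !mulgA mulgVK mulgVK.
case: low => /(cost_Lam Mw 7) low.
  have cy' : C7 ((nf c)^-1 * y)%g <= 7.
    have R1 := Rel_stripl compat Rq mq Em.
    by apply: C7_M; apply: (Mw_supp R1); rewrite supp_lmulM.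
  have -> : (A1 * x * (nf c)^-1 * y * B2 = A1 * x * ((nf c)^-1 * y) * B2)%g by rewrite !mulgA.
  have := C7_mul4 (leqnn (C7 A1)) low cy' (leqnn (C7 B2)); lia.
have cx' : C7 (x * (nf c)^-1)%g <= 7.
  have R1 := Rel_stripr compat Rp bp Eb.
  by apply: C7_M; apply: (Mw_supp R1); rewrite supp_rmulM.
have -> : (A1 * x * (nf c)^-1 * y * B2 = A1 * (x * (nf c)^-1) * y * B2)%g by rewrite !mulgA.
have := C7_mul4 (leqnn (C7 A1)) cx' low (leqnn (C7 B2)); lia.
Qed.

(** If both replacements have measure above 6, the square performs them one after the other as
    single turns, and the inequalities of [turn_level] compose. *)
Lemma pair_level A1 b B1 A2 m B2 p q x y : config th th A1 b B1 A2 m B2 ->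
  Rel p -> b \in msupp p -> x \in msupp p -> Rel q -> m \in msupp q -> y \in msupp q ->
  let W := (A1 * x * ((A1 * b)^-1 * A2) * y * B2)%g in let U := (A1 * b * B1)%g in
  lev_le W U /\ (~ robust A1 x B1 \/ ~ robust A2 y B2 -> lev_lt W U).
Proof.
move=> cf Rp bp xp Rq mq yq W U.
have [low|nlow] := pselect (Lam 6 x \/ Lam 6 y).
  have lt : lev_lt W U by left; exact: pair_low cf Rp bp xp Rq mq yq low.
  by split; [left|].
have [nx ny] : ~ Lam 6 x /\ ~ Lam 6 y by split=> h; apply: nlow; [left|right].
have [rb rm E lt] := cf.
have px := turn_alive compat th_ge9 rb Rp bp xp nx.
have py := turn_alive compat th_ge9 rm Rq mq yq ny.
have [|f [B1' [e [A2' [[E1 E2 E3] [l1 l2] Hb Hm _]]]]] :=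
  square_ex compat (x := x) (y := y) _ px py (ex_intro _ p (And3 Rp bp xp)) (ex_intro _ q (And3 Rq mq yq)).
  by split; [exact: robust4 rb|exact: robust4 rm|exact: E|exact: lt].
have EW : W = (A2' * (e * y) * B2)%g.
  rewrite -E3 /W.
  have -> : ((A1 * b)^-1 * A2 = f * B1' * B2^-1 * y^-1)%g.
    apply: (mulgI (A1 * b)%g); rewrite mulVKg !mulgA.
    by rewrite -[(A1 * b * f)%g]mulgA -E1 !mulgK.
  by rewrite !mulgA !mulgVK.
have [Hm1 Hm2] := Hm th; have [H41 H42] := Hm 4.
have rem : robust A2' (e * m)%g B2 by apply/Hm1.
have pey : fpos 4 A2' (e * y)%g B2 by apply/H42.
have [le1 nlt1 _] := turn_level compat th_ge9 rb px.
have [le2 nlt2 _] := turn_level compat th_ge9 rem pey.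
rewrite -E2 -EW in le2 nlt2.
split; first exact: lev_le_trans le2 le1.
case=> n; first by apply: (lev_le_lt le2); apply: nlt1.
by apply: lev_lt_le le1; apply: nlt2 => h; apply: n; apply/Hm2.
Qed.

Lemma chain_link A B m m' p x : chain A B m m' -> robust A m B -> Rel p -> m' \in msupp p ->
  x \in msupp p -> robust A x B -> chain A B m x.
Proof.
move=> c rm Rp mp xp rx; apply: chain_trans (c) _; apply: chain1; split=> //.
  exact: chain_robust c.
by exists p.
Qed.

(** The relators contain monomials [b'] and [m'] linked to [b] and [m], not these themselves. Moving
    along the chains first keeps the level and reduces to [pair_level]. *)
Lemma pair_chain_level A1 b B1 A2 m B2 b' m' p q x y : config th th A1 b B1 A2 m B2 ->
  chain A1 B1 b b' -> Rel p -> b' \in msupp p -> x \in msupp p ->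
  chain A2 B2 m m' -> Rel q -> m' \in msupp q -> y \in msupp q ->
  let W := (A1 * x * ((A1 * b)^-1 * A2) * y * B2)%g in let U := (A1 * b * B1)%g in
  lev_le W U /\ (~ robust A1 x B1 \/ ~ robust A2 y B2 -> lev_lt W U).
Proof.
move=> cf cb Rp bp xp cm Rq mq yq W U; have [rb rm E lt] := cf.
have [f [B1' [E1 rbf H1]]] := transfer_right_chain compat th_ge4 cm cf.
have [cb' Rpf _] := H1 _ cb.
have rm' := chain_robust rm cm.
have cf1 : config th th A1 (b * f)%g B1' A2 m' B2 by split=> //; exact: esym.
have [e [A2' [E2 rem lt' H2]]] := transfer_left_chain compat th_ge4 cb' cf1.
have [_ Req] := H2 _ (chain0 _ _ _ _ _).
have rbf' := chain_robust rbf cb'.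
have cf2 : config th th A1 (b' * f)%g B1' A2' (e * m')%g B2 by split.
have R1 := Rpf _ Rp bp; have R2 := Req _ Rq mq.
have bp1 : (b' * f)%g \in msupp (rmul p f) by rewrite supp_rmulM.
have xp1 : (x * f)%g \in msupp (rmul p f) by rewrite supp_rmulM.
have mq1 : (e * m')%g \in msupp (lmul e q) by rewrite supp_lmulM.
have yq1 : (e * y)%g \in msupp (lmul e q) by rewrite supp_lmulM.
have [le nlt] := pair_level cf2 R1 bp1 xp1 R2 mq1 yq1.
have EW : W = (A1 * (x * f) * ((A1 * (b' * f))^-1 * A2') * (e * y) * B2)%g.
  rewrite /W; have -> : ((A1 * (b' * f))^-1 * A2' = B1' * B2^-1 * m'^-1 * e^-1)%g.
    apply: (mulgI (A1 * (b' * f))%g); rewrite mulVKg !mulgA.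
    by rewrite -[(A1 * b' * f)%g]mulgA E2 !mulgA !mulgK.
  have -> : ((A1 * b)^-1 * A2 = f * B1' * B2^-1 * m'^-1)%g.
    apply: (mulgI (A1 * b)%g); rewrite mulVKg !mulgA.
    by rewrite -[(A1 * b * f)%g]mulgA -E1 !mulgK.
  by rewrite !mulgA !mulgVK.
have e1 : lev_eq (A1 * (b' * f) * B1')%g U.
  have [l1 _] := chain_level compat th_ge9 rbf cb'.
  have [l2 _] := chain_level compat th_ge9 rm cm.
  by apply: lev_eq_trans l1 _; rewrite -E1 /U E.
rewrite -EW in le nlt; split; first exact: lev_le_eq le e1.
move=> n; apply: lev_lt_eq e1; apply: nlt; case: n => n; [left|right] => r; apply: n.
  have cx := chain_link cb' rbf R1 bp1 xp1 r.
  (* Transport along the reversed chain has the multiplier inverse to [f], so robustness of [x f]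
     comes back as robustness of [x] before [B1]. *)
  have [f' [B3 [E3 rbf3 H3]]] := transfer_right_chain compat th_ge4 (chain_sym cm) cf1.
  have [Ef EB] := fpos_word_eq compat (robust4 th_ge4 rbf3) (robust4 th_ge4 rb) (etrans (esym E3) (esym E)).
  have ff : (f * f' = 1)%g by apply: (mulgI b); rewrite mulg1 mulgA.
  have [c3 _ _] := H3 _ cx; have := chain_robust rbf3 c3.
  by rewrite -mulgA ff mulg1 EB.
have cy := chain_link (chain0 _ _ _ _ _) rem R2 mq1 yq1 r.
have [e' [A3 [E3 rem3 _ H3]]] := transfer_left_chain compat th_ge4 (chain_sym cb') cf2.
have [EA Ee] := fpos_word_eqr compat (robust4 th_ge4 rem3) (robust4 th_ge4 rm') (etrans (esym E3) (esym E1)).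
have ee : (e' * e = 1)%g by apply: (mulIg m'); rewrite mul1g -mulgA.
have [c3 _] := H3 _ cy; have := chain_robust rem3 c3.
by rewrite mulgA ee mul1g EA.
Qed.

End Pairs.

(** * Cores and the isolation axiom *)

Section Cores.
Variables (T : eqType) (M P : seq T -> Prop).
Implicit Types (A B U V a b c g m u v w z : seq T) (K t n : nat).
Hypothesis M_sub : sub_closed M.
Hypothesis P_sub : sub_closed P.
Hypothesis P_nil : P [::].
Hypothesis MP_glue : glueable M P.

Notation Lam := (Lam P).
Notation C := (cost M P 3).
Notation pos := (position M P).

(* [v] is what remains of [m] when the part shared with the right neighbour is
   removed; right moves do not affect it. *)
Definition core m B v := exists y, [/\ m = v ++ y, C (y ++ B) = C B &
  forall x y', m = x ++ y' -> C (y' ++ B) = C B -> size y' <= size y].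

Lemma core_ex m B : exists v, core m B v.
Proof.
pose Q n := (n <= size m) && `[< C (drop (size m - n) m ++ B) = C B >].
have Q0 : exists n, Q n.
  by exists 0; rewrite /Q subn0 drop_size /=; apply/asboolP.
have Qle n : Q n -> n <= size m by case/andP.
case: (ex_maxnP Q0 Qle) => n /andP[le /asboolP E] mx.
exists (take (size m - n) m), (drop (size m - n) m); split=> //.
  by rewrite cat_take_drop.
move=> x y' Em E'; rewrite size_drop subKn //; apply: mx.
have sy : size y' <= size m by rewrite Em size_cat leq_addl.
rewrite /Q sy; apply/asboolP.
by rewrite {1}Em size_cat addnK {1}Em drop_size_cat.
Qed.

Lemma core_uniq m B v v' : core m B v -> core m B v' -> v = v'.
Proof.
move=> [y [E1 C1 h1]] [y' [E2 C2 h2]].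
have s : size y = size y' by apply/eqP; rewrite eqn_leq (h1 v' y') // (h2 v y).
have sv : size v = size v'.
  by have := congr1 size E1; rewrite E2 !size_cat s => /addIn.
by move: E1; rewrite E2 => /eqP; rewrite eqseq_cat // => /andP[/eqP].
Qed.

(** A free suffix is a piece, so it cannot contain the non-piece [g], and [c] is never reached. *)
Lemma core_tail c g B v : trimR M P (c ++ g) B -> ~ P g ->
  core g B v -> core (c ++ g) B (c ++ v).
Proof.
move=> tr nP [y [E1 C1 h1]]; exists y; split=> //; first by rewrite E1 catA.
move=> x y' E' C'; case: (cat_split E') => [[s [_ Eg]]|[s [_ [Ec Ey]]]].
  exact: h1 Eg C'.
case: nP; have := free_suffix M_sub P_sub P_nil (m := x) (y := y') (B := B).
by rewrite -E' => /(_ tr C'); rewrite Ey -[s ++ g]cats0 -catA; apply: P_sub.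
Qed.

Lemma core_gap A' m z g g' B2 v :
  pos 4 (A' ++ z) g B2 -> pos 4 (A' ++ z) g' B2 -> z <> [::] ->
  core m (z ++ g ++ B2) v -> core m (z ++ g' ++ B2) v.
Proof.
move=> pg pg' z0; have cg q y : pos 4 (A' ++ z) q B2 ->
    (C (y ++ z ++ q ++ B2) = C (z ++ q ++ B2)) <-> C (y ++ z) = C z.
  move=> pq; rewrite (cost_gap M_sub P_sub P_nil MP_glue y pq z0).
  have := cost_gap M_sub P_sub P_nil MP_glue [::] pq z0; rewrite !cat0s => ->.
  by lia.
move=> [y [E1 /(cg _ _ pg) C1 h]]; exists y; split=> //; first exact/(cg _ _ pg').
by move=> x y' E' /(cg _ _ pg') C'; apply: (h x) => //; apply/(cg _ _ pg).
Qed.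

(** A suffix reaching into [w] would put a non-empty word in front of the complete neighbour, at
    positive cost. *)
Lemma core_adj A w c g B2 : pos 4 (A ++ w) (c ++ g) B2 -> ~ Lam 3 g ->
  core (w ++ c) (g ++ B2) w.
Proof.
move=> pg ng; have [_ tr] := maxocc_trim M_sub MP_glue (pos_max pg).
have [Mg _ _] := pos_max pg.
have Cg : C (g ++ B2) = 3 + C B2.
  by apply: (cost_right M_sub P_sub P_nil tr) => //; apply: (M_catr M_sub) Mg.
have Ccg : C ((c ++ g) ++ B2) = 3 + C B2.
  apply: (cost_right M_sub P_sub P_nil (m := [::])) => //; exact: (pos_Lam (pos_le (isT : 3 <= 4) pg)).
exists c; split=> //; first by rewrite catA Ccg Cg.
move=> x y' E C'; case: (cat_split E) => [[s [_ Ec]]|[s [_ [Ew Ey]]]].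
  by rewrite Ec size_cat leq_addl.
have [s0|/eqP s0] := eqVneq s [::]; first by rewrite Ey s0.
have pg' : pos 4 ((A ++ x) ++ s) (c ++ g) B2 by rewrite -catA -Ew.
have := cost_gap M_sub P_sub P_nil MP_glue [::] pg' s0.
have e : s ++ (c ++ g) ++ B2 = y' ++ g ++ B2 by rewrite Ey -!catA.
rewrite !cat0s e C' Cg.
by have := cost_gt0 M P (isT : 0 < 3) s0; lia.
Qed.

(** Otherwise the part of the middle monomial before the third one, of measure above 3, would lie in
    the piece that the first two share. *)
Lemma pos_sep A1 m1 B1 A2 m2 B2 A3 m3 B3 :
  pos 4 A1 m1 B1 -> pos 4 A2 m2 B2 -> pos 4 A3 m3 B3 ->
  A1 ++ m1 ++ B1 = A2 ++ m2 ++ B2 -> A2 ++ m2 ++ B2 = A3 ++ m3 ++ B3 ->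
  size A1 < size A2 -> size A2 < size A3 -> size A1 + size m1 < size A3.
Proof.
move=> p1 p2 p3 E12 E23 l12 l23.
have h1 := pos_cases M_sub P_nil MP_glue p1 p2 E12 l12.
have h2 := pos_cases M_sub P_nil MP_glue p2 p3 E23 l23.
case: h1 => [[z [_ EA _]]|[u [c [g [[_ EA E1 E2 _] [Pc _ _]]]]]].
  by move: l23; rewrite EA !size_cat; lia.
case: h2 => [[z [z0 EA3 _]]|[u2 [c2 [g2 [[_ EA3 E2' _ _] [_ nu2 _]]]]]].
  have := congr1 size E2; have := congr1 size E1; rewrite EA3 EA !size_cat.
  by case: z z0 {EA3} => //= ? ?; lia.
rewrite EA3 EA E1 !size_cat; suff : size c < size u2 by lia.
rewrite ltnNge; apply/negP => le; apply: nu2; apply: (@Lam_le _ _ 1) => //.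
apply/(Lam1 P_nil); have Ec : c = u2 ++ drop (size u2) c.
  rewrite -[LHS](cat_take_drop (size u2) c); congr (_ ++ _).
  have := congr1 (take (size u2)) (etrans (esym E2) E2').
  by rewrite takel_cat // take_size_cat.
by move: Pc; rewrite Ec -[u2 ++ _]cat0s; apply: P_sub.
Qed.

End Cores.

(** * Right isolation separates the classes along a chain *)

Section Isolation.
Variables (k : fieldType) (X : choiceType).
Local Notation F := (freegroup X).
Local Notation L := (letter X).
Local Notation kF := (galg k F).
Variable Rel : set kF.
Implicit Types (A B D U V W m g b x y z u v w e f : F) (p q : kF) (n t : nat).

Local Notation Mw := (Mw Rel).
Local Notation Pw := (Pw Rel).
Local Notation Lam := (Lam Pw).
Local Notation S := (small_piece_or_letter Rel).
Local Notation core := (core Mw Pw).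

Lemma concat_Lam w t : concat_of S w t -> Lam t w.
Proof.
move=> [s [<- hs ->]]; elim: s hs => [_|v s IH hs] /=; first exact: Lam0.
apply: LamS; last by apply: IH => u us; apply: hs; rewrite inE us orbT.
by exists v => //; apply: hs; rewrite inE eqxx.
Qed.

Lemma Lam_concat w t : Lam t w -> exists2 n, n <= t & concat_of S w n.
Proof.
suff H a : Lam t a -> exists s : seq F,
    [/\ size s <= t, forall v, v \in s -> S v & a = flatten [seq word v | v <- s]].
  by case/H => s [le hs e]; exists (size s) => //; exists s.
elim=> {t a} [t|t a b [v Sv <-] _ [s [le hs ->]]]; first by exists [::].
exists (v :: s); split=> // u; rewrite inE => /orP[/eqP->|] //; exact: hs.
Qed.

Lemma le_Lambda t w : le_inf t.+1 (Lambda S w) <-> ~ Lam t w.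
Proof.
rewrite /Lambda; case: pselect => [e|ne] /=; last first.
  split=> // _ /Lam_concat[n _ c]; apply: ne; exists n; exact/asboolP.
case: ex_minnP => n /asboolP c mn; split.
  by move=> lt /Lam_concat[n' le /asboolP /mn]; lia.
by move=> nL; rewrite ltnNge; apply/negP => le; apply: nL; apply: Lam_le le _; exact: concat_Lam.
Qed.

Hypothesis compat : compatibility_axiom Rel.
Variable tau : nat.
Hypothesis tau_ge11 : 11 <= tau.
Hypothesis isol : right_isolation_axiom Rel S tau.
Let th := tau - 2.

Local Notation fpos := (fpos Rel).
Local Notation robust := (fpos th).
Local Notation link := (link Rel th).
Local Notation chain := (chain Rel th).
Local Notation rstep := (rstep Rel th).
Local Notation rmoves := (rmoves Rel th).

Let Msub := Mw_sub compat.
Let Psub := Pw_sub compat.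
Let Pnil := Pw_nil Rel.
Let Glue := Mw_glue compat.

Let th_ge9 : 9 <= th. Proof. by rewrite /th; lia. Qed.
Let th_ge4 : 4 <= th. Proof. exact: leq_trans th_ge9. Qed.

Lemma robust_chain A B m m' : robust A m B -> chain A B m m' ->
  exists K (s : nat -> F), [/\ incident_chain Rel S (tau - 2) K s, s 1 = m & s K = m'].
Proof.
have base m0 : robust A m0 B -> Mon Rel m0 /\ le_inf (tau - 2) (Lambda S m0).
  move=> [_ pm]; split; first by apply/MwE; case: (pos_max pm).
  have -> : tau - 2 = (tau - 3).+1 by lia.
  by apply/le_Lambda; apply: pos_Lam (pos_le _ pm); rewrite /th; lia.
move=> + c; elim: c => {m m'} [m|m m1 m' [rm rm1 i] c IH] r.
  exists 1, (fun _ => m); split=> //; split=> // [i _|i]; first exact: base.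
  by case: i => // -[].
have [K [s [[K1 h1 h2] s1 sK]]] := IH rm1.
exists K.+1, (fun i => if i == 1 then m else s i.-1); split=> //; last by case: (K) K1 sK.
split=> // [[|[|j]]|[|[|j]]] //=.
- by move=> _; exact: base.
- by move=> lt; apply: h1; lia.
- by move=> _; rewrite s1.
- by move=> lt; apply: h2; lia.
Qed.

Lemma fpos_sep A1 m1 B1 A2 m2 B2 A3 m3 B3 :
  fpos 4 A1 m1 B1 -> fpos 4 A2 m2 B2 -> fpos 4 A3 m3 B3 ->
  (A1 * m1 * B1 = A2 * m2 * B2)%g -> (A2 * m2 * B2 = A3 * m3 * B3)%g ->
  size A1 < size A2 -> size A2 < size A3 -> size A1 + size m1 < size A3.
Proof.
move=> p1 p2 p3 E12 E23.
exact: (pos_sep Msub Psub Pnil Glue p1.2 p2.2 p3.2 (fpos_eqw p1 p2 E12) (fpos_eqw p2 p3 E23)).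
Qed.

Lemma rstep_cases A m B m' B' : rstep A m B m' B' ->
  exists A2 g g' B2, [/\ size A < size A2, link A2 B2 g g',
    (A * m * B = A2 * g * B2)%g, (A * m' * B' = A2 * g' * B2)%g &
    gap_right A m B A2 g B2 m' g' B' \/ adj_right Rel A m B A2 g B2 m' g' B'].
Proof.
move=> [rm rm' [A2 [g [g' [B2 [lt l E E']]]]]]; have [rg rg' _] := l.
have [m1 [B1 [E1 _ ht cs]]] := fturn_right compat (robust4 th_ge4 rm) (robust4 th_ge4 rg) (robust4 th_ge4 rg') E lt.
have [e1 e2] := fpos_word_eq compat (robust4 th_ge4 rm') (robust4 th_ge4 (ht th rm)) (etrans E' E1).
by exists A2, g, g', B2; rewrite e1 e2 -E1.
Qed.

Lemma rstep_core A m B m' B' (v : seq L) : rstep A m B m' B' -> core m B v -> core m' B' v.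
Proof.
move=> /rstep_cases [A2 [g [g' [B2 [lt [rg rg' _] E E' [[z [z0 EA EB -> ->]]|]]]]]].
  rewrite EB; apply: (core_gap Msub Psub Pnil Glue (A' := A ++ m)) z0; rewrite -catA -EA.
    exact: (robust4 th_ge4 rg).2.
  exact: (robust4 th_ge4 rg').2.
move=> [u [c [g0 [c' [g0' [[EA -> Eg ->] [-> Eg' ->] [_ n1 n2]]]]]]] h.
have h1 : core (u ++ c) (g0 ++ B2) u.
  apply: (core_adj Msub Psub Pnil Glue (A := A)) n1; rewrite -Eg -EA.
  exact: (robust4 th_ge4 rg).2.
rewrite (core_uniq h h1).
apply: (core_adj Msub Psub Pnil Glue (A := A)) n2; rewrite -Eg' -EA.
exact: (robust4 th_ge4 rg').2.
Qed.

Lemma rmoves_core A m B m' B' (v : seq L) : rmoves A m B m' B' -> core m B v -> core m' B' v.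
Proof. by elim=> {m B m' B'} // m B n D n' D' /rstep_core h _ IH /h. Qed.

(** A robust neighbour on the right that overlaps [m] or touches it with empty overlap. Right moves
    can alter [m] only through such a neighbour. *)
Definition tied A m B A' g D := [/\ robust A' g D, (A * m * B = A' * g * D)%g &
  size A < size A' <= size A + size m].

(** The position that is moved is the tied neighbour itself, which gives a link, or lies to its
    right, which gives a right move of the neighbour. By [fpos_sep] it cannot lie between. *)
Lemma tied_step A m B m' B' A' g D : rstep A m B m' B' -> tied A m B A' g D ->
  exists g' D', tied A m' B' A' g' D' /\
    (link A' D g g' /\ D' = D \/ rstep A' g D g' D').
Proof.
move=> st [rg E /andP[lt le]]; have [rm rm' _] := st.
have [A2 [h [h' [B2 [lt2 [rh rh' ih] E2 E2' cs]]]]] := rstep_cases st.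
have [[p4 q4] [s4 s4']] := conj (conj (robust4 th_ge4 rm) (robust4 th_ge4 rg)) (conj (robust4 th_ge4 rh) (robust4 th_ge4 rh')).
case: (ltngtP (size A2) (size A')) => [l|l|l].
- by have := fpos_sep p4 s4 q4 E2 (etrans (esym E2) E) lt2 l; lia.
- have sep := fpos_sep p4 q4 s4 E (etrans (esym E) E2) lt l.
  have [g' [D' [E3 _ ht _]]] := fturn_right compat q4 s4 s4' (etrans (esym E) E2) l.
  have [m'm] : m' = m.
    case: cs => [[z [_ _ _ -> _]] //|[u [c [g0 [c' [g0' [[EA Em _ _] _ _]]]]]]].
    by move: sep; rewrite EA Em !size_cat; lia.
  exists g', D'; split.
    by split; [exact: ht|rewrite -E3|rewrite m'm lt le].
  right; split; [by []|exact: ht|].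
  by exists A2, h, h', B2; split; [exact: l|split|rewrite -E; exact: E2|exact: esym E3].
- have [EA Eg EB] := fpos_eq compat q4 s4 (etrans (esym E) E2) (esym l).
  exists h', B2; split; last by left; rewrite EA Eg EB; split.
  split; [by rewrite EA|by rewrite EA|rewrite lt /=].
  case: cs => [[z [z0 EA2 _ _ _]]|[u [c [g0 [c' [g0' [[EA2 _ _ _] [-> _ _] _]]]]]]].
    move: le; rewrite EA EA2 !size_cat; have : 0 < size z by rewrite lt0n size_eq0; apply/eqP.
    by lia.
  by rewrite EA EA2 !size_cat leq_add2l leq_addr.
Qed.

Lemma untied_step A m B m' B' : rstep A m B m' B' ->
  (forall A' g D, ~ tied A m B A' g D) ->
  m' = m /\ forall A' g D, ~ tied A m' B' A' g D.
Proof.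
move=> st nt; split; last first.
  by move=> A' g D /(tied_step (rstep_sym st))[g' [D' [/nt]]].
have [A2 [h [h' [B2 [lt2 [rh _ _] E2 _ []]]]]] := rstep_cases st; first by case=> z [].
move=> [u [c [g0 [c' [g0' [[EA Em _ _] _ _]]]]]]; case: (nt A2 h B2); split=> //.
by rewrite lt2 EA Em !size_cat leq_add2l leq_addr.
Qed.

Lemma rmoves_chain A m B m' B' : rmoves A m B m' B' -> exists f, m' = (m * f)%g /\
  forall b, chain A B m b -> chain A B' m' (b * f)%g /\ rmoves A b B (b * f)%g B'.
Proof.
elim=> {m B m' B'} [m B|m B n D n' D' st _ [f' [E' H']]].
  exists 1%g; rewrite mulg1; split=> // b c; rewrite mulg1; split=> //; exact: rmoves0.
have [rm rn [A2 [g [g' [B2 [lt l E EE]]]]]] := st; have [rg rg' _] := l.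
have [f [B1 [E1 r1 H]]] := transfer_right_chain compat th_ge4 (chain1 l) (And4 rm rg E lt).
have [e1 e2] := fpos_word_eq compat (robust4 th_ge4 r1) (robust4 th_ge4 rn) (etrans (esym E1) (esym EE)).
exists (f * f')%g; rewrite E' -e1 mulgA; split=> // b c.
have [c1 _ rv] := H b c; rewrite e1 e2 in c1 rv; have [c2 rv2] := H' _ c1.
by rewrite mulgA e1 -E'; split=> //; apply: rmoves_trans rv rv2.
Qed.

Lemma untied_rmoves A m B m' B' : rmoves A m B m' B' ->
  (forall A' g D, ~ tied A m B A' g D) -> m' = m.
Proof.
elim=> {m B m' B'} // m B n D n' D' st _ IH nt.
by have [<- nt'] := untied_step st nt; apply: IH.
Qed.

(** Links at the neighbour commute with its right moves, so they can all be made first, in the old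
    context [D]: they lead from [g] to [b]. What remains are right moves between [b] and the final
    [g']. *)
Lemma tied_rmoves A m B m' B' A' g D : rmoves A m B m' B' -> tied A m B A' g D ->
  exists g' D' b, [/\ tied A m' B' A' g' D', chain A' D g b & rmoves A' g' D' b D].
Proof.
move=> rv; elim: rv g D => {m B m' B'} [m B|m B n B1 n' B1' st _ IH] g D t.
  by exists g, D, g; split=> //; [exact: chain0|exact: rmoves0].
have [g1 [D1 [t1 cs]]] := tied_step st t.
have [g' [D' [b [t' c r]]]] := IH _ _ t1.
case: cs => [[l e]|st1].
  exists g', D', b; rewrite e in c r; split; [exact: t'|exact: chainS l c|exact: r].
have [f [Eg H]] := rmoves_chain (rmoves1 (rstep_sym st1)).
have [c2 r2] := H _ c.
by exists g', D', (b * f)%g; split=> //; apply: rmoves_trans r r2.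
Qed.

Lemma tied_split A m B A' g D : robust A m B -> tied A m B A' g D ->
  exists u c g0 : F, [/\ word A' = A ++ u, word m = u ++ c, word g = c ++ g0 &
    word B = g0 ++ D] /\ ~ Lam 3 u /\ ~ Lam 3 g0.
Proof.
move=> rm [rg E /andP[lt le]].
have [p4 q4] := conj (robust4 th_ge4 rm) (robust4 th_ge4 rg).
case: (pos_cases Msub Pnil Glue p4.2 q4.2 (fpos_eqw p4 q4 E) lt).
  by move=> [z [z0 EA _]]; move: le; rewrite EA !size_cat; case: z z0 {EA} => //= ? ?; lia.
move=> [u [c [g0 [[u0 EA Em Eg EB] [_ nu ng]]]]].
have [rA rg'] := (word_reduced A', word_reduced g); have rm' := word_reduced m.
have ru : reduced u by apply: (@reduced_catr _ A); rewrite -EA.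
have rc : reduced c by apply: (@reduced_catr _ u); rewrite -Em.
have rg0 : reduced g0 by apply: (@reduced_catr _ c); rewrite -Eg.
by exists (nf u), (nf c), (nf g0); rewrite !nfK.
Qed.

(** Supplies the maximality hypotheses of right isolation. Extending [m] into [a] is excluded by the
    maximality of [m]; extending [c a] to the left would, by gluing along the non-piece [a], extend
    [g]. *)
Lemma tied_maximal A m B A' g D (u c a y : F) : robust A m B -> robust A' g D ->
  word A' = A ++ u -> word m = u ++ c -> word g = c ++ a ++ y -> word B = a ++ y ++ D ->
  ~ Pw a ->
  [/\ nocancel m a, ~ Mon Rel (m * a)%g, maximal_occurrence Rel (m * a)%g m 0, suffix c m &
      maximal_occurrence Rel (m * a)%g (c * a)%g (size m - size c)].
Proof.
move=> [rAB pm] [_ pg] EA Em Eg EB na.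
have [[Mm _ mr] [Mg gl _]] := (pos_max pm, pos_max pg).
have rma : reduced (m ++ a).
  by move: rAB => /reduced_catr; rewrite EB catA => /reduced_catl.
have Ema := word_mul rma.
have Eca : word (c * a)%g = c ++ a.
  by apply: word_mul; apply: (@reduced_catr _ u); rewrite catA -Em.
have ext (s R : seq L) : s <> [::] -> word a = s ++ R -> ~ Mw (m ++ s).
  case: s => // x s _ Ea Ms; apply: (mr x (s ++ R ++ y ++ D)); first by rewrite EB Ea -!catA.
  by rewrite -cats1; apply: (@M_catl _ _ Msub _ s); rewrite -catA.
have a0 : word a <> [::] by move=> h; apply: na; rewrite h; exact: Pnil.
split=> //.
- by move=> /MwE; rewrite Ema; apply: (ext _ [::]) => //; rewrite cats0.
- split; [exact/MwE|by exists [::], a; rewrite Ema|move=> v j /MwE Mv [L0 [R [<- E]]]].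
  rewrite leqn0 => /eqP/size0nil L00; rewrite L00 /= in E *; rewrite !add0n => le.
  case: (cat_split (etrans (esym Ema) E)) => [[s [Ev Ea]]|[s [s0 [Em' _]]]].
    have [s0|/eqP s0] := eqVneq s [::]; last by case: (ext s R s0 Ea); rewrite -Ev.
    by split=> //; apply: word_inj; rewrite Ev s0 cats0.
  case: s0; apply: size0nil; move: le.
  by rewrite Em' size_cat -[X in _ <= X]addn0 leq_add2l leqn0 => /eqP.
- by rewrite Em suffix_suffix.
- have -> : size m - size c = size u by rewrite Em size_cat addnK.
  have Mca : Mw (c ++ a) by apply: (@M_catl _ _ Msub _ y); rewrite -catA -Eg.
  split; [by apply/MwE; rewrite Eca|by exists u, [::]; rewrite Ema Eca cats0 Em -catA|].
  move=> v j /MwE Mv [L0 [R [<- E]]]; rewrite Eca => le1 le2.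
  rewrite Ema Em -catA in E.
  have R0 : R = [::].
    apply: size0nil; have := congr1 size E; move: le1 le2; rewrite !size_cat.
    by move: (size u) (size c) (size a) (size L0) (size v) (size R) => *; lia.
  rewrite R0 cats0 in E.
  case: (cat_split E) => [[s [EL Eca']]|[s [_ [Eu Ev]]]].
    have s0 : s = [::].
      by apply: size0nil; move: le1; rewrite EL size_cat; move: (size u) (size s) => *; lia.
    by split; [apply: word_inj; rewrite Eca Eca' s0|rewrite EL s0 cats0].
  case/lastP: s => [|s x] in Eu Ev *.
    by split; [apply: word_inj; rewrite Eca Ev|rewrite Eu cats0].
  case: (gl (A ++ L0 ++ s) x); first by rewrite EA Eu -!cats1 !catA.
  rewrite Eg -[x :: _]/((x :: c) ++ a ++ y); apply: Glue => //.
    by apply: (@M_catr _ _ Msub s); rewrite -cat_rcons -Ev.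
  by apply: (@M_catr _ _ Msub c); rewrite -Eg.
Qed.

Lemma tied_end A' g D g' D' (c g0 c' g0' : F) B : robust A' g D -> robust A' g' D' ->
  word g = c ++ g0 -> word g' = c' ++ g0' -> word B = g0 ++ D -> word B = g0' ++ D' ->
  ~ Pw g0 -> ~ Pw g0' -> g0 = g0' /\ D = D'.
Proof.
suff half (h h' E E' e e0 e' e0' : F) (s : seq L) : robust A' h E -> robust A' h' E' ->
    word h = e ++ e0 -> word h' = e' ++ e0' -> word e0' = e0 ++ s ->
    word E = s ++ E' -> ~ Pw e0 -> s = [::].
  move=> r r' Eg Eg' EB EB' n n'; case: (cat_split (etrans (esym EB) EB')) => [] [s].
    move=> [E1 E2]; have s0 := half _ _ _ _ _ _ _ _ _ r r' Eg Eg' E1 E2 n.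
    by split; apply: word_inj; [rewrite E1 s0 cats0|rewrite E2 s0].
  move=> [_ [E1 E2]]; have s0 := half _ _ _ _ _ _ _ _ _ r' r Eg' Eg E1 E2 n'.
  by split; apply: word_inj; [rewrite E1 s0 cats0|rewrite E2 s0].
case: s => // x s [_ /pos_max[Mh _ mr]] [_ /pos_max[Mh' _ _]] Eh Eh' E1 E2 n.
case: (mr x (s ++ E') E2); rewrite Eh -cats1 -catA; apply: Glue => //; first by rewrite -Eh.
apply: (@M_catl _ _ Msub _ s); rewrite -catA; apply: (@M_catr _ _ Msub e').
by rewrite -E1 -Eh'.
Qed.

(** The tied neighbour reads [c a y0] before and [c' a y0] after the moves, with the same tail
    because [B] returns to itself. Undoing the moves on its right preserves the core [c' a] and
    gives [b = c' a y], linked by a chain to [g = c a y0]. These are the data of right isolation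
    with [p1 = c], [pK = c'], [r = y0], [r' = y]; but [m c^-1] and [m' c'^-1] are both [u]. *)
Lemma class_inj A m B m' : robust A m B -> chain A B m m' -> rmoves A m B m' B -> m = m'.
Proof.
move=> rm cm rv; apply: contrapT => nm; have rm' := chain_robust rm cm.
have [[A' [g [D t]]]|nt] := pselect (exists A' g D, tied A m B A' g D); last first.
  by apply/nm/esym/(untied_rmoves rv) => A' g D t; apply: nt; exists A', g, D.
have [g' [D' [b [t' cg rg]]]] := tied_rmoves rv t.
have [u [c [g0 [[EA Em Eg EB] [nu ng]]]]] := tied_split rm t.
have [u' [c' [g0' [[EA' Em' Eg' EB'] [nu' ng']]]]] := tied_split rm' t'.
have [[r r'] rb] : (robust A' g D /\ robust A' g' D') /\ robust A' b D.
  by case: t t' => [r _ _] [r' _ _]; split=> //; exact: chain_robust cg.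
have [np np'] : ~ Pw g0 /\ ~ Pw g0' by split; apply: (@nLam_nPw _ _ _ 2).
have [e1 e2] := tied_end r r' Eg Eg' EB EB' np np'; subst g0' D'.
have eu : u = u' by apply: word_inj; apply: (@catI _ (word A)); rewrite -EA -EA'.
subst u'.
have [a0 ca] := core_ex Mw Pw g0 D.
have [_ trg] := maxocc_trim Msub Glue (pos_max r.2).
have [_ trg'] := maxocc_trim Msub Glue (pos_max r'.2).
have [_ trb] := maxocc_trim Msub Glue (pos_max rb.2).
have cg' : core g' D (c' ++ a0).
  by rewrite Eg'; apply: (core_tail Msub Psub Pnil) => //; rewrite -Eg'.
have [y [Eb Cy _]] := rmoves_core rg cg'.
have [y0 [E0 Cy0 _]] := ca.
have Py0 : Pw y0 by apply: (free_suffix Msub Psub Pnil (m := c ++ a0)) Cy0; rewrite -catA -E0 -Eg.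
have Py : Pw y by apply: (free_suffix Msub Psub Pnil (m := c' ++ a0)) Cy; rewrite -Eb.
have ra : reduced a0 by apply: (@reduced_catl _ _ y0); rewrite -E0; exact: word_reduced.
have [ry ry0] := (Pw_reduced Py, Pw_reduced Py0).
(* Both ends of [g] are free: [y0] by the choice of the core, and [c] because [A u] and [A m] have
   the same cost. So [a0] is a trimmed part of a robust monomial. *)
have nLa : ~ Lam th a0.
  have cE : cost Mw Pw 3 (A' ++ c) = cost Mw Pw 3 A'.
    have [tlm _] := maxocc_trim Msub Glue (pos_max rm.2).
    have [Mm _ _] := pos_max rm.2; rewrite EA -catA -Em.
    have nm3 : ~ Lam 3 m by apply: pos_Lam (pos_le _ rm.2); lia.
    have tlm' : trimL Mw Pw A (m ++ [::]) by rewrite cats0.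
    rewrite (cost_left Msub Psub Pnil tlm' Mm nm3); rewrite Em in tlm Mm.
    by rewrite (cost_left Msub Psub Pnil tlm (@M_catl _ _ Msub _ _ Mm) nu).
  by case: r => _ [_ h]; apply: (h c a0 y0) => //; rewrite -E0 -Eg.
have na : ~ Pw a0.
  by move=> /(Lam1 Pnil) h; apply: nLa; apply: Lam_le h; apply: leq_trans th_ge9.
pose a := nf a0; pose y0F := nf y0; pose yF := nf y.
have [Ea Ey0 Ey] : [/\ word a = a0, word y0F = y0 & word yF = y] by rewrite /a /y0F /yF !nfK.
rewrite -Ea -Ey0 in E0; rewrite -Ea -Ey in Eb; rewrite -Ea in na nLa.
rewrite -Ey in Py; rewrite -Ey0 in Py0.
have EgA : word g = c ++ a ++ y0F by rewrite -E0.
have EgA' : word g' = c' ++ a ++ y0F by rewrite -E0.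
have EBA : word B = a ++ y0F ++ D by rewrite EB E0 -catA.
have [n1 nM1 mx1 s1 mp1] := tied_maximal rm r EA Em EgA EBA na.
have [n2 nM2 mx2 s2 mp2] := tied_maximal rm' r' EA Em' EgA' EBA na.
have [K [sq [hs sq1 sqK]]] := robust_chain rm cm.
have [n [bq [hb bq1 bqn]]] := robust_chain r cg.
have Mg : Mw (a ++ y0F).
  by apply: (@M_catr _ _ Msub c); rewrite -EgA; case: (pos_max r.2).
have Mb : Mw (a ++ yF).
  by apply: (@M_catr _ _ Msub c'); rewrite catA -Eb; case: (pos_max rb.2).
have [rg1 rb1] := (Mw_reduced Mg, Mw_reduced Mb).
have Sw (w : F) : Pw w -> S w by case=> v Sv /word_inj <-.
have Lth : le_inf (tau - 2) (Lambda S a).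
  have -> : tau - 2 = (tau - 3).+1 by lia.
  by apply/le_Lambda => h; apply: nLa; apply: Lam_le h; rewrite /th; lia.
have Ma : Mon Rel a by apply/MwE; apply: (@M_catl _ _ Msub _ y0F).
apply: (isol (K := K) (m := sq) (a := a) (p1 := c) (pK := c') hs); rewrite ?sq1 ?sqK //.
  exists y0F, yF, n, bq; split; [by split; exact: Sw|split=> //|split=> //|exact: hb|].
  - by apply/MwE; rewrite word_mul.
  - by apply/MwE; rewrite word_mul.
  - by rewrite bq1 bqn; split; [exact: EgA|rewrite catA; exact: Eb].
have [gm gm'] := (mul_word Em, mul_word Em').
by rewrite gm gm' !mulgK.
Qed.

End Isolation.

(** * Well-orders and the order on words *)

Lemma strict_well_order (T : Type) : exists R : T -> T -> Prop,
  [/\ forall x y z, R x y -> R y z -> R x z,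
      forall x y, x <> y -> R x y \/ R y x &
      forall Q : T -> Prop, (exists x, Q x) -> exists2 x, Q x & forall y, Q y -> ~ R y x].
Proof.
have [R wo] := well_ordering_principle {classic T}.
have minQ (Q : T -> Prop) : (exists x, Q x) -> exists2 x, Q x & forall y, Q y -> R x y.
  move=> [x Qx]; have [|z [[/asboolP Qz lb] _]] := wo (fun x => `[< Q x >]).
    by exists x; apply/asboolP.
  by exists z => // y Qy; apply: lb; apply/asboolP.
have anti x y : R x y -> R y x -> x = y.
  move=> xy yx; have [|z [_ uz]] := wo (pred2 x y); first by exists x; rewrite !inE eqxx.
  have Rxx : R x x.
    by have [|u -> h] := minQ (fun t => t = x); [exists x|exact: h].
  have Ryy : R y y.
    by have [|u -> h] := minQ (fun t => t = y); [exists y|exact: h].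
  rewrite -(uz x) ?(uz y) //; split; rewrite ?inE ?eqxx ?orbT //.
    by move=> t; rewrite !inE => /orP[] /eqP->.
  by move=> t; rewrite !inE => /orP[] /eqP->.
exists (fun x y => R x y /\ x <> y); split.
- move=> x y z [xy nxy] [yz nyz].
  have [|u Qu mu] := minQ (fun t => [\/ t = x, t = y | t = z]); first by exists x; constructor 1.
  have [ux uy uz] : [/\ R u x, R u y & R u z] by split; apply: mu; [constructor 1|constructor 2|constructor 3].
  case: Qu => e; subst u.
  + by split=> // e; apply: nxy; apply: anti => //; rewrite e.
  + by case: nxy; apply: anti.
  + by case: nyz; apply: anti.
- move=> x y nxy; have [|u Qu mu] := minQ (fun t => t = x \/ t = y); first by exists x; left.
  have [ux uy] : R u x /\ R u y by split; apply: mu; [left|right].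
  by case: Qu => e; subst u; [left|right]; split=> // /esym.
- move=> Q /minQ[x Qx mx]; exists x => // y Qy [yx nyx]; apply: nyx.
  by apply: anti => //; apply: mx.
Qed.

Lemma wf_minimal (T : Type) (R : T -> T -> Prop) :
  (forall Q : T -> Prop, (exists x, Q x) -> exists2 x, Q x & forall y, Q y -> ~ R y x) ->
  well_founded R.
Proof.
move=> h x; apply: contrapT => nx.
have [|y ny my] := h (fun t => ~ Acc R t); first by exists x.
by apply: ny; constructor => z Rzy; apply: contrapT => /my.
Qed.

Lemma minimal_nat (T : Type) (f : T -> nat) (Q : T -> Prop) : (exists x, Q x) ->
  exists2 x, Q x & forall y, Q y -> f x <= f y.
Proof.
move=> [x Qx]; have ex : exists n, `[< exists2 y, Q y & f y = n >].
  by exists (f x); apply/asboolP; exists x.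
case: (ex_minnP ex) => n /asboolP[y Qy <-] mn; exists y => // z Qz.
by apply: mn; apply/asboolP; exists z.
Qed.

Section WordOrder.
Variables (k : fieldType) (X : choiceType).
Local Notation F := (freegroup X).
Local Notation kF := (galg k F).
Variable Rel : set kF.
Implicit Types (A B D U V W m g b x y z u v w e f : F) (p q : kF) (n t : nat).
Variable th : nat.
Variable ltK : set (F * F * F) -> set (F * F * F) -> Prop.
Hypothesis ltK_min : forall Q : set (F * F * F) -> Prop, (exists s, Q s) ->
  exists2 s, Q s & forall s', Q s' -> ~ ltK s' s.

Local Notation Mw := (Mw Rel).
Local Notation Pw := (Pw Rel).
Local Notation C3 := (cost Mw Pw 3).
Local Notation C7 := (cost Mw Pw 7).
Local Notation nr := (nr Rel th).
Local Notation key := (key Rel th).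
Local Notation lev_lt := (lev_lt Rel th).
Local Notation lev_eq := (lev_eq Rel th).

(** The smallest differing prefix cost decides, so a decrease at one position outweighs whatever
    happens on its right. *)
Definition wlt W U := lev_lt W U \/ lev_eq W U /\ exists n,
  [/\ n <= C3 U, ltK (key W n) (key U n) & forall j, j < n -> key W j = key U j].

(** Minimize [C7], then [nr], then the keys one after the other. The bound by the common [C3] makes
    this finite; lexicographic orders on infinite sequences need not be well-founded. *)
Lemma wlt_wf : well_founded wlt.
Proof.
apply: wf_minimal => Q0 Q0n.
have [U1 Q1 m1] := minimal_nat (fun U : F => C7 U) Q0n.
pose Q1' U := Q0 U /\ C7 U = C7 U1.
have [|U2 [Q2 e2] m2] := minimal_nat (fun U : F => nr U) (Q := Q1'); first by exists U1.
pose Q2' U := [/\ Q0 U, C7 U = C7 U1, nr U = nr U2 & C3 U = C3 U2].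
(* [s] records the successive minima: [s j] is a minimal key at [j] among the words that agree with
   [s] before [j]. *)
pose Q3' n U := Q2' U /\ exists s, (forall j, j < n -> key U j = s j) /\
  forall j V, j < n -> Q2' V -> (forall i, i < j -> key V i = s i) -> ~ ltK (key V j) (s j).
have ex n : exists U, Q3' n U.
  elim: n => [|n [U [QU [s [h1 h2]]]]].
    by exists U2; split=> //; exists (fun _ => set0).
  pose Qn l := exists V, [/\ Q2' V, forall j, j < n -> key V j = s j & key V n = l].
  have [|l [V [QV hV <-]] ml] := ltK_min (Q := Qn); first by exists (key U n), U.
  exists V; split=> //; exists (fun j => if j < n then s j else key V n); split.
    move=> j; rewrite ltnS leq_eqVlt => /orP[/eqP->|lt]; first by rewrite ltnn.
    by rewrite lt hV.
  move=> j W; rewrite ltnS leq_eqVlt => /orP[/eqP->|lt] QW hW.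
    rewrite ltnn; apply: ml; exists W; split=> // i lt.
    by rewrite (hW i lt) lt.
  rewrite lt; apply: h2 => // i li.
  by rewrite (hW i li) (ltn_trans li lt).
have [U [[QU c7 cn c3] [s [h1 h2]]]] := ex (C3 U2).+1.
exists U => // W QW [[l|[l1 [l2 l3]]]|[[l1 [l2 l3]] [n [le lk eqk]]]].
- by have := m1 _ QW; rewrite -c7 leqNgt l.
- by have := m2 W (conj QW (etrans l1 c7)); rewrite -cn leqNgt l3.
- have lt : n < (C3 U2).+1 by rewrite ltnS -c3.
  apply: (h2 n W lt) => [|i li|].
  + by split=> //; rewrite ?l1 ?l2 ?l3.
  + by rewrite eqk // h1 // (ltn_trans li lt).
  + by rewrite -h1.
Qed.

End WordOrder.

(** * Layouts and normal forms *)

Section Layouts.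
Variables (k : fieldType) (X : choiceType).
Local Notation F := (freegroup X).
Local Notation L := (letter X).
Local Notation kF := (galg k F).
Variable Rel : set kF.
Implicit Types (A B D U V W m g b x y z u v w e f : F) (p q : kF) (n t : nat) (s : seq kF).
Hypothesis compat : compatibility_axiom Rel.
Variable tau : nat.
Hypothesis tau_ge11 : 11 <= tau.
Hypothesis isol : right_isolation_axiom Rel (small_piece_or_letter Rel) tau.
Hypothesis sca : small_cancellation_axiom Rel (small_piece_or_letter Rel) tau.
Let th := tau - 2.
Variable ltK : set (F * F * F) -> set (F * F * F) -> Prop.
Hypothesis ltK_trans : forall c1 c2 c3, ltK c1 c2 -> ltK c2 c3 -> ltK c1 c3.
Hypothesis ltK_total : forall c1 c2, c1 <> c2 -> ltK c1 c2 \/ ltK c2 c1.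

Local Notation Mw := (Mw Rel).
Local Notation Pw := (Pw Rel).
Local Notation Lam := (Lam Pw).
Local Notation C3 := (cost Mw Pw 3).
Local Notation fpos := (fpos Rel).
Local Notation robust := (fpos th).
Local Notation chain := (chain Rel th).
Local Notation cls := (cls Rel th).
Local Notation lev_lt := (lev_lt Rel th).
Local Notation wlt := (wlt Rel th ltK).
Local Notation sum s := (\sum_(p <- s) p)%R.

Let Msub := Mw_sub compat.
Let Psub := Pw_sub compat.
Let Pnil := Pw_nil Rel.
Let Glue := Mw_glue compat.

Let th_ge9 : 9 <= th. Proof. by rewrite /th; lia. Qed.
Let th_ge4 : 4 <= th. Proof. exact: leq_trans th_ge9. Qed.

Lemma supp_sum s x : x \in msupp (sum s) -> exists2 p, p \in s & x \in msupp p.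
Proof.
rewrite -mcoeff_neq0 => nx; apply: contrapT => h; case/eqP: nx.
rewrite raddf_sum big_seq big1 // => p ps; apply/eqP; apply: contrapT => /negP.
by rewrite mcoeff_neq0 => xp; apply: h; exists p.
Qed.

Lemma RelZ (c : k) p : Rel p -> Rel (c *: p)%R.
Proof. by case: compat => h _ _; apply: h. Qed.

Lemma suppZ (c : k) p : c != 0%R -> msupp (c *: p)%R = msupp p.
Proof.
move=> c0; apply/fsetP => x; rewrite -!mcoeff_neq0 mcoeffZ mulf_eq0.
by rewrite (negPf c0).
Qed.

Lemma supp_long s : (forall p, p \in s -> Rel p) -> sum s != 0%R ->
  exists2 x, x \in msupp (sum s) & ~ Lam tau x.
Proof.
move=> Rs nz; have E : (sum s = \sum_(i < size s) 1 *: nth 0 s i)%R.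
  by rewrite (big_nth 0%R) big_mkord; apply: eq_bigr => i _; rewrite scale1r.
have Rq (i : 'I_(size s)) : Rel (nth 0%R s i) by apply: Rs; apply: mem_nth.
have nz' : (\sum_(i < size s) 1 *: nth 0 s i)%R != 0%R :> kF by rewrite -E.
have [x xs lx] := sca (g := fun _ => 1%R) Rq nz'.
by exists x; [rewrite E|apply/le_Lambda].
Qed.

Lemma supp_long1 p : Rel p -> p != 0%R -> exists2 x, x \in msupp p & ~ Lam tau x.
Proof.
move=> Rp nz; have [||x] := @supp_long [:: p]; rewrite ?big_seq1 //.
  by move=> q; rewrite inE => /eqP->.
by exists x.
Qed.

(** Each summand has its own monomial in the chain of [m]. Such families can be scaled and
    concatenated even though a summand need not contain the leading monomial of the sum. *)
Definition good A B m s := forall p, p \in s ->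
  Rel p /\ exists2 m', chain A B m m' & m' \in msupp p.

Lemma good_chain A B m s x : robust A m B -> good A B m s -> x \in msupp (sum s) ->
  robust A x B -> chain A B m x.
Proof.
move=> rm gs /supp_sum[p /gs[Rp [m' cm mp]] xp] rx.
exact: chain_link cm rm Rp mp xp rx.
Qed.

Lemma long_robust A m B p x : robust A m B -> Rel p -> m \in msupp p -> x \in msupp p ->
  ~ Lam tau x -> robust A x B.
Proof.
move=> rm Rp mp xp nx; have nx' : ~ Lam th.+2 x by rewrite /th; have -> : (tau - 2).+2 = tau by lia.
have [r mx] := turned compat (robust4 th_ge4 rm) Rp mp xp (nLam_nPw nx').
by split=> //; apply: (pos_of_Lam Msub Psub Pnil Glue).
Qed.

Lemma good_level A B m s x : robust A m B -> good A B m s -> x \in msupp (sum s) ->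
  ~ robust A x B -> lev_lt (A * x * B)%g (A * m * B)%g.
Proof.
move=> rm gs /supp_sum[p /gs[Rp [m' cm mp]] xp] nr.
have [e _] := chain_level compat th_ge9 rm cm; have rm' := chain_robust rm cm.
apply: lev_lt_eq e; have [lx|nx] := pselect (Lam 6 x).
  by left; exact: (turn_low compat th_ge9 rm' lx).
have px := turn_alive compat th_ge9 rm' Rp mp xp nx.
by have [_ h _] := turn_level compat th_ge9 rm' px; apply: h.
Qed.

(* [A b B] is the leading word of [A (sum s) B]: the other robust words have a
   smaller class and the remaining ones a lower level. *)
Definition lay A b B s := [/\ robust A b B, good A B b s, (sum s)@_b = 1%R &
  forall x, x \in msupp (sum s) -> x <> b -> robust A x B -> ltK (cls A x B) (cls A b B)].

Lemma lay_lt A b B s x : lay A b B s -> x \in msupp (sum s) -> x <> b ->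
  wlt (A * x * B)%g (A * b * B)%g.
Proof.
move=> [rb gs _ mx] xs nx; have [rx|nr] := pselect (robust A x B); last first.
  by left; apply: good_level gs xs nr.
have [e h] := chain_level compat th_ge9 rb (good_chain rb gs xs rx).
right; split=> //; exists (C3 A); split; last exact: h.
  by rewrite (C3_pos compat (robust4 th_ge4 rb)) -addnA leq_addr.
by rewrite !key_at //; apply: mx.
Qed.

Lemma max_in (T : choiceType) (R : T -> T -> Prop) (l : seq T) :
  (forall x y z : T, R x y -> R y z -> R x z) ->
  (forall x y : T, x \in l -> y \in l -> x <> y -> R x y \/ R y x) -> l != [::] ->
  exists2 x : T, x \in l & forall y : T, y \in l -> y <> x -> R y x.
Proof.
move=> tr; elim: l => // x l IH tot _.
have [->|l0] := eqVneq l [::].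
  by exists x; rewrite ?mem_seq1 // => y; rewrite mem_seq1 => /eqP.
have [|y yl my] := IH _ l0.
  by move=> y z yl zl; apply: tot; rewrite inE ?yl ?zl orbT.
have [<-|/eqP nxy] := eqVneq y x.
  by exists y; rewrite ?mem_head // => z; rewrite inE => /orP[/eqP->|/my].
have yl' : y \in x :: l by rewrite inE yl orbT.
have [xy|yx] := tot x y (mem_head _ _) yl' (nesym nxy).
  by exists y => // z; rewrite inE => /orP[/eqP->|/my].
exists x; rewrite ?mem_head // => z; rewrite inE => /orP[/eqP->|zl] // nzx.
have [->//|/eqP nzy] := eqVneq z y; by apply: tr yx; apply: my.
Qed.

(** Small cancellation leaves a monomial of measure above [tau] in the sum, which is robust. By
    [class_inj] distinct robust monomials have distinct classes, so one of them is largest; [c]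
    normalizes its coefficient. *)
Lemma lay_ex A m B s : robust A m B -> good A B m s -> sum s != 0%R ->
  exists b c, c != 0%R /\ lay A b B [seq (c *: p)%R | p <- s].
Proof.
move=> rm gs nz; have [x xs nx] := supp_long (fun p ps => proj1 (gs p ps)) nz.
pose l := [seq x <- msupp (sum s) | `[< robust A x B >]].
have lE y : (y \in l) <-> (y \in msupp (sum s) /\ robust A y B).
  by rewrite mem_filter; split=> [/andP[/asboolP ? ?]|[? ?]] //; apply/andP; split=> //; apply/asboolP.
have xl : x \in l.
  apply/lE; split=> //; have [p ps xp] := supp_sum xs; have [Rp [m' cm mp]] := gs p ps.
  exact: long_robust (chain_robust rm cm) Rp mp xp nx.
have [|||b bl mb] := @max_in _ (fun x y => ltK (cls A x B) (cls A y B)) l.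
- by move=> y1 y2 y3; apply: ltK_trans.
- move=> y z /lE[ys ry] /lE[zs rz] nyz; apply: ltK_total => /cls_eq e; apply: nyz.
  apply: (class_inj compat tau_ge11 isol ry) e.
  exact: chain_trans (chain_sym (good_chain rm gs ys ry)) (good_chain rm gs zs rz).
- by apply/eqP => l0; rewrite l0 in xl.
have /lE[bs rb] := bl; have nb : (sum s)@_b != 0%R by rewrite mcoeff_neq0.
pose c := ((sum s)@_b)^-1%R; have c0 : c != 0%R by rewrite invr_eq0.
have E : (sum [seq c *: p | p <- s] = c *: sum s)%R by rewrite big_map scaler_sumr.
exists b, c; split=> //; split=> //.
- move=> q /mapP[p ps ->]; have [Rp [m' cm mp]] := gs p ps.
  split; first exact: RelZ.
  exists m'; last by rewrite suppZ.
  exact: chain_trans (chain_sym (good_chain rm gs bs rb)) cm.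
- by rewrite E mcoeffZ mulVf.
- move=> y; rewrite E suppZ // => ys nyb ry; apply: mb => //; exact/lE.
Qed.

Lemma Rel_letterl p x (a : L) (v : seq L) : Rel p -> x \in msupp p -> word x = linv a :: v ->
  Rel (lmul (nf [:: a]) p).
Proof.
move=> Rp xp Ex; have := Rel_stripl compat Rp xp (a := [:: linv a]) (b := v) Ex.
by rewrite linv_nf invgK.
Qed.

Lemma Rel_letterr p x (a : L) (v : seq L) : Rel p -> x \in msupp p -> word x = rcons v (linv a) ->
  Rel (rmul p (nf [:: a])).
Proof.
rewrite -cats1 => Rp xp Ex; have := Rel_stripr compat Rp xp (a := v) (b := [:: linv a]) Ex.
by rewrite linv_nf invgK.
Qed.

Lemma Rel_extl p x (a : L) : ~ Pw x -> Rel p -> x \in msupp p -> Mw (a :: x) ->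
  Rel (lmul (nf [:: a]) p).
Proof.
move=> nP Rp xp Max.
by have := Rel_gluel compat (a := 1%g) (b := nf [:: a]) nP Rp xp erefl Max; rewrite invg1 mulg1.
Qed.

Lemma Rel_extr p x (a : L) : ~ Pw x -> Rel p -> x \in msupp p -> Mw (rcons x a) ->
  Rel (rmul p (nf [:: a])).
Proof.
rewrite -cats1 => nP Rp xp Max.
have Ex : word x = x ++ word (1%g : F) by rewrite cats0.
by have := Rel_gluer compat (d := 1%g) (b := nf [:: a]) nP Rp xp Ex Max; rewrite invg1 mul1g.
Qed.

(** Take a monomial [x] of measure above [tau]. An adjacent letter of [A] or [B] that cancels with
    [x] or extends it to a monomial can be absorbed into the relator. When no letter can be
    absorbed, [x] is a maximal occurrence. *)
Lemma Rel_position p A B : Rel p -> p != 0%R -> exists A' B' p' m,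
  [/\ Rel p', m \in msupp p', robust A' m B' & lmul A (rmul p B) = lmul A' (rmul p' B')].
Proof.
move: (ltnSn (size A + size B)); move: {2}(size A + size B).+1 => n.
elim: n A B p => [|n IH] A B p // le Rp nz.
have stepL (A1 : seq L) (a : L) : word A = rcons A1 a -> Rel (lmul (nf [:: a]) p) ->
    exists A' B' p' m,
    [/\ Rel p', m \in msupp p', robust A' m B' & lmul A (rmul p B) = lmul A' (rmul p' B')].
  move=> EA Ra; have [gA r1 _] := word_cat (etrans EA (esym (cats1 A1 a))).
  have [x xp _] := supp_long1 Rp nz.
  have nza : lmul (nf [:: a]) p != 0%R.
    by apply/eqP => h; move: xp; rewrite -(supp_lmulM (nf [:: a])) h msupp0.
  have [|A' [B' [p' [m [R' mp' rm' E']]]]] := IH (nf A1) B (lmul (nf [:: a]) p) _ Ra nza.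
    by rewrite nfK //; move: le; rewrite EA size_rcons; lia.
  exists A', B', p', m; split; [exact: R'|exact: mp'|exact: rm'|apply: etrans E'].
  by rewrite gA lmulM (lrmul (nf [:: a]) B p).
have stepR (B1 : seq L) (a : L) : word B = a :: B1 -> Rel (rmul p (nf [:: a])) ->
    exists A' B' p' m,
    [/\ Rel p', m \in msupp p', robust A' m B' & lmul A (rmul p B) = lmul A' (rmul p' B')].
  move=> EB Ra; have [gB _ r1] := word_cat (a := [:: a]) EB.
  have [x xp _] := supp_long1 Rp nz.
  have nza : rmul p (nf [:: a]) != 0%R.
    by apply/eqP => h; move: xp; rewrite -(supp_rmulM (nf [:: a])) h msupp0.
  have [|A' [B' [p' [m [R' mp' rm' E']]]]] := IH A (nf B1) (rmul p (nf [:: a])) _ Ra nza.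
    by rewrite nfK //; move: le; rewrite EB /=; lia.
  exists A', B', p', m; split; [exact: R'|exact: mp'|exact: rm'|apply: etrans E'].
  by rewrite gB rmulM.
have [x xp nx] := supp_long1 Rp nz.
have nx' : ~ Lam th.+2 x by rewrite /th; have -> : (tau - 2).+2 = tau by lia.
have nP := nLam_nPw nx'; have x0 := nLam_neq0 nx.
have [[A1 [a [EA Ra]]]|nL] := pselect (exists (A1 : seq L) (a : L), word A = rcons A1 a /\ Rel (lmul (nf [:: a]) p)).
  exact: stepL EA Ra.
have [[B1 [a [EB Ra]]]|nR] := pselect (exists (B1 : seq L) (a : L), word B = a :: B1 /\ Rel (rmul p (nf [:: a]))).
  exact: stepR EB Ra.
exists A, B, p, x; split=> //.
have mx : maxocc Mw A x B.
  split; first exact: Mw_supp Rp xp.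
    by move=> A1 a EA Max; apply: nL; exists A1, a; split=> //; apply: Rel_extl xp Max.
  by move=> a B1 EB Max; apply: nR; exists B1, a; split=> //; apply: Rel_extr xp Max.
split; last exact: (pos_of_Lam Msub Psub Pnil Glue).
have x1 : x <> 1%g by move=> h; apply: x0; rewrite h.
apply: reduced_glue => //.
  have [->|/eqP A0] := eqVneq A 1%g; first exact: word_reduced.
  apply: contraT => nr; have [A1 [a [v [EA Ex]]]] := cancel_letter A0 x1 nr; case: nL.
  by exists A1, a; split=> //; apply: Rel_letterl xp Ex.
have [->|/eqP B0] := eqVneq B 1%g; first by rewrite cats0; exact: word_reduced.
apply: contraT => nr; have [v [a [B1 [Ex EB]]]] := cancel_letter x1 B0 nr; case: nR.
 exists B1, (linv a); split=> //; apply: Rel_letterr xp _ => //.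
by rewrite linvK Ex.
Qed.

End Layouts.

(** * Linear extension to the group algebra *)

Section LinearExtension.
Variables (k : fieldType) (G : groupType).
Local Notation kG := (galg k G).
Implicit Types (p q z : kG).
Local Open Scope ring_scope.

Definition lext (f : G -> kG) z : kG := \sum_(x <- msupp z) z@_x *: f x.

Lemma lextw f (d : {fset G}) z : (msupp z `<=` d)%fset ->
  lext f z = \sum_(x <- d) z@_x *: f x.
Proof.
move=> le; rewrite /lext (big_fset_incl _ le) //= => x _ /mcoeff_outdom ->.
by rewrite scale0r.
Qed.

Lemma lextD f p q : lext f (p + q) = lext f p + lext f q.
Proof.
rewrite (lextw _ (msuppD_le p q)) (lextw _ (fsubsetUl (msupp p) (msupp q))).
rewrite (lextw _ (fsubsetUr (msupp p) (msupp q))) -big_split /=.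
by apply: eq_bigr => x _; rewrite mcoeffD scalerDl.
Qed.

Lemma lextZ f c p : lext f (c *: p) = c *: lext f p.
Proof.
rewrite (lextw _ (msuppZ_le c p)) scaler_sumr.
by apply: eq_bigr => x _; rewrite mcoeffZ scalerA.
Qed.

Lemma lext0 f : lext f 0 = 0.
Proof. by rewrite /lext msupp0 big_seq_fset0. Qed.

Lemma lextN f p : lext f (- p) = - lext f p.
Proof. by rewrite -scaleN1r lextZ scaleN1r. Qed.

Lemma lextB f p q : lext f (p - q) = lext f p - lext f q.
Proof. by rewrite lextD lextN. Qed.

Lemma lext_sum f (I : Type) (s : seq I) (E : I -> kG) :
  lext f (\sum_(i <- s) E i) = \sum_(i <- s) lext f (E i).
Proof. exact: (big_morph (lext f) (lextD f) (lext0 f)). Qed.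

Lemma galgE z : z = \sum_(x <- msupp z) z@_x *: gmono k x.
Proof.
rewrite {1}[z]monalgE; apply: eq_bigr => x _.
by rewrite /gmono gscaleU mulr1.
Qed.

Lemma gmono3 (x y z : G) : gmono k (x * y * z)%g = gmono k x * gmono k y * gmono k z.
Proof. by rewrite (gmonoM k (x * y)%g z) (gmonoM k x y). Qed.

Lemma lext_mul0 f (u z v : kG) :
  (forall x, x \in msupp z -> lext f (u * gmono k x * v) = 0) -> lext f (u * z * v) = 0.
Proof.
move=> h; have E : u * z * v = \sum_(x <- msupp z) z@_x *: (u * gmono k x * v).
  transitivity (u * (\sum_(x <- msupp z) z@_x *: gmono k x) * v).
    exact (f_equal (fun t : kG => u * t * v) (galgE z)).
  transitivity ((\sum_(x <- msupp z) u * (z@_x *: gmono k x)) * v).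
    exact (f_equal (fun t : kG => t * v) (gmul_sumr _ _ u)).
  transitivity (\sum_(x <- msupp z) u * (z@_x *: gmono k x) * v).
    exact: gmul_suml.
  apply: eq_bigr => x _; transitivity (z@_x *: (u * gmono k x) * v).
    exact (f_equal (fun t : kG => t * v) (gmul_scaler _ _ _)).
  exact: gmul_scalel.
by rewrite E lext_sum big_seq big1 // => x xz; rewrite lextZ h // scaler0.
Qed.

(** [w] and [v] stand for sums of relators with leading monomials [b] and [m], and [g] for what
    separates these. Each product on the right has lost one of the two leading monomials. *)
Lemma square_ring (R : pzRingType) (a w b g v m c : R) :
  a * w * (g * m * c) - a * b * g * v * c =
  a * (w - b) * (g * v * c) - a * w * g * (v - m) * c.
Proof.
by rewrite !(mulrBr, mulrBl) !mulrA opprB [RHS]addrC subrKA.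
Qed.

Lemma assoc5 (R : pzRingType) (a x g w c : R) : a * x * (g * w * c) = a * x * g * w * c.
Proof. by rewrite !mulrA. Qed.

Lemma mul_sub_mul (R : pzRingType) (a w v c : R) : a * (w - v) * c = a * w * c - a * v * c.
Proof. by rewrite mulrBr mulrBl. Qed.

Lemma subr0_eqP (V : zmodType) (a b : V) : a - b = 0 -> a = b.
Proof. by move/eqP; rewrite subr_eq0 => /eqP. Qed.

Lemma supp_sub_mono (z : kG) (b x : G) : z@_b = 1 -> x \in msupp (z - gmono k b) ->
  x \in msupp z /\ x <> b.
Proof.
rewrite -!mcoeff_neq0 mcoeffB mcoeffU => zb.
have [->|/eqP nxb] := eqVneq x b; first by rewrite zb mulr1n subrr (eqxx (0 : k)).
by rewrite mulr0n subr0.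
Qed.

Lemma addN_eq (V : zmodType) (a b : V) : a = b -> - a + b = 0.
Proof. by move->; rewrite addNr. Qed.

End LinearExtension.

(** * Confluence of the rewriting *)

Section Confluence.
Variables (k : fieldType) (X : choiceType).
Local Notation F := (freegroup X).
Local Notation kF := (galg k F).
Variable Rel : set kF.
Implicit Types (A B D U V W m g b x y z u v w e f : F) (p q : kF) (n t : nat) (s : seq kF).
Hypothesis compat : compatibility_axiom Rel.
Variable tau : nat.
Hypothesis tau_ge11 : 11 <= tau.
Hypothesis isol : right_isolation_axiom Rel (small_piece_or_letter Rel) tau.
Hypothesis sca : small_cancellation_axiom Rel (small_piece_or_letter Rel) tau.
Let th := tau - 2.
Variable ltK : set (F * F * F) -> set (F * F * F) -> Prop.
Hypothesis ltK_trans : forall c1 c2 c3, ltK c1 c2 -> ltK c2 c3 -> ltK c1 c3.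
Hypothesis ltK_total : forall c1 c2, c1 <> c2 -> ltK c1 c2 \/ ltK c2 c1.
Hypothesis ltK_min : forall Q : set (F * F * F) -> Prop, (exists c, Q c) ->
  exists2 c, Q c & forall c', Q c' -> ~ ltK c' c.

Local Notation Mw := (Mw Rel).
Local Notation Pw := (Pw Rel).
Local Notation C3 := (cost Mw Pw 3).
Local Notation fpos := (fpos Rel).
Local Notation robust := (fpos th).
Local Notation chain := (chain Rel th).
Local Notation config := (config Rel).
Local Notation cls := (cls Rel th).
Local Notation wlt := (wlt Rel th ltK).
Local Notation good := (good Rel tau).
Local Notation lay := (lay Rel tau ltK).
Local Notation sum s := (\sum_(p <- s) p)%R.
Local Notation triple A z B := (lmul A (rmul z B)).

Let th_ge9 : 9 <= th. Proof. by rewrite /th; lia. Qed.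
Let th_ge4 : 4 <= th. Proof. exact: leq_trans th_ge9. Qed.

Lemma coeff_triple A p B x : (triple A p B)@_(A * x * B)%g = p@_x.
Proof. by rewrite coeff_lmul coeff_rmul -(mulgA A x B) mulKg mulgK. Qed.

Lemma supp_triple A p B W : W \in msupp (triple A p B) ->
  exists2 x, x \in msupp p & W = (A * x * B)%g.
Proof.
rewrite supp_lmul supp_rmul => h; exists (A^-1 * W * B^-1)%g => //.
by rewrite mulgA mulVKg mulgVK.
Qed.

Lemma supp_tripleM A p B x : ((A * x * B)%g \in msupp (triple A p B)) = (x \in msupp p).
Proof. by rewrite -!mcoeff_neq0 coeff_triple. Qed.

(** If robustness is lost at either position, the level drops. Otherwise replacing [m] by [y] is a
    right move for the left position, whose smaller class therefore decides, and keys further left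
    are unchanged. *)
Lemma pair_wlt A1 b B1 A2 m B2 b' m' p q x y : config th th A1 b B1 A2 m B2 ->
  chain A1 B1 b b' -> Rel p -> b' \in msupp p -> x \in msupp p ->
  chain A2 B2 m m' -> Rel q -> m' \in msupp q -> y \in msupp q ->
  (robust A1 x B1 -> ltK (cls A1 x B1) (cls A1 b B1)) ->
  wlt (A1 * x * ((A1 * b)^-1 * A2) * y * B2)%g (A1 * b * B1)%g.
Proof.
move=> cf cb Rp bp xp cm Rq mq yq lt; have [rb rm E l12] := cf.
have [_ nlt] := pair_chain_level compat th_ge9 cf cb Rp bp xp cm Rq mq yq.
have [rx|nx] := pselect (robust A1 x B1); last by left; apply: nlt; left.
have [ry|ny] := pselect (robust A2 y B2); last by left; apply: nlt; right.
have cx := chain_link cb rb Rp bp xp rx; have cy := chain_link cm rm Rq mq yq ry.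
have [f [B1' [E1 rbf H]]] := transfer_right_chain compat th_ge4 cy cf.
have [cxf _ rv] := H _ cx.
have -> : (A1 * x * ((A1 * b)^-1 * A2) * y * B2 = A1 * (x * f) * B1')%g.
  have -> : ((A1 * b)^-1 * A2 = f * B1' * B2^-1 * y^-1)%g.
    apply: (mulgI (A1 * b)%g); rewrite mulVKg !mulgA.
    by rewrite -[(A1 * b * f)%g]mulgA -E1 !mulgK.
  by rewrite !mulgA !mulgVK.
have [e1 k1] := chain_level compat th_ge9 rbf cxf.
have [e2 k2] := chain_level compat th_ge9 rm cy.
rewrite -E1 in e1 k1; right; split.
  by apply: lev_eq_trans e1 _; apply: lev_eq_trans e2 _; rewrite E.
have rxf := chain_robust rbf cxf.
have l3 : C3 A1 < C3 A2.
  by rewrite -(C3_lt compat (robust4 th_ge4 rb) (robust4 th_ge4 rm) E).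
exists (C3 A1); split.
- by rewrite (C3_pos compat (robust4 th_ge4 rb)) -addnA leq_addr.
- by rewrite !key_at // -(cls_rmoves rv); apply: lt.
- by move=> j lj; rewrite k1 // k2 ?(ltn_trans lj l3) // E.
Qed.

Definition laid U (l : F * F * F * seq kF) :=
  (l.1.1.1 * l.1.1.2 * l.1.2 = U)%g /\ lay l.1.1.1 l.1.1.2 l.1.2 l.2.

(** One layout is chosen for each leading word; by [N_lay] the normal form vanishes on all the
    others too. *)
Definition lead U := if pselect (exists l, laid U l) is left e then Some (projT1 (cid e)) else None.

Definition layz (l : F * F * F * seq kF) : kF := triple l.1.1.1 (sum l.2) l.1.2.

(** The leading coefficient is 1, so [U] is replaced by minus the other terms. The default 0 drops
    the term [U] itself, the only one that is not smaller. *)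
Definition nform_step U (rec : forall W, wlt W U -> kF) : kF :=
  if lead U is Some l then
    (- \sum_(W <- msupp (layz l)) (layz l)@_W *:
        (if pselect (wlt W U) is left h then rec W h else 0))%R
  else gmono k U.

Definition nform : F -> kF := Fix (wlt_wf Rel th ltK_min) (fun _ => kF) nform_step.

Lemma nformE U : nform U = nform_step (fun W (_ : wlt W U) => nform W).
Proof.
refine (Fix_eq (wlt_wf Rel th ltK_min) (fun _ => kF) nform_step _ U) => V f g fg.
rewrite (_ : f = g) //.
by apply: functional_extensionality_dep => W; exact: functional_extensionality_dep.
Qed.

Local Notation N := (lext nform).

Lemma nform_free U : (forall l, ~ laid U l) -> nform U = gmono k U.
Proof. by move=> h; rewrite nformE /nform_step /lead; case: pselect => // e; have [l /h] := e. Qed.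

Lemma wlt_irr U : ~ wlt U U.
Proof.
move: U; apply: (well_founded_ind (wlt_wf Rel th ltK_min)) => U IH UU.
exact: (IH U UU UU).
Qed.

Lemma lext_layz U l : lead U = Some l -> N (layz l) = 0%R.
Proof.
move=> El; have [E ll] : laid U l.
  by move: El; rewrite /lead; case: pselect => // e [<-]; case: cid.
have [rb gs c1 _] := ll.
have cU : (layz l)@_U = 1%R by rewrite -E coeff_triple.
have Us : U \in msupp (layz l) by rewrite -mcoeff_neq0 cU oner_eq0.
rewrite /lext (big_rem U Us) /= cU scale1r nformE /nform_step El (big_rem U Us) /=.
case: pselect => [/wlt_irr //|_]; rewrite scaler0 add0r.
apply: addN_eq; apply: eq_big_seq => W.
rewrite (mem_rem_uniq _ (fset_uniq (msupp (layz l)))) => /andP[nW Ws].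
case: pselect => [h|nlt]; first exact: erefl.
case: nlt; have [x xs EW] := supp_triple Ws.
rewrite EW -E; apply: lay_lt ll xs _ => // ex; case/negP: nW; apply/eqP.
by rewrite EW ex E.
Qed.

Lemma lay_lead A b B s : lay A b B s -> exists l, lead (A * b * B)%g = Some l /\ laid (A * b * B)%g l.
Proof.
move=> h; rewrite /lead; case: pselect => [e|[]]; last by exists (A, b, B, s).
by exists (projT1 (cid e)); split; [exact: erefl|case: cid].
Qed.

Lemma sumZ (c : k) s : (sum [seq c *: p | p <- s] = c *: sum s)%R.
Proof. by rewrite big_map scaler_sumr. Qed.

Lemma tripleZ (c : k) A p B : triple A (c *: p)%R B = (c *: triple A p B)%R.
Proof.
exact (etrans (f_equal (gmul (gmono k A)) (gmul_scalel c p (gmono k B)))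
  (gmul_scaler c (gmono k A) (gmul p (gmono k B)))).
Qed.

Lemma triple0 A B : triple A (0%R : kF) B = 0%R.
Proof.
by rewrite -{1}(scale0r (0%R : kF)) tripleZ scale0r.
Qed.

Lemma triple_sum A s B : triple A (sum s) B = (\sum_(p <- s) triple A p B)%R.
Proof.
exact (etrans (f_equal (gmul (gmono k A)) (gmul_suml s id (gmono k B)))
  (gmul_sumr s (fun p => gmul p (gmono k B)) (gmono k A))).
Qed.

Section Kill.
Variable Q : F -> Prop.
Hypothesis IH : forall A b B s, lay A b B s -> Q (A * b * B)%g -> N (triple A (sum s) B) = 0%R.

(** [Q] is the range in which layouts are already known to be killed: the words below [U] during the
    induction, all words after it. A non-zero good sum is a scalar multiple of a layout. *)
Lemma N_good A m B s : robust A m B -> good A B m s ->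
  (forall x, x \in msupp (sum s) -> Q (A * x * B)%g) -> N (triple A (sum s) B) = 0%R.
Proof.
move=> rm gs ls; have [->|nz] := eqVneq (sum s) 0%R; first by rewrite triple0 lext0.
have [b [c [c0 lb]]] := lay_ex compat tau_ge11 isol sca ltK_trans ltK_total rm gs nz.
have bs : b \in msupp (sum s).
  by have [_ _ c1 _] := lb; rewrite -(suppZ _ c0) -sumZ -mcoeff_neq0 c1 oner_eq0.
have h := etrans (esym (f_equal (fun w : kF => N (triple A w B)) (sumZ c s))) (IH lb (ls b bs)).
have h2 := etrans (esym (f_equal N (tripleZ c A (sum s) B))) h.
have := etrans (esym (lextZ nform c (triple A (sum s) B))) h2; move/eqP.
by rewrite scaler_eq0 (negPf c0) => /eqP.
Qed.

(** [Rel_position] changes the relator and its context but not the product, so the words to be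
    tested against [Q] stay the same. *)
Lemma N_Rel A p B : Rel p -> (forall x, x \in msupp p -> Q (A * x * B)%g) ->
  N (triple A p B) = 0%R.
Proof.
move=> Rp ls; have [->|nz] := eqVneq p 0%R; first by rewrite triple0 lext0.
have [A' [B' [p' [m [Rp' mp' rm E]]]]] := Rel_position compat tau_ge11 sca A B Rp nz.
have gs : good A' B' m [:: p'].
  move=> q; rewrite mem_seq1 => /eqP->; split; first exact: Rp'.
  by exists m; [exact: chain0|exact: mp'].
have := N_good rm gs; rewrite big_seq1 => H; rewrite E; apply: H => x.
rewrite -(supp_tripleM A' p' B') -E => /supp_triple[y yp ->].
exact: ls.
Qed.

End Kill.

Lemma triple_prod A p B : triple A p B = (gmono k A * p * gmono k B)%R.
Proof. exact: gmulA. Qed.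

Section Step.
Variable U : F.
Hypothesis IH : forall A b B s, lay A b B s -> wlt (A * b * B)%g U -> N (triple A (sum s) B) = 0%R.

(** The difference is again a good family, and as both leading coefficients are 1 only words below
    [U] remain. *)
Lemma N_same A b B s s' : lay A b B s -> lay A b B s' -> (A * b * B)%g = U ->
  N (triple A (sum s) B) = N (triple A (sum s') B).
Proof.
move=> l l' EU; have [rb gs c1 _] := l; have [_ gs' c1' _] := l'.
pose t := s ++ [seq ((-1) *: p)%R | p <- s'].
have n1 : (-1)%R != 0%R :> k by rewrite oppr_eq0 oner_eq0.
have gt : good A B b t.
  move=> p; rewrite mem_cat => /orP[/gs //|/mapP[q qs ->]].
  have [Rq [m' cm mq]] := gs' q qs; split; first exact: RelZ.
  by exists m'; [exact: cm|rewrite suppZ].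
have Et : sum t = (sum s - sum s')%R.
  by rewrite /t big_cat /=; congr (_ + _)%R; rewrite big_map -scaler_sumr scaleN1r.
have H := N_good (Q := fun W => wlt W U) IH rb gt; rewrite Et in H.
have Ed : triple A (sum s - sum s')%R B = (triple A (sum s) B - triple A (sum s') B)%R.
  apply: etrans (triple_prod _ _ _) _; apply: etrans (mul_sub_mul _ _ _ _) _.
  exact (esym (f_equal2 (fun u v : kF => (u - v)%R) (triple_prod A (sum s) B) (triple_prod A (sum s') B))).
apply: subr0_eqP; rewrite -lextB -Ed; apply: H => x; rewrite -mcoeff_neq0 mcoeffB => nx.
have nxb : x <> b by move=> e; move: nx; rewrite e c1 c1' subrr eqxx.
rewrite -EU; have [xs|nxs] := boolP (x \in msupp (sum s)); first exact: lay_lt l xs nxb.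
apply: (lay_lt compat tau_ge11 l' _ nxb); rewrite -mcoeff_neq0.
by move: nx; rewrite (mcoeff_outdom nxs) sub0r oppr_eq0.
Qed.

(** Both sides differ from the full product of the two families by terms that lack a leading
    monomial, as in [square_ring]; these terms are combinations of words below [U]. *)
Lemma N_left A1 b B1 s1 A2 m B2 s2 : lay A1 b B1 s1 -> lay A2 m B2 s2 ->
  (A1 * b * B1)%g = U -> (A2 * m * B2)%g = U -> size A1 < size A2 ->
  N (triple A1 (sum s1) B1) = N (triple A2 (sum s2) B2).
Proof.
move=> l1 l2 E1 E2 lt; have [r1 g1 c1 mx1] := l1; have [r2 g2 c2 _] := l2.
have cf : config th th A1 b B1 A2 m B2 by split; [exact: r1|exact: r2|rewrite E1 E2|exact: lt].
have [G [EG EB1 EA2]] : exists G, [/\ G = ((A1 * b)^-1 * A2)%g, B1 = (G * m * B2)%g & A2 = (A1 * b * G)%g].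
  exists ((A1 * b)^-1 * A2)%g; split; first exact: erefl; last by rewrite mulVKg.
  apply: (mulgI (A1 * b)%g); rewrite !mulgA mulgV mul1g.
  by rewrite -[RHS]/(A2 * m * B2)%g E1 E2.
have gB1 : gmono k B1 = (gmono k G * gmono k m * gmono k B2)%R.
  exact (eq_trans (f_equal (fun u : F => gmono k u) EB1) (gmono3 k G m B2)).
have gA2 : gmono k A2 = (gmono k A1 * gmono k b * gmono k G)%R.
  exact (eq_trans (f_equal (fun u : F => gmono k u) EA2) (gmono3 k A1 b G)).
have pair x y p q : p \in s1 -> x \in msupp p -> q \in s2 -> y \in msupp q ->
    x <> b -> x \in msupp (sum s1) -> wlt (A1 * x * G * y * B2)%g U.
  move=> /g1[Rp [b' cb bp]] xp /g2[Rq [m' cm mq]] yq nxb xs; rewrite -E1 EG.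
  apply: (pair_wlt cf cb Rp bp xp cm Rq mq yq); exact: mx1.
pose w1 := sum s1; pose w2 := sum s2.
(* The left position already decreases, so each relator of [s2] can be treated alone, whatever
   monomials it has. *)
have D1 x : x \in msupp (w1 - gmono k b)%R ->
    N (gmono k A1 * gmono k x * (gmono k G * w2 * gmono k B2))%R = 0%R.
  move=> /(supp_sub_mono c1)[xs nxb].
  have -> : (gmono k A1 * gmono k x * (gmono k G * w2 * gmono k B2))%R = triple (A1 * x * G)%g w2 B2.
    apply: etrans (assoc5 _ _ _ _ _) _; apply: etrans (esym (triple_prod _ _ _)).
    exact (f_equal (fun u : kF => u * w2 * gmono k B2)%R (esym (gmono3 k A1 x G))).
  rewrite /w2 triple_sum lext_sum big_seq big1 // => q qs.
  have [p ps xp] := supp_sum xs; have [Rq _] := g2 q qs.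
  by apply: (N_Rel (Q := fun W => wlt W U) IH Rq) => y yq; exact: pair ps xp qs yq nxb xs.
have D2 y : y \in msupp (w2 - gmono k m)%R ->
    N (gmono k A1 * w1 * gmono k G * gmono k y * gmono k B2)%R = 0%R.
  move=> /(supp_sub_mono c2)[ys nym].
  have -> : (gmono k A1 * w1 * gmono k G * gmono k y * gmono k B2)%R = triple A1 w1 (G * y * B2)%g.
    apply: etrans (esym (assoc5 _ _ _ _ _)) _; apply: etrans (esym (triple_prod _ _ _)).
    exact (f_equal (fun u : kF => gmono k A1 * w1 * u)%R (esym (gmono3 k G y B2))).
  have [q qs yq] := supp_sum ys; have [Rq [m' cm mq]] := g2 q qs.
  (* If [y] is not robust, the level drops for every monomial of every relator of [s1], and these
     can be treated one by one. *)
  have [ry|ny] := pselect (robust A2 y B2); last first.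
    rewrite /w1 triple_sum lext_sum big_seq big1 // => p ps.
    have [Rp [b' cb bp]] := g1 p ps; apply: (N_Rel (Q := fun W => wlt W U) IH Rp) => x xp.
    have [_ nlt] := pair_chain_level compat th_ge9 cf cb Rp bp xp cm Rq mq yq.
    by rewrite !mulgA -E1 EG; left; apply: nlt; right.
  (* Here the family [s1] must be kept together: only its sum, not each relator in it, has all other
     classes below that of [b]. The turn to [y] multiplies the whole family by one [f] and keeps it
     good. *)
  have cy := chain_link cm r2 Rq mq yq ry.
  have [f [B1' [Ef rbf H]]] := transfer_right_chain compat th_ge4 cy cf.
  have Ef' : (G * y * B2 = f * B1')%g.
    apply: (mulgI (A1 * b)%g).
    apply: etrans (_ : A2 * y * B2 = _)%g; first by rewrite EA2 !mulgA.
    by rewrite Ef !mulgA.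
  have Es : sum [seq rmul p f | p <- s1] = rmul w1 f.
    by rewrite big_map; exact: esym (gmul_suml _ _ _).
  have Ew : triple A1 w1 (f * B1')%g = triple A1 (sum [seq rmul p f | p <- s1]) B1'.
    exact (etrans (f_equal (lmul A1) (rmulM f B1' w1)) (f_equal (fun u : kF => triple A1 u B1') (esym Es))).
  have gs : good A1 B1' (b * f)%g [seq rmul p f | p <- s1].
    move=> p' /mapP[p ps ->]; have [Rp [b' cb bp]] := g1 p ps.
    have [cbf Rf _] := H _ cb; split; first exact: Rf.
    by exists (b' * f)%g; [exact: cbf|rewrite supp_rmulM].
  rewrite Ef' Ew; apply: (N_good (Q := fun W => wlt W U) IH rbf gs) => x'; rewrite Es supp_rmul.
  have [x Ex] : exists x, x = (x' * f^-1)%g by exists (x' * f^-1)%g.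
  rewrite -Ex => xs.
  have -> : (A1 * x' * B1' = A1 * x * G * y * B2)%g.
    apply: etrans (_ : A1 * x * (G * y * B2) = _)%g; last by rewrite !mulgA.
    by rewrite Ef' Ex !mulgA mulgVK.
  have [->|/eqP nxb] := eqVneq x b.
    rewrite -EA2 -E2; exact: lay_lt l2 ys nym.
  have [p ps xp] := supp_sum xs; exact: pair ps xp qs yq nxb xs.
apply: subr0_eqP; rewrite -lextB.
have -> : (triple A1 (sum s1) B1 - triple A2 (sum s2) B2 =
    gmono k A1 * (w1 - gmono k b) * (gmono k G * w2 * gmono k B2) -
    gmono k A1 * w1 * gmono k G * (w2 - gmono k m) * gmono k B2)%R.
  exact (etrans (f_equal2 (fun u v : kF => u - v)%R (triple_prod A1 w1 B1) (triple_prod A2 w2 B2))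
    (etrans (f_equal2 (fun u v : kF => gmono k A1 * w1 * u - v * w2 * gmono k B2)%R gB1 gA2)
      (square_ring (gmono k A1) w1 (gmono k b) (gmono k G) w2 (gmono k m) (gmono k B2)))).
exact (etrans (lextB nform _ _) (etrans (f_equal2 (fun u v : kF => u - v)%R (lext_mul0 D1) (lext_mul0 D2)) (subrr _))).
Qed.

End Step.

(** A layout at [U] has the same normal form as the chosen one, on which the normal form vanishes by
    construction. *)
Lemma N_lay U : forall A b B s, lay A b B s -> (A * b * B)%g = U -> N (triple A (sum s) B) = 0%R.
Proof.
move: U; apply: (well_founded_ind (wlt_wf Rel th ltK_min)) => U IHU A b B s l EU.
have IH A0 b0 B0 s0 : lay A0 b0 B0 s0 -> wlt (A0 * b0 * B0)%g U -> N (triple A0 (sum s0) B0) = 0%R.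
  by move=> l0 lt; exact: IHU lt _ _ _ _ l0 erefl.
have [[[[A2 m] B2] s2] [El [E2 l2]]] := lay_lead l.
have N2 : N (triple A2 (sum s2) B2) = 0%R := lext_layz El.
rewrite EU in E2; rewrite /= in E2 l2.
have [[r1 _ _ _] [r2 _ _ _]] := (l, l2).
case: (ltngtP (size A) (size A2)) => sz.
- exact: etrans (N_left IH l l2 EU E2 sz) N2.
- exact: etrans (esym (N_left IH l2 l E2 EU sz)) N2.
have [eA eb eB] := fpos_eq compat (robust4 th_ge4 r1) (robust4 th_ge4 r2) (etrans EU (esym E2)) sz.
rewrite -eA -eb -eB in l2 N2.
exact: etrans (N_same IH l l2 EU) N2.
Qed.

Lemma N_Rel0 A p B : Rel p -> N (triple A p B) = 0%R.
Proof.
move=> Rp; apply: (@N_Rel (fun _ => True)) => // D b E s l _; exact: N_lay l erefl.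
Qed.

End Confluence.

(** * Elements of the ideal *)

Section Ideal.
Variables (k : fieldType) (X : choiceType).
Local Notation F := (freegroup X).
Local Notation kF := (galg k F).
Variable Rel : set kF.
Hypothesis compat : compatibility_axiom Rel.
Variable tau : nat.
Hypothesis tau_ge11 : 11 <= tau.
Hypothesis isol : right_isolation_axiom Rel (small_piece_or_letter Rel) tau.
Hypothesis sca : small_cancellation_axiom Rel (small_piece_or_letter Rel) tau.

(** Since [th] is at least 9, a word without positions of threshold 9 carries no layout. So the
    normal form fixes [z], while it vanishes on the ideal. *)
Lemma ideal_support z : gen_ideal Rel z ->
  (forall U A m B : F, U \in msupp z -> U = (A * m * B)%g -> ~ fpos Rel 9 A m B) ->
  z = 0%R.
Proof.
move=> Iz free.
have [ltK [tr tot mn]] := strict_well_order (set (F * F * F)).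
pose N := lext (nform Rel tau mn).
have NRel A p B : Rel p -> N (lmul A (rmul p B)) = 0%R.
  exact: N_Rel0.
(* Vanishing in all contexts is required in order to get a two-sided ideal; linearity of [N] alone
   gives a subspace. *)
pose I : set kF := fun x => forall A B : F, N (lmul A (rmul x B)) = 0%R.
have expand (u v x : kF) : (forall y, N (u * gmono k y * v)%R = 0%R) -> N (u * x * v)%R = 0%R.
  by move=> h; apply: lext_mul0 => y _; exact: h.
have II : two_sided_ideal I.
  split.
  - by move=> A B; rewrite triple0; exact: lext0.
  - move=> x y Ix Iy A B.
    have -> : lmul A (rmul (x + y)%R B) = (lmul A (rmul x B) + lmul A (rmul y B))%R.
      exact (etrans (f_equal (gmul (gmono k A)) (gmulDl x y (gmono k B))) (gmulDr (gmono k A) _ _)).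
    apply: etrans (lextD _ _ _) _.
    exact (etrans (f_equal2 (fun u v : kF => u + v)%R (Ix A B) (Iy A B)) (addr0 _)).
  - move=> a x Ix A B.
    have -> : lmul A (rmul (a * x)%R B) = (gmono k A * a * (x * gmono k B))%R.
      exact (etrans (f_equal (gmul (gmono k A)) (esym (gmulA a x (gmono k B)))) (gmulA _ _ _)).
    apply: expand => y.
    have E : (gmono k A * gmono k y * (x * gmono k B))%R = lmul (A * y)%g (rmul x B).
      exact (f_equal (fun u : kF => gmul u (rmul x B)) (esym (gmonoM k A y))).
    exact (etrans (f_equal N E) (Ix (A * y)%g B)).
  - move=> a x Ix A B.
    have -> : lmul A (rmul (x * a)%R B) = (gmono k A * x * a * gmono k B)%R.
      exact (etrans (gmulA (gmono k A) (gmul x a) (gmono k B)) (f_equal (fun u => gmul u _) (gmulA _ _ _))).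
    apply: expand => y.
    have E : (gmono k A * x * gmono k y * gmono k B)%R = lmul A (rmul x (y * B)%g).
      apply: etrans (esym (gmulA (gmul (gmono k A) x) (gmono k y) (gmono k B))) _.
      apply: etrans (esym (gmulA _ _ _)) _.
      exact (f_equal (fun u : kF => gmul (gmono k A) (gmul x u)) (esym (gmonoM k y B))).
    exact (etrans (f_equal N E) (Ix A (y * B)%g)).
have Nz : N z = 0%R.
  have h := Iz I II (fun p Rp A B => NRel A p B Rp) 1%g 1%g.
  by rewrite lmul1 rmul1 in h.
rewrite [LHS]galgE; apply: etrans Nz; apply: eq_big_seq => U Uz.
congr (_ *: _)%R; apply/esym/nform_free => -[[[A m] B] s] [/= EU [rm _ _ _]].
by apply: (free U A m B Uz (esym EU)); apply: fpos_le rm; lia.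
Qed.

End Ideal.

(** * Free words *)

Section Letters.
Variable X : choiceType.
Local Notation F := (freegroup X).
Local Notation L := (letter X).

(** With at most one generator every word is a power of it. *)
Lemma noncyclic_generators : ~ cyclic_group F -> exists x y : X, x <> y.
Proof.
move=> nc; apply: contrapT => h; apply: nc.
have [[x]|nx] := pselect (exists _ : X, True); last first.
  exists 1%g => u; exists 0; left; rewrite expg0; apply: word_inj.
  by case: (word u) => //= -[x b]; case: nx; exists x.
move=> _; pose g : F := nf [:: (x, false)]; exists g => u; rewrite -[u]wordK.
have eqx y : y = x by apply: contrapT => ne; apply: h; exists y, x.
have step (b : bool) : nf [:: (x, b)] = if b then (g^-1)%g else g.
  by case: b => //; rewrite -[(x, true)]/(linv (x, false)) linv_nf.
elim: (word u) => [|[y b] v [n]]; first by exists 0; left; rewrite nf_nil expg0.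
rewrite -cat1s nfM (eqx y) step; case: b => -[] ->.
- case: n => [|n]; first by exists 1; right; rewrite expg0 mulg1 expg1.
  by exists n; left; rewrite expgS mulKg.
- by exists n.+1; right; rewrite expgSr invgM.
- by exists n.+1; left; rewrite expgS.
- case: n => [|n]; first by exists 1; left; rewrite expg0 invg1 mulg1 expg1.
  by exists n; right; rewrite expgSr invgM mulVKg.
Qed.

(** Two generators give four letters, of which [a] and [b] exclude at most two. *)
Lemma two_letters (a b : L) : ~ cyclic_group F ->
  exists s1 s2 : L, [/\ s1 != s2, s1 \notin [:: a; b] & s2 \notin [:: a; b]].
Proof.
move=> /noncyclic_generators[x [y /eqP nxy]].
pose l : seq L := [:: (x, false); (x, true); (y, false); (y, true)].
have ul : uniq l by rewrite /= !inE !xpair_eqE eqxx (negPf nxy) !andbF.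
pose l' := [seq z <- l | z \notin [:: a; b]].
have sz : 1 < size l'.
  have := count_predC (fun z => z \in [:: a; b]) l; rewrite -!size_filter /= -/l'.
  have : size [seq z <- l | z \in [:: a; b]] <= 2.
    apply: (uniq_leq_size (s2 := [:: a; b])); first exact: filter_uniq.
    by move=> z; rewrite mem_filter => /andP[].
  by rewrite /l'; move: (size _) (size _) => n1 n2; lia.
have ul' : uniq l' by apply: filter_uniq.
have ml z : z \in l' -> z \notin [:: a; b] by rewrite mem_filter => /andP[].
case: l' sz ul' ml => [|s1 [|s2 l']] // _ /= /andP[]; rewrite inE negb_or => /andP[ne _] _ ml.
by exists s1, s2; split=> //; apply: ml; rewrite !inE eqxx ?orbT.
Qed.

End Letters.

Section FreeWords.
Variables (k : fieldType) (X : choiceType).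
Local Notation F := (freegroup X).
Local Notation L := (letter X).
Local Notation kF := (galg k F).
Variable Rel : set kF.
Hypothesis compat : compatibility_axiom Rel.

Local Notation Mw := (Mw Rel).
Local Notation Pw := (Pw Rel).
Local Notation Lam := (Lam Pw).

Let Msub := Mw_sub compat.
Let Psub := Pw_sub compat.
Let Pnil := Pw_nil Rel.
Let Glue := Mw_glue compat.

Section Minimal.
Variable w : F.
Hypothesis nM : ~ Mw w.
Hypothesis shorter : forall v : seq L, reduced v -> v <> [::] -> size v < size w -> Mw v.

(** What lies between the end letters of [w] is a piece: otherwise the two longest proper subwords
    would glue to [w]. The remaining end letter is a letter of [Mon], hence a piece. *)
Lemma proper_Lam (v : seq L) : (exists x : L, word w = x :: v) \/ (exists x : L, word w = rcons v x) ->
  Lam 2 v.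
Proof.
have rw := word_reduced w.
have letterP (x : L) (a b : seq L) : word w = a ++ x :: b -> 1 < size w -> Pw [:: x].
  by move=> E lt; apply: Mw_letter; apply: shorter.
have mid (x y : L) (c : seq L) : word w = x :: rcons c y -> Pw c.
  move=> E; apply: contrapT => nP; apply: nM; rewrite E -cats1 -[x :: _]/([:: x] ++ c ++ [:: y]).
  have rcy : reduced (c ++ [:: y]) by move: rw; rewrite E -cats1 => /(@reduced_catr _ [:: x]).
  have rxc : reduced (x :: c).
    by move: rw; rewrite E -cats1 => /(@reduced_catl _ (x :: c)).
  apply: Glue => //; apply: shorter => //; rewrite ?E /= ?size_rcons ?size_cat /= ?addn1 //.
  by case: (c).
case=> -[x E].
  case/lastP: v E => [|c y] E; first exact: Lam0.
  rewrite -cats1; apply: LamS; first exact: mid E.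
  by apply/(Lam1 Pnil); apply: (letterP y (x :: c) [::]); rewrite E ?cats1 //= size_rcons.
case: v E => [|y c] E; first exact: Lam0.
rewrite -cat1s; apply: LamS; first by apply: (letterP y [::] (rcons c x)); rewrite E //= size_rcons.
by apply/(Lam1 Pnil); apply: mid E.
Qed.

Lemma sub_Lam (a c b : seq L) : word w = a ++ c ++ b -> Mw c -> Lam 2 c.
Proof.
move=> E Mc; case: a => [|x a] in E *.
  case/lastP: b => [|b y] in E *.
    by case: nM; rewrite E cats0.
  have /(Lam_catl Psub) : Lam 2 (c ++ b) by [apply: proper_Lam; right; exists y; rewrite E rcons_cat].
  by [].
have /(Lam_catr Psub)/(Lam_catl Psub) : Lam 2 (a ++ c ++ b) by [apply: proper_Lam; left; exists x].
by [].
Qed.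

Definition blocks (s : seq L) : seq L := flatten [seq rcons (word w) x | x <- s].

Lemma blocks_cat s t : blocks (s ++ t) = blocks s ++ blocks t.
Proof. by rewrite /blocks map_cat flatten_cat. Qed.

Lemma prefix_Lam s (m b : seq L) : blocks s = m ++ b -> Mw m -> Lam 2 m.
Proof.
case: s => [|x s]; first by case: m => // _ _; exact: Lam0.
rewrite /blocks /= -/(blocks s) cat_rcons => /cat_split[] [e].
  by move=> [Em _] Mm; case: nM; apply: (M_catl Msub (v := e)); rewrite -Em.
by move=> [_ [Ew _]]; apply: (@sub_Lam [::] m e).
Qed.

(** A monomial cannot contain [w], so it meets at most two consecutive copies and the letter between
    them: [2 + 1 + 2] pieces. *)
Lemma blocks_Lam s (a m b : seq L) : blocks s = a ++ m ++ b -> Mw m -> Lam 5 m.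
Proof.
elim: s a => [|x s IH] a.
  by case: a => //; case: m => // _ _; exact: Lam0.
rewrite /blocks /= -/(blocks s) => /cat_split[] [e].
  by move=> [_ /IH].
move=> [e0 [Ew Em]] Mm; case/lastP: e e0 Ew Em => // p y _ Ew Em.
have [Ewp Ey] : word w = a ++ p /\ x = y.
  by move: Ew; rewrite -rcons_cat => /rcons_inj[].
have Lp (c d : seq L) : p = c ++ d -> Mw c -> Lam 2 c by move=> E; apply: (@sub_Lam a c d); rewrite Ewp E.
rewrite cat_rcons in Em; case: (cat_split Em) => [[e [Ep _]]|[e [_ [Em' E]]]].
  exact: Lam_le (isT : 2 <= 5) (Lp _ _ Ep Mm).
rewrite Em' -[5]/(2 + 3); apply: Lam_cat.
  apply: (Lp p [::]); rewrite ?cats0 //; apply: (M_catl Msub (v := e)); rewrite -Em'; exact: Mm.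
have Me : Mw e by apply: (M_catr Msub (u := p)); rewrite -Em'.
case: e E Me {Em'} => [|z e]; first by move=> *; exact: Lam0.
move=> [_ E] Me; rewrite -cat1s; apply: LamS.
  by apply: Mw_letter; apply: (M_catl Msub (v := e)).
by apply: prefix_Lam E _; apply: (M_catr Msub (u := [:: z])).
Qed.

Lemma blocks_inj : injective blocks.
Proof.
elim=> [|x s IH] [|y t] //; rewrite /blocks /= -/(blocks _).
- by case: (word w).
- by case: (word w).
by move=> /(cat_inj2 _)[]; rewrite ?size_rcons // => /rcons_inj[->] /IH ->.
Qed.

End Minimal.

Lemma minimal_nonMon : (exists w : F, w <> 1%g /\ ~ Mon Rel w) -> exists w : F,
  [/\ word w <> [::], ~ Mw w &
   forall v : seq L, reduced v -> v <> [::] -> size v < size w -> Mw v].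
Proof.
move=> [w1 [n1 nM1]].
have [|w [w0 nM] mn] := minimal_nat (fun w : F => size w) (Q := fun w => word w <> [::] /\ ~ Mw w).
  by exists w1; split; [move=> h; apply: n1; exact: word_inj|move=> /MwE].
exists w; split=> // v rv v0 lt; apply: contrapT => nv.
by have := mn (nf v); rewrite nfK // leqNgt lt => /(_ (conj v0 nv)).
Qed.

Lemma free_words : ~ cyclic_group F -> (exists w : F, w <> 1%g /\ ~ Mon Rel w) ->
  exists phi : seq 'I_2 -> F, [/\ phi [::] = 1%g,
    forall s t, phi (s ++ t) = (phi s * phi t)%g, injective phi &
    forall s (A m B : F), phi s = (A * m * B)%g -> ~ fpos Rel 9 A m B].
Proof.
move=> nc /minimal_nonMon[w [w0 nM sh]].
case Ew: (word w) w0 => [|x0 w'] // _.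
(* Avoiding the inverses of the first and the last letter of [w] makes all products of blocks
   reduced. *)
have [s1 [s2 [ne h1 h2]]] := two_letters (linv x0) (linv (last x0 w')) nc.
pose sg (i : 'I_2) := if i == ord0 then s1 else s2.
have sgP i : sg i != linv x0 /\ sg i != linv (last x0 w').
  by rewrite /sg; case: ifP => _; [move: h1|move: h2]; rewrite !inE negb_or => /andP[].
have sg_inj : injective sg.
  move=> i j; rewrite /sg; case: eqP => [->|ni]; case: eqP => [->|nj] // e.
  - by move: ne; rewrite e eqxx.
  - by move: ne; rewrite e eqxx.
  apply: val_inj; case: i j ni nj {e} => [[|[|i]] hi] [[|[|j]] hj] // ni nj;
    by [case: ni; exact: val_inj|case: nj; exact: val_inj].
have red s : reduced (blocks w [seq sg i | i <- s]).
  elim: s => // i s IH; rewrite /blocks /= -/(blocks _ _) cat_rcons -cat1s.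
  have [n1 n2] := sgP i; apply: reduced_glue => //.
    have := word_reduced w; rewrite Ew /= /reduced /= cat_path /= => ->; by rewrite n2.
  case: s IH => [|j s] // ; rewrite /blocks /= Ew /= => IH.
  rewrite /reduced /= IH andbT; apply: contra n1 => /eqP ->; by rewrite linvK.
exists (fun s => nf (blocks w [seq sg i | i <- s])); split.
- exact: nf_nil.
- by move=> s t; rewrite map_cat blocks_cat nfM.
- move=> s t /(congr1 (@word X)); rewrite !nfK // => /blocks_inj.
  exact: inj_map.
- move=> s A m B E pm; apply: (pos_Lam pm.2); apply: (@Lam_le _ _ 5) => //.
  apply: (blocks_Lam nM sh (s := [seq sg i | i <- s]) (a := A) (b := B)).
    by rewrite -(fposE pm) -E nfK.
  by case: (pos_max pm.2).
Qed.

End FreeWords.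

(** * The homomorphism from the free algebra *)

Section FreeHom.
Local Open Scope ring_scope.
Variables (k : fieldType) (G : groupType) (Rel : set (galg k G)).
Variable phi : seq 'I_2 -> G.
Hypothesis phi1 : phi [::] = 1%g.
Hypothesis phiM : forall s t, phi (s ++ t) = (phi s * phi t)%g.
Local Notation A := (free_algebra k 'I_2).
Local Notation kG := (galg k G).

Definition wext (z : A) : kG := \sum_(m <- msupp z) z@_m *: gmono k (phi m).

Lemma wextw (d : {fset {fmonom 'I_2}}) z : (msupp z `<=` d)%fset ->
  wext z = \sum_(m <- d) z@_m *: gmono k (phi m).
Proof.
move=> le; rewrite /wext (big_fset_incl _ le) //= => m _ /mcoeff_outdom ->.
by rewrite scale0r.
Qed.

Lemma wextD p q : wext (p + q) = wext p + wext q.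
Proof.
rewrite (wextw (msuppD_le p q)) (wextw (fsubsetUl (msupp p) (msupp q))).
rewrite (wextw (fsubsetUr (msupp p) (msupp q))) -big_split /=.
by apply: eq_bigr => m _; rewrite mcoeffD scalerDl.
Qed.

Lemma wextZ c p : wext (c *: p) = c *: wext p.
Proof.
rewrite (wextw (msuppZ_le c p)) scaler_sumr.
by apply: eq_bigr => m _; rewrite mcoeffZ scalerA.
Qed.

Lemma wext0 : wext 0 = 0.
Proof. by rewrite /wext msupp0 big_seq_fset0. Qed.

Lemma wextB p q : wext (p - q) = wext p - wext q.
Proof. by rewrite -scaleN1r wextD wextZ scaleN1r. Qed.

Lemma wextU c m : wext << c *g m >> = c *: gmono k (phi m).
Proof. by rewrite (wextw msuppU_le) big_seq_fset1 mcoeffUU. Qed.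

Lemma wext_sum (I : Type) (s : seq I) (E : I -> A) :
  wext (\sum_(i <- s) E i) = \sum_(i <- s) wext (E i).
Proof. exact: (big_morph wext wextD wext0). Qed.

Lemma wextM p q : wext (p * q) = wext p * wext q.
Proof.
rewrite malgME wext_sum.
apply: etrans (esym (gmul_suml _ _ (wext q))); apply: eq_bigr => m _.
rewrite wext_sum.
apply: etrans (esym (gmul_sumr _ _ _)); apply: eq_bigr => n _.
rewrite wextU fmM phiM -scalerA.
apply: etrans (esym (gmul_scalel _ _ _)); congr (_ *: _).
apply: etrans (esym (gmul_scaler _ _ _)); congr (_ *: _).
exact: gmonoM.
Qed.

Lemma wext1 : wext 1 = 1.
Proof. by rewrite wextU scale1r fm1 phi1. Qed.

Lemma wext_supp z x : x \in msupp (wext z) -> exists2 m : {fmonom 'I_2}, m \in msupp z & x = phi m.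
Proof.
rewrite -mcoeff_neq0 => nx; apply: contrapT => h; case/eqP: nx.
rewrite /wext raddf_sum big_seq big1 // => m mz /=.
rewrite mcoeffZ mcoeffU; case: eqP => [e|_]; last by rewrite mulr0.
by case: h; exists m.
Qed.

Lemma wext_inj z : injective phi -> wext z = 0 -> z = 0.
Proof.
move=> pinj wz; apply/malgP => m; rewrite mcoeff0.
have [mz|/mcoeff_outdom //] := boolP (m \in msupp z).
have := congr1 (mcoeff (phi m)) wz; rewrite mcoeff0 /wext raddf_sum (big_rem m mz) /=.
rewrite mcoeffZ mcoeffU eqxx mulr1 big_seq big1 ?addr0 // => n.
rewrite (mem_rem_uniq _ (fset_uniq (msupp z))) inE => /andP[ne _].
rewrite mcoeffZ mcoeffU; case: eqP => [/pinj e|_]; last by rewrite mulr0.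
by case/eqP: ne; apply: val_inj.
Qed.

Definition free_hom (z : A) : quot_alg Rel := toq Rel (wext z).

Lemma free_homB : zmod_morphism free_hom.
Proof. 
move=> p q; rewrite /free_hom wextB -[- wext q]scaleN1r toqD toqZ.
by rewrite -scaleN1r.
Qed.

Lemma free_homZ : scalable free_hom.
Proof. by move=> c p; rewrite /free_hom wextZ toqZ. Qed.

Lemma free_homM : monoid_morphism free_hom.
Proof. by split=> [|p q]; rewrite /free_hom ?wext1 // wextM toqM. Qed.

End FreeHom.

Local Open Scope ring_scope.

Theorem theorem3 (k : fieldType) (X : choiceType)
    (Rel : set (galg k (freegroup X))) (tau : nat)
    (noncyclic : ~ cyclic_group (freegroup X))
    (compat : compatibility_axiom Rel)
    (tau_ge11 : (11 <= tau)%N)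
    (small_canc :
       small_cancellation_axiom Rel (small_piece_or_letter Rel) tau)
    (isol : isolation_axiom Rel (small_piece_or_letter Rel) tau)
    (notMon : exists w : freegroup X, w <> 1%g /\ ~ Mon Rel w) :
  exists f : {lrmorphism free_algebra k 'I_2 -> quot_alg Rel}, injective f.
Proof.
have [phi [phi1 phiM phi_inj free]] := free_words compat noncyclic notMon.
pose f : {lrmorphism free_algebra k 'I_2 -> quot_alg Rel} := HB.pack (free_hom Rel phi)
  (GRing.isZmodMorphism.Build _ _ _ (free_homB Rel phi))
  (GRing.isScalable.Build _ _ _ _ _ (free_homZ Rel phi))
  (GRing.isMonoidMorphism.Build _ _ _ (free_homM Rel phi1 phiM)).
exists f => z z' /eqP/toqP.
rewrite -wextB => Iz; apply/eqP; rewrite -subr_eq0; apply/eqP.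
(* The image of [z - z'] lies in the ideal but is supported on block words, which carry no position,
   so it vanishes already in the group algebra. *)
apply: (wext_inj phi_inj); apply: (ideal_support compat tau_ge11 isol.2 small_canc Iz).
move=> U A m B /wext_supp[s _ ->] E; exact: free E.
Qed.
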